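(* Let $g\in H(\mathbb{D})$ be such that $\log(g')\in\mathcal{B}$, let $\nu$ be an analytic weight and let $\mu$ be an arbitrary weight. Then $T_g: H^{\infty}_\nu\rightarrow H^{\infty}_\mu$ is compact if and only if $$\lim_{t_2\rightarrow1^-}\limsup_{t_1\rightarrow1^-}\sup_{0\leq\theta<2\pi}\mu(t_1)\int_{t_2}^{t_1}\frac{|g'(re^{i\theta})|}{\nu(r)}\,dr=0\,.$$
   Context: $\mathbb{D}$ is the open unit disk and $H(\mathbb{D})$ the space of analytic functions on $\mathbb{D}$. A weight is a non-negative continuous function $\nu$ on $\mathbb{D}$ with $\nu(z)=\nu(|z|)$ for all $z$, which is decreasing in $|z|$; we write $\nu(r)$ for its value at $|z|=r$. For a weight $\nu$, $H^{\infty}_\nu=\{f\in H(\mathbb{D}): \|f\|_{H^\infty_\nu}:=\sup_{z\in\mathbb{D}}\nu(z)|f(z)|<\infty\}$. The Bloch space is $\mathcal{B}=\{f\in H(\mathbb{D}): |f(0)|+\sup_{z}(1-|z|^2)|f'(z)|<\infty\}$; ''$\log(g')\in\mathcal{B}$'' means $g'$ has no zeros in $\mathbb{D}$ and an analytic branch of $\log g'$ belongs to $\mathcal{B}$. A weight $\nu$ is analytic if $\nu(z)=1/F(|z|)$ for some $F\in H(\mathbb{D})$ with $|F(z)|\leq F(|z|)$ for all $z$. For $g\in H(\mathbb{D})$, $(T_gf)(z)=\int_0^z f(\omega)g'(\omega)\,d\omega$. *)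

(* Defs.v *)
From Stdlib Require Import Reals.
From Coquelicot Require Import Coquelicot.
Open Scope R_scope.

Definition inD (z : C) : Prop := Cmod z < 1.

Definition holo (f : C -> C) : Prop :=
  forall z : C, inD z -> ex_derive f z.

Definition is_deriv_on_D (f fp : C -> C) : Prop :=
  forall z : C, inD z -> is_derive f z (fp z).

Definition cexp (z : C) : C :=
  (exp (Re z) * cos (Im z), exp (Re z) * sin (Im z)).

(* log g' in the Bloch space: g' has an analytic logarithm h on D
   (exp h = g', which forces g' zero-free) with
   |h 0| + sup (1-|z|^2)|h'(z)| finite. *)
Definition log_deriv_in_Bloch (gp : C -> C) : Prop :=
  exists h hp : C -> C,
    is_deriv_on_D h hp /\
    (forall z, inD z -> cexp (h z) = gp z) /\
    exists M : R, forall z, inD z ->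
      Cmod (h 0) + (1 - Cmod z ^ 2) * Cmod (hp z) <= M.

Definition weight (w : C -> R) : Prop :=
  (forall z, inD z -> 0 <= w z) /\
  (forall z, inD z -> continuous w z) /\
  (forall z, inD z -> w z = w (RtoC (Cmod z))) /\
  (forall z1 z2, inD z1 -> inD z2 -> Cmod z1 <= Cmod z2 -> w z2 <= w z1).

(* analytic weight: w(z) = 1 / F(|z|) with F analytic on D and |F z| <= F(|z|)
   (in particular F(|z|) is real, and positive) *)
Definition analytic_weight (w : C -> R) : Prop :=
  weight w /\
  exists F : C -> C, holo F /\
    forall z, inD z ->
      Im (F (RtoC (Cmod z))) = 0 /\
      w z * Re (F (RtoC (Cmod z))) = 1 /\
      Cmod (F z) <= Re (F (RtoC (Cmod z))).

Definition wnorm_le (w : C -> R) (f : C -> C) (M : R) : Prop :=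
  forall z, inD z -> w z * Cmod (f z) <= M.

Definition Hinf (w : C -> R) (f : C -> C) : Prop :=
  holo f /\ exists M, wnorm_le w f M.

(* Volterra operator: (T_g f)(z) = int_0^z f(omega) g'(omega) d omega,
   integrated along the segment [0,z] *)
Definition Tg (gp : C -> C) (f : C -> C) (z : C) : C :=
  @RInt C_R_CompleteNormedModule
    (fun t : R => Cmult (Cmult (f (Cmult (RtoC t) z)) (gp (Cmult (RtoC t) z))) z) 0 1.

Definition Tg_compact (gp : C -> C) (nu mu : C -> R) : Prop :=
  (forall f, Hinf nu f -> Hinf mu (Tg gp f)) /\
  forall (fs : nat -> C -> C) (B : R),
    (forall n, holo (fs n) /\ wnorm_le nu (fs n) B) ->
    exists (phi : nat -> nat) (h : C -> C),
      (forall k, (phi k < phi (S k))%nat) /\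
      Hinf mu h /\
      forall eps, 0 < eps -> exists N, forall k, (N <= k)%nat ->
        wnorm_le mu (fun z => Cminus (Tg gp (fs (phi k)) z) (h z)) eps.

Definition Iquant (gp : C -> C) (nu mu : C -> R) (t1 t2 theta : R) : R :=
  mu (RtoC t1) *
  RInt (fun r : R => Cmod (gp (r * cos theta, r * sin theta)) / nu (RtoC r)) t2 t1.

(* lim_{t2 -> 1-} limsup_{t1 -> 1-} sup_{0 <= theta < 2 pi} Iquant = 0,
   written out with epsilons (the quantity is >= 0 for t1 > t2). *)
Definition limit_condition (gp : C -> C) (nu mu : C -> R) : Prop :=
  forall eps, 0 < eps ->
    exists d, d < 1 /\
      forall t2, d < t2 < 1 ->
        exists e, e < 1 /\
          forall t1, e < t1 < 1 ->
            forall theta, 0 <= theta < 2 * PI ->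
              Iquant gp nu mu t1 t2 theta <= eps.

(* Main.v *)
Require Import Defs.
From Stdlib Require Import Reals Lra Lia Classical ClassicalEpsilon Cantor.
From Coquelicot Require Import Coquelicot.
Open Scope R_scope.

(** Sufficiency.  If [f_n] is bounded in [H^infty_nu], Montel gives a subsequence converging locally
uniformly to some [f], and [T_g f] is the limit of the images: inside a disk this is uniform
convergence, and on the tail of each ray the limit condition bounds [mu |T_g (f_n - f)|].

Necessity.  On a ray at angle [th] the phase of [g'] is [u(r) = Im log g'(r e^(i th))], and the Bloch
condition makes [u] Lipschitz in [ln (1-r)].  Mollifying [exp(-iu)] in that variable gives a bounded
analytic [S], with bounds depending only on the Bloch norm, such that [Re (S e^(iu)) >= c > 0] on the
ray.  If [nu = 1/F], the functions [z^n F(z) S(z)], rotated by [th], are bounded in [H^infty_nu],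
their images tend to [0] pointwise, and those images are at least
[(c/2) int_{t2}^{t1} |g'|/nu dr] at [t1 e^(i th)] as soon as [t2^n >= 1/2]; compactness then forces
the limit condition. *)

(** * Complex derivatives and integrals of complex-valued functions *)

(** The obstacle in the necessity is cancellation: [Tg f] integrates [f * g'], the condition
    integrates [|g'|]. So [f] has to undo the phase of [g'] along a whole ray and yet be analytic on
    the disk, with bounds that do not depend on the ray, on [t1] or on [n]. The exact conjugate
    phase is not analytic, but the phase turns little over a fixed logarithmic distance, so it is
    enough to sample it at the radii [1 - q^k] and to sum bumps of that width. The bump is
    [1/cosh^2 (s/2)] with [s = ln y], which is the rational function [4y/(1+y)^2]. A high power of
    it makes the samples with a wrong phase negligible against the nearest one. Finitely many
    samples, reaching beyond [t1], are used.

    In the sufficiency, the Montel limit [f] is treated as a continuous function. What must be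
    analytic is [Tg f], and this comes from a mean value inequality that passes to the limit.
    Montel's theorem itself rests on Taylor coefficients: a diagonal extraction makes all of them
    Cauchy, and a finite expansion with remainder turns this into locally uniform convergence. *)

Lemma Cmod_minus_sym (z w : C) : Cmod (z - w)%C = Cmod (w - z)%C.
Proof. rewrite <- Cmod_opp. f_equal. ring. Qed.

Lemma Cmod_triangle_minus (z w : C) : Cmod (z - w)%C <= Cmod z + Cmod w.
Proof.
  unfold Cminus. rewrite <- (Cmod_opp w). apply Cmod_triangle.
Qed.

Lemma Cmod_triangle_inv (z w : C) : Cmod z - Cmod w <= Cmod (z - w)%C.
Proof.
  replace z with ((z - w) + w)%C at 1 by ring.
  generalize (Cmod_triangle (z - w)%C w). lra.
Qed.

Lemma Cmod_le_Rabs (x y : R) : Cmod (x, y) <= Rabs x + Rabs y.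
Proof.
  replace ((x, y) : C) with (RtoC x + Ci * RtoC y)%C.
  - eapply Rle_trans. apply Cmod_triangle.
    rewrite Cmod_mult, !Cmod_R, Cmod_Ci. lra.
  - unfold Cplus, Cmult, RtoC, Ci; simpl; f_equal; ring.
Qed.

Lemma Rabs_fst_le_Cmod (z : C) : Rabs (fst z) <= Cmod z.
Proof. eapply Rle_trans. 2: apply Rmax_Cmod. apply Rmax_l. Qed.

Lemma Rabs_snd_le_Cmod (z : C) : Rabs (snd z) <= Cmod z.
Proof. eapply Rle_trans. 2: apply Rmax_Cmod. apply Rmax_r. Qed.

(** * Continuity and differentiability on [C] in epsilon form *)

Definition cont (f : C -> C) (z : C) : Prop :=
  @continuous C_UniformSpace C_UniformSpace f z.

Lemma locally_C_eps (z : C) (P : C -> Prop) :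
  @locally C_UniformSpace z P <->
  exists d, 0 < d /\ forall w, Cmod (w - z)%C < d -> P w.
Proof.
  split.
  - intros [d Hd]. exists d. split. apply cond_pos.
    intros w Hw. apply Hd. apply C_NormedModule_mixin_compat1. exact Hw.
  - intros (d & Hd & H). apply locally_C. exists (mkposreal d Hd).
    intros w Hw. apply H. exact Hw.
Qed.

Lemma cont_eps (f : C -> C) (z : C) :
  cont f z <-> forall e, 0 < e -> exists d, 0 < d /\
     forall w, Cmod (w - z)%C < d -> Cmod (f w - f z)%C < e.
Proof.
  split.
  - intros H e He.
    assert (L : @locally C_UniformSpace (f z) (fun y => Cmod (y - f z)%C < e)).
    { apply locally_C_eps. exists e. split; auto. }
    apply H in L. apply locally_C_eps in L. exact L.
  - intros H. unfold cont, continuous, filterlim, filter_le, filtermap.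
    intros P HP. apply locally_C_eps in HP. destruct HP as (e & He & HP).
    destruct (H e He) as (d & Hd & H').
    apply locally_C_eps. exists d. split; auto.
Qed.

(** Replaces filters by [Cmod] estimates. The linear map of the derivative is complex multiplication
    by [l], hence complex differentiability. *)
Lemma is_derive_C_eps (f : C -> C) (z l : C) :
  is_derive f z l <-> forall e, 0 < e -> exists d, 0 < d /\
     forall w, Cmod (w - z)%C < d ->
       Cmod (f w - f z - (w - z) * l)%C <= e * Cmod (w - z)%C.
Proof.
  split.
  - intros [_ H] e He.
    specialize (H z (fun P HP => HP) (mkposreal e He)).
    apply locally_C, locally_C_eps in H. destruct H as (d & Hd & H).
    exists d; split; [exact Hd|]. intros w Hw. specialize (H w Hw).
    exact H.
  - intros H. split.
    + apply is_linear_scal_l.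
    + intros x Hx. apply (@is_filter_lim_locally_unique C_AbsRing (AbsRing_NormedModule C_AbsRing)) in Hx. subst x.
      intros e. apply locally_C, locally_C_eps.
      destruct (H e (cond_pos e)) as (d & Hd & H').
      exists d; split; [exact Hd|]. intros w Hw. apply H'; auto.
Qed.

Lemma is_derive_R_eps (f : R -> C) (t : R) (l : C) :
  @is_derive R_AbsRing C_R_NormedModule f t l <->
  forall e, 0 < e -> exists d, 0 < d /\
     forall s, Rabs (s - t) < d ->
       Cmod (f s - f t - RtoC (s - t) * l)%C <= e * Rabs (s - t).
Proof.
  split.
  - intros [_ H] e He.
    specialize (H t (fun P HP => HP) (mkposreal e He)).
    destruct H as [d H]. exists d; split; [apply cond_pos|].
    intros w Hw. specialize (H w Hw).
    rewrite <- Cmod_norm, scal_R_Cmult in H. exact H.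
  - intros H. split.
    + apply is_linear_scal_l.
    + intros x Hx. apply (@is_filter_lim_locally_unique R_AbsRing (AbsRing_NormedModule R_AbsRing)) in Hx. subst x.
      intros e.
      destruct (H e (cond_pos e)) as (d & Hd & H').
      exists (mkposreal d Hd). intros w Hw. rewrite <- Cmod_norm, scal_R_Cmult.
      apply H'; auto.
Qed.

Lemma is_derive_C_cont (f : C -> C) (z l : C) : is_derive f z l -> cont f z.
Proof.
  intros H. apply cont_eps. intros e He.
  destruct (proj1 (is_derive_C_eps f z l) H 1 Rlt_0_1) as (d & Hd & H').
  pose proof (Cmod_ge_0 l).
  exists (Rmin d (e / (2 + Cmod l))). split.
  { apply Rmin_pos; auto. apply Rdiv_lt_0_compat; lra. }
  intros w Hw.
  assert (H1 : Cmod (w - z)%C < d) by (eapply Rlt_le_trans; [apply Hw | apply Rmin_l]).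
  assert (H2 : Cmod (w - z)%C < e / (2 + Cmod l)) by (eapply Rlt_le_trans; [apply Hw | apply Rmin_r]).
  specialize (H' w H1).
  replace (f w - f z)%C with ((f w - f z - (w - z) * l) + (w - z) * l)%C by ring.
  eapply Rle_lt_trans. apply Cmod_triangle. rewrite Cmod_mult.
  apply (Rmult_lt_compat_r (2 + Cmod l)) in H2; [|lra].
  unfold Rdiv in H2. rewrite Rmult_assoc, Rinv_l, Rmult_1_r in H2 by lra.
  pose proof (Cmod_ge_0 (w - z)%C). nra.
Qed.

Lemma ex_derive_C_cont (f : C -> C) (z : C) : ex_derive f z -> cont f z.
Proof. intros [l H]. eapply is_derive_C_cont; eauto. Qed.

Lemma is_derive_C_comp_R (f : C -> C) (p : R -> C) (t : R) (l d : C) :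
  is_derive f (p t) l ->
  @is_derive R_AbsRing C_R_NormedModule p t d ->
  @is_derive R_AbsRing C_R_NormedModule (fun s => f (p s)) t (l * d)%C.
Proof.
  rewrite is_derive_C_eps, !is_derive_R_eps. intros Hf Hp e He.
  pose proof (Cmod_ge_0 l). pose proof (Cmod_ge_0 d).
  (* The minimum serves two purposes: [e1 <= 1] bounds the increment of [p] by
     [(1 + |d|) * |s - t|], and [e1 * |l| <= e/2] leaves half of the error for [f]. *)
  assert (He1 : 0 < Rmin 1 (e / (2 * (1 + Cmod l)))).
  { apply Rmin_pos. lra. apply Rdiv_lt_0_compat; lra. }
  set (e1 := Rmin 1 (e / (2 * (1 + Cmod l)))) in *.
  assert (H1 : e1 <= 1) by apply Rmin_l.
  assert (H2 : e1 * Cmod l <= e / 2).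
  { assert (H2 : e1 <= e / (2 * (1 + Cmod l))) by apply Rmin_r.
    apply (Rmult_le_compat_r (1 + Cmod l)) in H2; [|lra].
    replace (e / (2 * (1 + Cmod l)) * (1 + Cmod l)) with (e / 2) in H2 by (field; lra).
    nra. }
  destruct (Hp e1 He1) as (d1 & Hd1 & Hp').
  assert (He2 : 0 < e / (2 * (1 + Cmod d))) by (apply Rdiv_lt_0_compat; lra).
  destruct (Hf _ He2) as (d2 & Hd2 & Hf').
  exists (Rmin d1 (d2 / (1 + Cmod d))). split.
  { apply Rmin_pos; auto. apply Rdiv_lt_0_compat; lra. }
  intros s Hs.
  assert (Hs1 : Rabs (s - t) < d1) by (eapply Rlt_le_trans; [apply Hs | apply Rmin_l]).
  assert (Hs2 : Rabs (s - t) < d2 / (1 + Cmod d)) by (eapply Rlt_le_trans; [apply Hs | apply Rmin_r]).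
  specialize (Hp' s Hs1). pose proof (Rabs_pos (s - t)).
  assert (Hb : Cmod (p s - p t)%C <= (1 + Cmod d) * Rabs (s - t)).
  { replace (p s - p t)%C with ((p s - p t - RtoC (s - t) * d) + RtoC (s - t) * d)%C by ring.
    eapply Rle_trans. apply Cmod_triangle. rewrite Cmod_mult, Cmod_R. nra. }
  assert (Hb2 : Cmod (p s - p t)%C < d2).
  { eapply Rle_lt_trans. apply Hb. apply (Rmult_lt_compat_l (1 + Cmod d)) in Hs2; [|lra].
    replace ((1 + Cmod d) * (d2 / (1 + Cmod d))) with d2 in Hs2 by (field; lra). lra. }
  specialize (Hf' _ Hb2).
  replace (f (p s) - f (p t) - RtoC (s - t) * (l * d))%C with
    ((f (p s) - f (p t) - (p s - p t) * l) + l * (p s - p t - RtoC (s - t) * d))%C by ring.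
  eapply Rle_trans. apply Cmod_triangle. rewrite Cmod_mult.
  apply Rle_trans with (e / 2 * Rabs (s - t) + e / 2 * Rabs (s - t)); [|lra].
  apply Rplus_le_compat.
  - eapply Rle_trans. apply Hf'.
    apply Rle_trans with (e / (2 * (1 + Cmod d)) * ((1 + Cmod d) * Rabs (s - t))).
    + apply Rmult_le_compat_l; lra.
    + right. field. lra.
  - apply Rle_trans with (Cmod l * (e1 * Rabs (s - t))).
    + apply Rmult_le_compat_l; lra.
    + nra.
Qed.

(* [C_NormedModule] and [AbsRing_NormedModule C_AbsRing] carry the same norm but non-convertible uniform structures. *)
Lemma is_derive_C_AbsRing (f : C -> C) (z l : C) :
  @is_derive C_AbsRing C_NormedModule f z l <->
  @is_derive C_AbsRing (AbsRing_NormedModule C_AbsRing) f z l.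
Proof.
  split; intros [_ H]; (split; [apply is_linear_scal_l | exact H]).
Qed.

Lemma is_derive_C_mult (f g : C -> C) (z lf lg : C) :
  is_derive f z lf -> is_derive g z lg ->
  is_derive (fun w => f w * g w)%C z (lf * g z + f z * lg)%C.
Proof.
  rewrite !is_derive_C_AbsRing. intros Hf Hg.
  apply (is_derive_mult f g z lf lg Hf Hg). apply Cmult_comm.
Qed.

Lemma is_derive_C_plus (f g : C -> C) (z lf lg : C) :
  is_derive f z lf -> is_derive g z lg ->
  is_derive (fun w => f w + g w)%C z (lf + lg)%C.
Proof. intros Hf Hg. exact (is_derive_plus f g z lf lg Hf Hg). Qed.

Lemma is_derive_C_minus (f g : C -> C) (z lf lg : C) :
  is_derive f z lf -> is_derive g z lg ->
  is_derive (fun w => f w - g w)%C z (lf - lg)%C.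
Proof. intros Hf Hg. exact (is_derive_minus f g z lf lg Hf Hg). Qed.

Lemma is_derive_C_const (c z : C) : is_derive (fun _ : C => c) z (RtoC 0).
Proof. exact (is_derive_const c z). Qed.

Lemma is_derive_C_id (z : C) : is_derive (fun w : C => w) z (RtoC 1).
Proof. apply is_derive_C_AbsRing. exact (is_derive_id z). Qed.

Lemma is_derive_C_comp (f g : C -> C) (z lf lg : C) :
  is_derive f (g z) lf -> is_derive g z lg ->
  is_derive (fun w => f (g w)) z (lg * lf)%C.
Proof.
  rewrite (is_derive_C_AbsRing g). intros Hf Hg. exact (is_derive_comp f g z lf lg Hf Hg).
Qed.

Lemma is_derive_C_inv (z : C) : z <> RtoC 0 ->
  is_derive (fun w : C => / w)%C z (- / (z * z))%C.
Proof.
  intros Hz. apply is_derive_C_eps. intros e He.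
  assert (Hm : 0 < Cmod z) by (apply Cmod_gt_0; auto).
  set (m := Cmod z) in *.
  assert (Hp : 0 < m ^ 3) by (apply pow_lt; auto).
  (* The error term is exactly [(w - z)^2 / (z^2 w)]. The first bound keeps [|w| > m/2]; with it the
     second makes the error at most [e * |w - z|]. *)
  exists (Rmin (m / 2) (e * m ^ 3 / 2)). split.
  { apply Rmin_pos. lra. apply Rdiv_lt_0_compat; nra. }
  intros w Hw.
  assert (H1 : Cmod (w - z)%C < m / 2) by (eapply Rlt_le_trans; [apply Hw | apply Rmin_l]).
  assert (H2 : Cmod (w - z)%C < e * m ^ 3 / 2) by (eapply Rlt_le_trans; [apply Hw | apply Rmin_r]).
  assert (Hw' : m / 2 < Cmod w).
  { pose proof (Cmod_triangle_inv z w). rewrite Cmod_minus_sym in H. fold m in H. lra. }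
  assert (w <> RtoC 0) by (apply Cmod_gt_0; lra).
  replace (/ w - / z - (w - z) * - / (z * z))%C with ((w - z) * (w - z) / (z * z * w))%C
    by (field; auto).
  rewrite Cmod_div by (repeat apply Cmult_neq_0; auto).
  rewrite !Cmod_mult. fold m. pose proof (Cmod_ge_0 (w - z)%C).
  apply (Rmult_le_reg_r (m * m * Cmod w)). { apply Rmult_lt_0_compat; nra. }
  unfold Rdiv at 1. rewrite Rmult_assoc, Rinv_l, Rmult_1_r.
  2:{ apply Rgt_not_eq. apply Rmult_lt_0_compat; nra. }
  replace (e * Cmod (w - z)%C * (m * m * Cmod w)) with (Cmod (w - z)%C * (e * (m * m * Cmod w))) by ring.
  apply Rmult_le_compat_l; auto.
  assert (e * (m * m * (m / 2)) <= e * (m * m * Cmod w)).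
  { apply Rmult_le_compat_l. lra. apply Rmult_le_compat_l. nra. lra. }
  simpl in H2. nra.
Qed.

Lemma ex_derive_C_mult (f g : C -> C) (z : C) :
  ex_derive f z -> ex_derive g z -> ex_derive (fun w => f w * g w)%C z.
Proof. intros [a Ha] [b Hb]. eexists. apply is_derive_C_mult; eauto. Qed.

Lemma ex_derive_C_plus (f g : C -> C) (z : C) :
  ex_derive f z -> ex_derive g z -> ex_derive (fun w => f w + g w)%C z.
Proof. intros [a Ha] [b Hb]. eexists. apply is_derive_C_plus; eauto. Qed.

Lemma ex_derive_C_minus (f g : C -> C) (z : C) :
  ex_derive f z -> ex_derive g z -> ex_derive (fun w => f w - g w)%C z.
Proof. intros [a Ha] [b Hb]. eexists. apply is_derive_C_minus; eauto. Qed.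

Lemma ex_derive_C_const (c z : C) : ex_derive (fun _ : C => c) z.
Proof. eexists. apply is_derive_C_const. Qed.

Lemma ex_derive_C_id (z : C) : ex_derive (fun w : C => w) z.
Proof. eexists. apply is_derive_C_id. Qed.

Lemma ex_derive_C_comp (f g : C -> C) (z : C) :
  ex_derive f (g z) -> ex_derive g z -> ex_derive (fun w => f (g w)) z.
Proof. intros [a Ha] [b Hb]. eexists. apply is_derive_C_comp; eauto. Qed.

Lemma ex_derive_C_div (f g : C -> C) (z : C) : g z <> RtoC 0 ->
  ex_derive f z -> ex_derive g z -> ex_derive (fun w => f w / g w)%C z.
Proof.
  intros Hz Hf Hg. apply ex_derive_C_mult; auto.
  apply (ex_derive_C_comp (fun w => / w)%C g); auto.
  eexists. apply is_derive_C_inv; auto.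
Qed.

Lemma ex_derive_C_pow (f : C -> C) (n : nat) (z : C) :
  ex_derive f z -> ex_derive (fun w => Cpow (f w) n) z.
Proof.
  intros Hf. induction n; simpl.
  - apply ex_derive_C_const.
  - apply ex_derive_C_mult; auto.
Qed.

Lemma ex_derive_C_ext_loc (f g : C -> C) (z : C) :
  (exists d, 0 < d /\ forall w, Cmod (w - z)%C < d -> f w = g w) ->
  ex_derive f z -> ex_derive g z.
Proof.
  intros (d & Hd & H) Hf. eapply ex_derive_ext_loc; [|exact Hf].
  apply locally_C, locally_C_eps. exists d; auto.
Qed.

Lemma inD_open (z : C) : inD z -> exists d, 0 < d /\ forall w, Cmod (w - z)%C < d -> inD w.
Proof.
  intros H. exists (1 - Cmod z). unfold inD in *. split. lra.
  intros w Hw. pose proof (Cmod_triangle_inv w z). lra.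
Qed.

(** * Integrals of complex-valued functions over real intervals *)

Notation CI := (@RInt C_R_CompleteNormedModule).
Notation ex_CI := (@ex_RInt C_R_NormedModule).
Notation is_CI := (@is_RInt C_R_NormedModule).

Definition contR (p : R -> C) (t : R) : Prop := @continuous R_UniformSpace C_UniformSpace p t.

Lemma ex_CI_cont (p : R -> C) (a b : R) :
  (forall t, Rmin a b <= t <= Rmax a b -> contR p t) -> ex_CI p a b.
Proof. intros H. apply (@ex_RInt_continuous C_R_CompleteNormedModule). exact H. Qed.

Lemma CI_correct (p : R -> C) (a b : R) : ex_CI p a b -> is_CI p a b (CI p a b).
Proof. intros H. apply (@RInt_correct C_R_CompleteNormedModule). exact H. Qed.

Lemma is_CI_unique (p : R -> C) (a b : R) (l : C) : is_CI p a b l -> CI p a b = l.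
Proof. intros H. apply (@is_RInt_unique C_R_CompleteNormedModule). exact H. Qed.

Lemma is_CI_pair (p : R -> C) (a b : R) (l : C) :
  is_CI p a b l <->
  is_RInt (fun t => fst (p t)) a b (fst l) /\ is_RInt (fun t => snd (p t)) a b (snd l).
Proof.
  split.
  - intros H. split.
    + apply (@is_RInt_fct_extend_fst R_NormedModule R_NormedModule p a b l H).
    + apply (@is_RInt_fct_extend_snd R_NormedModule R_NormedModule p a b l H).
  - intros [H1 H2].
    apply (@is_RInt_fct_extend_pair R_NormedModule R_NormedModule p a b (fst l) (snd l)) in H1; auto.
Qed.

Lemma is_CI_plus (p q : R -> C) (a b : R) (l m : C) :
  is_CI p a b l -> is_CI q a b m -> is_CI (fun t => p t + q t)%C a b (l + m)%C.
Proof. intros H1 H2. exact (is_RInt_plus p q a b l m H1 H2). Qed.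

Lemma is_CI_minus (p q : R -> C) (a b : R) (l m : C) :
  is_CI p a b l -> is_CI q a b m -> is_CI (fun t => p t - q t)%C a b (l - m)%C.
Proof. intros H1 H2. exact (is_RInt_minus p q a b l m H1 H2). Qed.

(** The scalars of [C_R_NormedModule] are real, so a complex factor is multiplied out in
    coordinates. *)
Lemma is_CI_scal (c : C) (p : R -> C) (a b : R) (l : C) :
  is_CI p a b l -> is_CI (fun t => c * p t)%C a b (c * l)%C.
Proof.
  rewrite !is_CI_pair. intros [H1 H2]. simpl. split.
  - exact (is_RInt_minus _ _ a b _ _ (is_RInt_scal _ a b (fst c) _ H1) (is_RInt_scal _ a b (snd c) _ H2)).
  - exact (is_RInt_plus _ _ a b _ _ (is_RInt_scal _ a b (fst c) _ H2) (is_RInt_scal _ a b (snd c) _ H1)).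
Qed.

Lemma is_CI_ext (p q : R -> C) (a b : R) (l : C) :
  (forall t, Rmin a b < t < Rmax a b -> p t = q t) -> is_CI p a b l -> is_CI q a b l.
Proof. intros H. apply (@is_RInt_ext C_R_NormedModule). exact H. Qed.

Lemma CI_scal (c : C) (p : R -> C) (a b : R) : ex_CI p a b ->
  CI (fun t => c * p t)%C a b = (c * CI p a b)%C.
Proof. intros H. apply is_CI_unique, is_CI_scal, CI_correct, H. Qed.

Lemma CI_minus (p q : R -> C) (a b : R) : ex_CI p a b -> ex_CI q a b ->
  CI (fun t => p t - q t)%C a b = (CI p a b - CI q a b)%C.
Proof. intros H1 H2. apply is_CI_unique, is_CI_minus; apply CI_correct; auto. Qed.

Lemma CI_Chasles (p : R -> C) (a b c : R) : ex_CI p a b -> ex_CI p b c ->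
  CI p a c = (CI p a b + CI p b c)%C.
Proof.
  intros H1 H2. symmetry. exact (@RInt_Chasles C_R_CompleteNormedModule p a b c H1 H2).
Qed.

Lemma CI_swap (p : R -> C) (a b : R) : ex_CI p a b -> CI p b a = (- CI p a b)%C.
Proof.
  intros H. apply is_CI_unique. apply CI_correct in H.
  exact (is_RInt_swap p b a (CI p a b) H).
Qed.

Lemma CI_bound (p : R -> C) (a b M : R) : ex_CI p a b ->
  (forall t, Rmin a b <= t <= Rmax a b -> Cmod (p t) <= M) ->
  Cmod (CI p a b) <= M * Rabs (b - a).
Proof.
  assert (G : forall a b, a <= b -> ex_CI p a b ->
    (forall t, a <= t <= b -> Cmod (p t) <= M) -> Cmod (CI p a b) <= M * (b - a)).
  { clear. intros a b Hab H HM. rewrite Cmod_norm, Rmult_comm.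
    apply (norm_RInt_le_const p a b); auto.
    - intros t Ht. rewrite <- Cmod_norm. auto.
    - apply CI_correct; auto. }
  intros H HM. destruct (Rle_dec a b) as [Hab | Hab].
  - rewrite Rmin_left, Rmax_right in HM by lra. rewrite Rabs_pos_eq by lra. auto.
  - rewrite Rmin_right, Rmax_left in HM by lra. rewrite Rabs_left by lra.
    assert (H' := ex_RInt_swap _ _ _ H).
    rewrite (CI_swap p b a H'), Cmod_opp. replace (- (b - a)) with (a - b) by ring.
    apply G; auto. lra.
Qed.

Lemma CI_derive (p dp : R -> C) (a b : R) :
  (forall t, Rmin a b <= t <= Rmax a b -> @is_derive R_AbsRing C_R_NormedModule p t (dp t)) ->
  (forall t, Rmin a b <= t <= Rmax a b -> contR dp t) ->
  is_CI dp a b (p b - p a)%C.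
Proof. intros H1 H2. exact (@is_RInt_derive C_R_CompleteNormedModule p dp a b H1 H2). Qed.

Lemma contR_comp (f : C -> C) (p : R -> C) (t : R) :
  contR p t -> cont f (p t) -> contR (fun s => f (p s)) t.
Proof. intros H1 H2. exact (continuous_comp p f t H1 H2). Qed.

Lemma contR_derive (p : R -> C) (t : R) (l : C) :
  @is_derive R_AbsRing C_R_NormedModule p t l -> contR p t.
Proof.
  intros H. apply (@ex_derive_continuous R_AbsRing C_R_NormedModule p t).
  exists l. exact H.
Qed.

Lemma contR_pair (x y : R -> R) (t : R) :
  continuous x t -> continuous y t -> contR (fun s => (x s, y s)) t.
Proof.
  intros H1 H2 P [e He].
  assert (A : locally t (fun s => ball (x t) e (x s))) by exact (H1 _ (locally_ball _ e)).
  assert (B : locally t (fun s => ball (y t) e (y s))) by exact (H2 _ (locally_ball _ e)).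
  refine (filter_imp _ _ _ (filter_and _ _ A B)). intros s [Hx Hy]. apply He. split; assumption.
Qed.

Lemma contR_const (c : C) (t : R) : contR (fun _ => c) t.
Proof. apply continuous_const. Qed.

Lemma contR_fst (p : R -> C) (t : R) : contR p t -> continuous (fun s => fst (p s)) t.
Proof. intros H. apply (continuous_comp p fst t H). apply continuous_fst. Qed.

Lemma contR_snd (p : R -> C) (t : R) : contR p t -> continuous (fun s => snd (p s)) t.
Proof. intros H. apply (continuous_comp p snd t H). apply continuous_snd. Qed.

Lemma contR_mult (p q : R -> C) (t : R) :
  contR p t -> contR q t -> contR (fun s => p s * q s)%C t.
Proof.
  intros Hp Hq. apply contR_pair.
  - apply (continuous_minus (fun s => fst (p s) * fst (q s)) (fun s => snd (p s) * snd (q s)));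
    apply (continuous_mult (K:=R_AbsRing)); auto using contR_fst, contR_snd.
  - apply (continuous_plus (fun s => fst (p s) * snd (q s)) (fun s => snd (p s) * fst (q s)));
    apply (continuous_mult (K:=R_AbsRing)); auto using contR_fst, contR_snd.
Qed.

Lemma contR_minus (p q : R -> C) (t : R) :
  contR p t -> contR q t -> contR (fun s => p s - q s)%C t.
Proof. intros Hp Hq. exact (@continuous_minus _ _ C_R_NormedModule p q t Hp Hq). Qed.

(** * Goursat's theorem on rectangles *)

Lemma nested_intervals (a b : nat -> R) :
  (forall n, a n <= a (S n)) -> (forall n, b (S n) <= b n) -> (forall n, a n <= b n) ->
  exists x, forall n, a n <= x <= b n.
Proof.
  intros Ha Hb Hab.
  assert (Ha' : forall n k, a n <= a (n + k)%nat).
  { intros n k. induction k. rewrite Nat.add_0_r; lra.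
    rewrite Nat.add_succ_r. eapply Rle_trans; eauto. }
  assert (Hb' : forall n k, b (n + k)%nat <= b n).
  { intros n k. induction k. rewrite Nat.add_0_r; lra.
    rewrite Nat.add_succ_r. eapply Rle_trans; eauto. }
  assert (H : forall n m, a n <= b m).
  { intros n m. eapply Rle_trans. apply (Ha' n m).
    eapply Rle_trans. apply Hab. rewrite Nat.add_comm. apply Hb'. }
  destruct (completeness (fun x => exists n, x = a n)) as [x [H1 H2]].
  - exists (b O). intros y [n ->]. apply H.
  - exists (a O). exists O; reflexivity.
  - exists x. intros n. split.
    + apply H1. exists n; reflexivity.
    + apply H2. intros y [k ->]. apply H.
Qed.

(** The skeleton of Goursat's argument, freed from integrals. If [P] failed, some quarter would fail
    again and again, and the nested bad rectangles would shrink to a point, near which the local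
    hypothesis gives [P]. The rectangles of that hypothesis contain the point, so that their size
    bounds the distance to it. *)
Lemma bisection_ind (P : R -> R -> R -> R -> Prop) (A B C D : R) :
  A <= B -> C <= D ->
  (forall a b c d, a <= b -> c <= d ->
     P a ((a + b) / 2) c ((c + d) / 2) -> P ((a + b) / 2) b c ((c + d) / 2) ->
     P a ((a + b) / 2) ((c + d) / 2) d -> P ((a + b) / 2) b ((c + d) / 2) d ->
     P a b c d) ->
  (forall x y, A <= x <= B -> C <= y <= D -> exists e, 0 < e /\
     forall a b c d, A <= a <= x -> x <= b <= B -> C <= c <= y -> y <= d <= D ->
       b - a < e -> d - c < e -> P a b c d) ->
  P A B C D.
Proof.
  intros HAB HCD Hstep Hloc. apply NNPP. intros Hbad.
  (* The bad rectangles form a type, so that the choice of a bad quarter is a map [T -> T] that can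
     be iterated. *)
  set (T := {q : (R * R) * (R * R) |
     let '((a, b), (c, d)) := q in
     A <= a <= b /\ b <= B /\ C <= c <= d /\ d <= D /\ ~ P a b c d}).
  assert (next : forall q : T, exists q' : T,
     let '((a, b), (c, d)) := proj1_sig q in let '((a', b'), (c', d')) := proj1_sig q' in
     a <= a' /\ b' <= b /\ c <= c' /\ d' <= d /\ b' - a' = (b - a) / 2 /\ d' - c' = (d - c) / 2).
  { intros [[[a b] [c d]] (H1 & H2 & H3 & H4 & H5)]. simpl.
    set (m := (a + b) / 2). set (n := (c + d) / 2).
    assert (Hm : a <= m <= b) by (unfold m; lra).
    assert (Hn : c <= n <= d) by (unfold n; lra).
    destruct (classic (P a m c n)) as [P1|P1].
    destruct (classic (P m b c n)) as [P2|P2].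
    destruct (classic (P a m n d)) as [P3|P3].
    destruct (classic (P m b n d)) as [P4|P4].
    - exfalso. apply H5. apply Hstep; auto; lra.
    - assert (Q : A <= m <= b /\ b <= B /\ C <= n <= d /\ d <= D /\ ~ P m b n d)
        by (repeat split; auto; lra).
      exists (exist _ ((m, b), (n, d)) Q). simpl. unfold m, n in *; lra.
    - assert (Q : A <= a <= m /\ m <= B /\ C <= n <= d /\ d <= D /\ ~ P a m n d)
        by (repeat split; auto; lra).
      exists (exist _ ((a, m), (n, d)) Q). simpl. unfold m, n in *; lra.
    - assert (Q : A <= m <= b /\ b <= B /\ C <= c <= n /\ n <= D /\ ~ P m b c n)
        by (repeat split; auto; lra).
      exists (exist _ ((m, b), (c, n)) Q). simpl. unfold m, n in *; lra.
    - assert (Q : A <= a <= m /\ m <= B /\ C <= c <= n /\ n <= D /\ ~ P a m c n)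
        by (repeat split; auto; lra).
      exists (exist _ ((a, m), (c, n)) Q). simpl. unfold m, n in *; lra. }
  assert (Q0 : A <= A <= B /\ B <= B /\ C <= C <= D /\ D <= D /\ ~ P A B C D)
    by (repeat split; auto; lra).
  set (q0 := exist _ ((A, B), (C, D)) Q0 : T).
  set (nx := fun q : T => proj1_sig (constructive_indefinite_description _ (next q))).
  set (q := fix q n := match n with O => q0 | S n => nx (q n) end).
  assert (Hq : forall n,
     let '((a, b), (c, d)) := proj1_sig (q n) in let '((a', b'), (c', d')) := proj1_sig (q (S n)) in
     a <= a' /\ b' <= b /\ c <= c' /\ d' <= d /\ b' - a' = (b - a) / 2 /\ d' - c' = (d - c) / 2).
  { intros n. simpl. unfold nx at 1. destruct (constructive_indefinite_description _ (next (q n))). exact y. }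
  set (a := fun n => fst (fst (proj1_sig (q n)))).
  set (b := fun n => snd (fst (proj1_sig (q n)))).
  set (c := fun n => fst (snd (proj1_sig (q n)))).
  set (d := fun n => snd (snd (proj1_sig (q n)))).
  assert (Hin : forall n, A <= a n <= b n /\ b n <= B /\ C <= c n <= d n /\ d n <= D /\
     ~ P (a n) (b n) (c n) (d n)).
  { intros n. unfold a, b, c, d. destruct (q n) as [[[? ?] [? ?]] H]. exact H. }
  assert (Hs : forall n, a n <= a (S n) /\ b (S n) <= b n /\ c n <= c (S n) /\ d (S n) <= d n /\
     b (S n) - a (S n) = (b n - a n) / 2 /\ d (S n) - c (S n) = (d n - c n) / 2).
  { intros n. specialize (Hq n). unfold a, b, c, d.
    destruct (proj1_sig (q n)) as [[? ?] [? ?]].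
    destruct (proj1_sig (q (S n))) as [[? ?] [? ?]]. exact Hq. }
  assert (Hlen : forall n, b n - a n = (B - A) * (/ 2) ^ n /\ d n - c n = (D - C) * (/ 2) ^ n).
  { induction n.
    - unfold a, b, c, d; simpl. lra.
    - destruct (Hs n) as (_ & _ & _ & _ & E1 & E2). destruct IHn as [I1 I2].
      simpl pow. rewrite E1, E2, I1, I2. lra. }
  destruct (nested_intervals a b) as [x Hx]; try (intros n; generalize (Hs n) (Hin n); lra).
  destruct (nested_intervals c d) as [y Hy]; try (intros n; generalize (Hs n) (Hin n); lra).
  destruct (Hloc x y) as (e & He & HP).
  - generalize (Hx O) (Hin O); lra.
  - generalize (Hy O) (Hin O); lra.
  (* The denominator exceeds both sides of the initial rectangle, so at step [N] both sides are
     shorter than [e]. *)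
  - destruct (pow_lt_1_zero (/ 2) ltac:(rewrite Rabs_pos_eq; lra) (e / (1 + (B - A) + (D - C))))
      as [N HN]. { apply Rdiv_lt_0_compat; lra. }
    specialize (HN N (le_n N)).
    assert (Hp : 0 < (/ 2) ^ N) by (apply pow_lt; lra).
    rewrite Rabs_pos_eq in HN by lra.
    apply (Rmult_lt_compat_r (1 + (B - A) + (D - C))) in HN; [|lra].
    unfold Rdiv in HN. rewrite Rmult_assoc, Rinv_l, Rmult_1_r in HN by lra.
    destruct (Hlen N) as [L1 L2]. destruct (Hin N) as (I1 & I2 & I3 & I4 & I5).
    specialize (Hx N). specialize (Hy N).
    apply I5. apply HP; try lra; nra.
Qed.

(** The contour integral of [f dz] along the boundary of the rectangle, anticlockwise when [a <= b]
    and [c <= d]. On the vertical sides [dz = i ds], whence the factor [Ci]. *)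
Definition rectJ (f : C -> C) (a b c d : R) : C :=
  (CI (fun t => f (t, c)) a b + Ci * CI (fun s => f (b, s)) c d
   - CI (fun t => f (t, d)) a b - Ci * CI (fun s => f (a, s)) c d)%C.

Lemma contR_horiz (c t : R) : contR (fun s => (s, c)) t.
Proof. apply contR_pair. apply continuous_id. apply continuous_const. Qed.

Lemma contR_vert (c t : R) : contR (fun s => (c, s)) t.
Proof. apply contR_pair. apply continuous_const. apply continuous_id. Qed.

Lemma is_derive_horiz (c t : R) :
  @is_derive R_AbsRing C_R_NormedModule (fun s => (s, c)) t (RtoC 1).
Proof.
  apply is_derive_R_eps. intros e He. exists 1. split. lra. intros s _.
  match goal with |- Cmod ?z <= _ => replace z with (RtoC 0) end.
  - rewrite Cmod_0. apply Rmult_le_pos. lra. apply Rabs_pos.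
  - unfold Cminus, Cplus, Copp, Cmult, RtoC; simpl. f_equal; ring.
Qed.

Lemma is_derive_vert (c t : R) :
  @is_derive R_AbsRing C_R_NormedModule (fun s => (c, s)) t Ci.
Proof.
  apply is_derive_R_eps. intros e He. exists 1. split. lra. intros s _.
  match goal with |- Cmod ?z <= _ => replace z with (RtoC 0) end.
  - rewrite Cmod_0. apply Rmult_le_pos. lra. apply Rabs_pos.
  - unfold Cminus, Cplus, Copp, Cmult, RtoC, Ci; simpl. f_equal; ring.
Qed.

Definition cont_rect (f : C -> C) (A B C D : R) : Prop :=
  forall x y, A <= x <= B -> C <= y <= D -> cont f (x, y).

Section Rect.

Variables (f : C -> C) (A B C D : R).
Hypothesis Hf : cont_rect f A B C D.

Lemma ex_CI_horiz (a b c : R) :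
  A <= a <= B -> A <= b <= B -> C <= c <= D -> ex_CI (fun t => f (t, c)) a b.
Proof.
  intros Ha Hb Hc. apply ex_CI_cont. intros t Ht.
  apply (contR_comp f (fun s => (s, c)) t). apply contR_horiz. apply Hf; auto.
  revert Ht. unfold Rmin, Rmax. destruct (Rle_dec a b); lra.
Qed.

Lemma ex_CI_vert (a c d : R) :
  A <= a <= B -> C <= c <= D -> C <= d <= D -> ex_CI (fun t => f (a, t)) c d.
Proof.
  intros Ha Hb Hc. apply ex_CI_cont. intros t Ht.
  apply (contR_comp f (fun s => (a, s)) t). apply contR_vert. apply Hf; auto.
  revert Ht. unfold Rmin, Rmax. destruct (Rle_dec c d); lra.
Qed.

Lemma rectJ_split_x (a m b c d : R) :
  A <= a <= B -> A <= m <= B -> A <= b <= B -> C <= c <= D -> C <= d <= D ->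
  rectJ f a b c d = (rectJ f a m c d + rectJ f m b c d)%C.
Proof.
  intros. unfold rectJ.
  rewrite (CI_Chasles (fun t => f (t, c)) a m b) by (apply ex_CI_horiz; auto).
  rewrite (CI_Chasles (fun t => f (t, d)) a m b) by (apply ex_CI_horiz; auto).
  ring.
Qed.

Lemma rectJ_split_y (a b c n d : R) :
  A <= a <= B -> A <= b <= B -> C <= c <= D -> C <= n <= D -> C <= d <= D ->
  rectJ f a b c d = (rectJ f a b c n + rectJ f a b n d)%C.
Proof.
  intros. unfold rectJ.
  rewrite (CI_Chasles (fun t => f (b, t)) c n d) by (apply ex_CI_vert; auto).
  rewrite (CI_Chasles (fun t => f (a, t)) c n d) by (apply ex_CI_vert; auto).
  ring.
Qed.

Lemma rectJ_split (a m b c n d : R) :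
  A <= a <= B -> A <= m <= B -> A <= b <= B ->
  C <= c <= D -> C <= n <= D -> C <= d <= D ->
  rectJ f a b c d =
    (rectJ f a m c n + rectJ f m b c n + (rectJ f a m n d + rectJ f m b n d))%C.
Proof.
  intros. rewrite (rectJ_split_y a b c n d), (rectJ_split_x a m b c n), (rectJ_split_x a m b n d); auto.
Qed.

Lemma rectJ_bound (M a b c d : R) :
  A <= a <= B -> A <= b <= B -> C <= c <= D -> C <= d <= D ->
  (forall x y, Rmin a b <= x <= Rmax a b -> Rmin c d <= y <= Rmax c d -> Cmod (f (x, y)) <= M) ->
  Cmod (rectJ f a b c d) <= 2 * M * (Rabs (b - a) + Rabs (d - c)).
Proof.
  intros Ha Hb Hc Hd HM. unfold rectJ.
  pose proof (Rmin_l a b). pose proof (Rmin_r a b).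
  pose proof (Rmax_l a b). pose proof (Rmax_r a b).
  pose proof (Rmin_l c d). pose proof (Rmin_r c d).
  pose proof (Rmax_l c d). pose proof (Rmax_r c d).
  assert (H7 := CI_bound (fun t => f (t, c)) a b M (ex_CI_horiz a b c Ha Hb Hc)).
  assert (H8 := CI_bound (fun t => f (t, d)) a b M (ex_CI_horiz a b d Ha Hb Hd)).
  assert (H9 := CI_bound (fun t => f (a, t)) c d M (ex_CI_vert a c d Ha Hc Hd)).
  assert (H10 := CI_bound (fun t => f (b, t)) c d M (ex_CI_vert b c d Hb Hc Hd)).
  lapply H7; [clear H7; intros H7 | intros; apply HM; lra].
  lapply H8; [clear H8; intros H8 | intros; apply HM; lra].
  lapply H9; [clear H9; intros H9 | intros; apply HM; lra].
  lapply H10; [clear H10; intros H10 | intros; apply HM; lra].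
  eapply Rle_trans. apply Cmod_triangle_minus.
  rewrite Cmod_mult, Cmod_Ci.
  assert (Cmod (CI (fun t => f (t, c)) a b + Ci * CI (fun s => f (b, s)) c d
       - CI (fun t => f (t, d)) a b)%C <= M * Rabs (b - a) + M * Rabs (d - c) + M * Rabs (b - a)).
  { eapply Rle_trans. apply Cmod_triangle_minus. apply Rplus_le_compat; auto.
    eapply Rle_trans. apply Cmod_triangle. apply Rplus_le_compat; auto.
    rewrite Cmod_mult, Cmod_Ci. lra. }
  lra.
Qed.

End Rect.

Lemma rectJ_primitive (F f : C -> C) (A B C D a b c d : R) :
  cont_rect f A B C D ->
  A <= a <= B -> A <= b <= B -> C <= c <= D -> C <= d <= D ->
  (forall x y, A <= x <= B -> C <= y <= D -> is_derive F ((x, y) : Complex.C) (f (x, y))) ->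
  rectJ f a b c d = RtoC 0.
Proof.
  intros Hf Ha Hb Hc Hd HF.
  assert (Hh : forall y, C <= y <= D -> CI (fun t => f (t, y)) a b = (F (b, y) - F (a, y))%C).
  { intros y Hy. apply is_CI_unique.
    apply (CI_derive (fun t => F (t, y)) (fun t => f (t, y))).
    - intros t Ht. replace (f (t, y)) with (f (t, y) * RtoC 1)%C by ring.
      apply (is_derive_C_comp_R F (fun t => (t, y)) t).
      + apply HF; auto. revert Ht; unfold Rmin, Rmax; destruct (Rle_dec a b); lra.
      + apply is_derive_horiz.
    - intros t Ht. apply (contR_comp f (fun s => (s, y)) t). apply contR_horiz. apply Hf; auto.
      revert Ht; unfold Rmin, Rmax; destruct (Rle_dec a b); lra. }
  assert (Hv : forall x, A <= x <= B -> (Ci * CI (fun t => f (x, t)) c d = F (x, d) - F (x, c))%C).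
  { intros x Hx. rewrite <- CI_scal by (apply (ex_CI_vert f A B C D); auto).
    apply is_CI_unique.
    assert (E : forall t, Rmin c d <= t <= Rmax c d -> C <= t <= D)
      by (intros t; unfold Rmin, Rmax; destruct (Rle_dec c d); lra).
    apply (CI_derive (fun t => F (x, t)) (fun t => Ci * f (x, t))%C).
    - intros t Ht. rewrite Cmult_comm.
      apply (is_derive_C_comp_R F (fun t => (x, t)) t).
      + apply HF; auto.
      + apply is_derive_vert.
    - intros t Ht. apply contR_mult. apply contR_const.
      apply (contR_comp f (fun s => (x, s)) t). apply contR_vert. apply Hf; auto. }
  unfold rectJ. rewrite (Hh c), (Hh d), (Hv a), (Hv b) by auto. ring.
Qed.

(** Affine functions have a quadratic primitive. This lets the tangent map be subtracted in
    Goursat's theorem without changing the integral. *)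
Lemma rectJ_affine (u v : C) (a b c d : R) : rectJ (fun z => u + v * z)%C a b c d = RtoC 0.
Proof.
  assert (HD : forall z : C, is_derive (fun z => u * z + v / 2 * (z * z))%C z (u + v * z)%C).
  { intros z. replace (u + v * z)%C with
      ((RtoC 0 * z + u * RtoC 1) + (RtoC 0 * (z * z) + v / 2 * (RtoC 1 * z + z * RtoC 1)))%C.
    2:{ field. }
    apply (is_derive_C_plus (fun z => u * z)%C (fun z => v / 2 * (z * z))%C).
    - apply (is_derive_C_mult (fun _ => u) (fun z => z)).
      apply is_derive_C_const. apply is_derive_C_id.
    - apply (is_derive_C_mult (fun _ => v / 2)%C (fun z => z * z)%C).
      apply is_derive_C_const. apply (is_derive_C_mult (fun z => z) (fun z => z)); apply is_derive_C_id. }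
  assert (HC : forall z, cont (fun z => u + v * z)%C z).
  { intros z. apply ex_derive_C_cont. apply ex_derive_C_plus. apply ex_derive_C_const.
    apply ex_derive_C_mult. apply ex_derive_C_const. apply ex_derive_C_id. }
  apply (rectJ_primitive (fun z => u * z + v / 2 * (z * z))%C _ (Rmin a b) (Rmax a b) (Rmin c d) (Rmax c d)).
  - intros x y _ _. apply HC.
  - split. apply Rmin_l. apply Rmax_l.
  - split. apply Rmin_r. apply Rmax_r.
  - split. apply Rmin_l. apply Rmax_l.
  - split. apply Rmin_r. apply Rmax_r.
  - intros x y _ _. apply HD.
Qed.

Lemma rectJ_minus (f g : C -> C) (A B C D a b c d : R) :
  cont_rect f A B C D -> cont_rect g A B C D ->
  A <= a <= B -> A <= b <= B -> C <= c <= D -> C <= d <= D ->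
  rectJ (fun z => f z - g z)%C a b c d = (rectJ f a b c d - rectJ g a b c d)%C.
Proof.
  intros Hf Hg Ha Hb Hc Hd. unfold rectJ.
  rewrite (CI_minus (fun t => f (t, c)) (fun t => g (t, c))) by (eapply ex_CI_horiz; eauto).
  rewrite (CI_minus (fun t => f (t, d)) (fun t => g (t, d))) by (eapply ex_CI_horiz; eauto).
  rewrite (CI_minus (fun t => f (a, t)) (fun t => g (a, t))) by (eapply ex_CI_vert; eauto).
  rewrite (CI_minus (fun t => f (b, t)) (fun t => g (b, t))) by (eapply ex_CI_vert; eauto).
  ring.
Qed.

Theorem goursat_rect (f : C -> C) (A B C D : R) : A <= B -> C <= D ->
  (forall x y, A <= x <= B -> C <= y <= D -> ex_derive f ((x, y) : Complex.C)) ->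
  rectJ f A B C D = RtoC 0.
Proof.
  intros HAB HCD Hd.
  assert (Hc : cont_rect f A B C D) by (intros x y Hx Hy; apply ex_derive_C_cont; auto).
  (* The square of the half-perimeter is the right gauge for bisection: halving the sides divides it
     by 4, and there are 4 quarters. *)
  assert (G : forall e, 0 < e -> Cmod (rectJ f A B C D) <= e * ((B - A) + (D - C)) ^ 2).
  { intros e He.
    (* The trivial inequalities let the inductive predicate record that a subrectangle lies in the
       big one, where [f] is continuous. *)
    cut (A <= A -> B <= B -> C <= C -> D <= D ->
      Cmod (rectJ f A B C D) <= e * ((B - A) + (D - C)) ^ 2).
    { intros H; apply H; lra. }
    apply (bisection_ind (fun a b c d => A <= a -> b <= B -> C <= c -> d <= D ->
      Cmod (rectJ f a b c d) <= e * ((b - a) + (d - c)) ^ 2) A B C D); auto.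
    - intros a b c d Hab Hcd P1 P2 P3 P4 H1 H2 H3 H4.
      rewrite (rectJ_split f A B C D Hc a ((a + b) / 2) b c ((c + d) / 2) d) by lra.
      specialize (P1 ltac:(lra) ltac:(lra) ltac:(lra) ltac:(lra)).
      specialize (P2 ltac:(lra) ltac:(lra) ltac:(lra) ltac:(lra)).
      specialize (P3 ltac:(lra) ltac:(lra) ltac:(lra) ltac:(lra)).
      specialize (P4 ltac:(lra) ltac:(lra) ltac:(lra) ltac:(lra)).
      eapply Rle_trans. apply Cmod_triangle.
      eapply Rle_trans. apply Rplus_le_compat; apply Cmod_triangle.
      eapply Rle_trans. apply Rplus_le_compat; apply Rplus_le_compat; eassumption.
      right. field.
    - intros x y Hx Hy. destruct (Hd x y Hx Hy) as [l Hl].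
      assert (He2 : 0 < e / 2) by lra.
      destruct (proj1 (is_derive_C_eps _ _ _) Hl (e / 2) He2) as (r & Hr & Hl').
      exists (r / 2). split. lra.
      intros a b c d Ha Hb Hc' Hd' Hba Hdc _ _ _ _.
      set (z := (x, y) : Complex.C) in *.
      (* [g] is the tangent map of [f] at [z]. On the small rectangle [f - g] is at most [e/2] times
         the half-perimeter, and [rectJ_bound] contributes a factor 2. *)
      set (g := fun w : Complex.C => ((f z - l * z) + l * w)%C).
      assert (Hg : cont_rect g A B C D).
      { intros s t _ _. apply ex_derive_C_cont. apply ex_derive_C_plus. apply ex_derive_C_const.
        apply ex_derive_C_mult. apply ex_derive_C_const. apply ex_derive_C_id. }
      assert (E : rectJ f a b c d = rectJ (fun w => f w - g w)%C a b c d).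
      { rewrite (rectJ_minus f g A B C D) by (auto; lra).
        unfold g at 1. rewrite rectJ_affine. ring. }
      rewrite E.
      replace (e * (b - a + (d - c)) ^ 2) with
        (2 * (e / 2 * (b - a + (d - c))) * (Rabs (b - a) + Rabs (d - c)))
        by (rewrite !Rabs_pos_eq by lra; field).
      apply (rectJ_bound (fun w => f w - g w)%C A B C D); try lra.
      { intros s t Hs Ht.
        apply (@continuous_minus C_UniformSpace C_AbsRing C_NormedModule f g); auto. apply Hc; auto. apply Hg; auto. }
      rewrite !Rmin_left, !Rmax_right by lra.
      intros s t Hs Ht.
      assert (Hdist : Cmod ((s, t) - z)%C <= b - a + (d - c)).
      { replace ((s, t) - z)%C with ((s - x, t - y) : Complex.C) by reflexivity.
        eapply Rle_trans. apply Cmod_le_Rabs.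
        apply Rplus_le_compat; apply Rabs_le; lra. }
      replace (f (s, t) - g (s, t))%C with (f (s, t) - f z - ((s, t) - z) * l)%C
        by (unfold g; ring).
      eapply Rle_trans. apply Hl'. lra.
      apply Rmult_le_compat_l; lra. }
  apply Cmod_eq_0. apply Rle_antisym; [|apply Cmod_ge_0].
  apply Rnot_lt_le. intros H0.
  set (L := ((B - A) + (D - C)) ^ 2) in *.
  assert (HL : 0 <= L) by (unfold L; apply pow2_ge_0).
  (* With this [e] the bound is less than half of the left-hand side; the [1 +] covers a degenerate
     rectangle. *)
  specialize (G (Cmod (rectJ f A B C D) / (2 * (1 + L))) ltac:(apply Rdiv_lt_0_compat; lra)).
  apply (Rmult_le_compat_r (2 * (1 + L))) in G; [|lra].
  replace (Cmod (rectJ f A B C D) / (2 * (1 + L)) * L * (2 * (1 + L)))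
    with (Cmod (rectJ f A B C D) * L) in G by (field; lra).
  nra.
Qed.

(** * Primitives on the disk *)

Section Signed.

Variables (f : C -> C) (A B C D : R).
Hypothesis Hf : cont_rect f A B C D.

Lemma rectJ_swap_x (a b c d : R) :
  A <= a <= B -> A <= b <= B -> C <= c <= D -> C <= d <= D ->
  rectJ f b a c d = (- rectJ f a b c d)%C.
Proof.
  intros. unfold rectJ.
  rewrite (CI_swap (fun t => f (t, c)) a b), (CI_swap (fun t => f (t, d)) a b)
    by (eapply ex_CI_horiz; eauto).
  ring.
Qed.

Lemma rectJ_swap_y (a b c d : R) :
  A <= a <= B -> A <= b <= B -> C <= c <= D -> C <= d <= D ->
  rectJ f a b d c = (- rectJ f a b c d)%C.
Proof.
  intros. unfold rectJ.
  rewrite (CI_swap (fun t => f (a, t)) c d), (CI_swap (fun t => f (b, t)) c d)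
    by (eapply ex_CI_vert; eauto).
  ring.
Qed.

(** A primitive is integrated from 0 to coordinates of either sign, so endpoints come in any order;
    reversing a pair only flips the sign of the integral. *)
Lemma goursat_rect_signed (a b c d : R) :
  A <= a <= B -> A <= b <= B -> C <= c <= D -> C <= d <= D ->
  (forall x y, Rmin a b <= x <= Rmax a b -> Rmin c d <= y <= Rmax c d ->
     ex_derive f ((x, y) : Complex.C)) ->
  rectJ f a b c d = RtoC 0.
Proof.
  assert (G : forall a b c d, a <= b -> c <= d -> (forall x y, Rmin a b <= x <= Rmax a b ->
     Rmin c d <= y <= Rmax c d -> ex_derive f ((x, y) : Complex.C)) -> rectJ f a b c d = RtoC 0).
  { clear. intros a b c d Hab Hcd H. rewrite Rmin_left, Rmax_right in H by lra.
    rewrite Rmin_left, Rmax_right in H by lra. apply goursat_rect; auto. }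
  intros Ha Hb Hc Hd H.
  destruct (Rle_dec a b) as [L1|L1]; destruct (Rle_dec c d) as [L2|L2].
  - apply G; auto.
  - rewrite rectJ_swap_y, G; try lra. ring.
    rewrite Rmin_comm, Rmax_comm in H. intros x y Hx Hy. apply H; auto.
    rewrite Rmin_comm, Rmax_comm; auto. now rewrite (Rmin_comm c d), (Rmax_comm c d).
  - rewrite rectJ_swap_x, G; try lra. ring.
    intros x y. rewrite (Rmin_comm b a), (Rmax_comm b a). auto.
  - rewrite rectJ_swap_x, rectJ_swap_y, G; try lra. ring.
    intros x y. rewrite (Rmin_comm b a), (Rmax_comm b a), (Rmin_comm d c), (Rmax_comm d c). auto.
Qed.

Variables (p q : R).
Hypothesis Hd : forall x y, A <= x <= B -> C <= y <= D -> (x, y) <> (p, q) ->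
  ex_derive f ((x, y) : Complex.C).

(* Shrinking the rectangle towards the exceptional corner does not change the integral,
   which is at most a bound of [f] near the corner times the perimeter. *)
Lemma goursat_rect_corner (x y : R) :
  A <= p <= B -> C <= q <= D -> A <= x <= B -> C <= y <= D -> rectJ f p x q y = RtoC 0.
Proof.
  intros Hp Hq Hx Hy.
  destruct (Req_dec x p) as [->|Hxp].
  { unfold rectJ. rewrite !(is_CI_unique _ p p (RtoC 0)) by apply @is_RInt_point. ring. }
  destruct (Req_dec y q) as [->|Hyq].
  { unfold rectJ. rewrite !(is_CI_unique _ q q (RtoC 0)) by apply @is_RInt_point. ring. }
  assert (G : forall th, 0 < th <= 1 ->
    rectJ f p x q y = rectJ f p (p + th * (x - p)) q (q + th * (y - q))).
  { intros th Hth.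
    set (m := p + th * (x - p)). set (n := q + th * (y - q)).
    assert (Hm : Rmin p x <= m <= Rmax p x).
    { unfold m, Rmin, Rmax. destruct (Rle_dec p x); nra. }
    assert (Hn : Rmin q y <= n <= Rmax q y).
    { unfold n, Rmin, Rmax. destruct (Rle_dec q y); nra. }
    assert (Hmp : m <> p). { intros E. unfold m in E. apply Hxp.
      assert (th * (x - p) = 0) by lra. apply Rmult_integral in H. lra. }
    assert (Hnq : n <> q). { intros E. unfold n in E. apply Hyq.
      assert (th * (y - q) = 0) by lra. apply Rmult_integral in H. lra. }
    assert (HmA : A <= m <= B).
    { revert Hm; unfold Rmin, Rmax; destruct (Rle_dec p x); lra. }
    assert (HnA : C <= n <= D).
    { revert Hn; unfold Rmin, Rmax; destruct (Rle_dec q y); lra. }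
    assert (Nx : forall s, Rmin m x <= s <= Rmax m x -> s <> p /\ A <= s <= B).
    { intros s Hs. unfold m in *. split.
      - intros ->. revert Hs; unfold Rmin, Rmax; destruct (Rle_dec _ x); nra.
      - revert Hs; unfold Rmin, Rmax; destruct (Rle_dec _ x); lra. }
    assert (Ny : forall s, Rmin n y <= s <= Rmax n y -> s <> q /\ C <= s <= D).
    { intros s Hs. unfold n in *. split.
      - intros ->. revert Hs; unfold Rmin, Rmax; destruct (Rle_dec _ y); nra.
      - revert Hs; unfold Rmin, Rmax; destruct (Rle_dec _ y); lra. }
    assert (Bx : forall s, Rmin p m <= s <= Rmax p m -> A <= s <= B).
    { intros s; unfold Rmin, Rmax; destruct (Rle_dec p m); lra. }
    assert (By : forall s, Rmin q n <= s <= Rmax q n -> C <= s <= D).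
    { intros s; unfold Rmin, Rmax; destruct (Rle_dec q n); lra. }
    (* Of the four pieces only the one at the corner meets [(p, q)]; the other three vanish. *)
    rewrite (rectJ_split f A B C D Hf p m x q n y); auto.
    rewrite (goursat_rect_signed m x q n), (goursat_rect_signed p m n y),
      (goursat_rect_signed m x n y); auto.
    - ring.
    - intros s t Hs Ht. apply Nx in Hs. apply Ny in Ht. apply Hd; try tauto. intros E; injection E; tauto.
    - intros s t Hs Ht. apply Bx in Hs. apply Ny in Ht. apply Hd; try tauto.
      intros E; injection E; tauto.
    - intros s t Hs Ht. apply Nx in Hs. apply By in Ht. apply Hd; try tauto.
      intros E; injection E; tauto. }
  assert (Hcw := Hf p q Hp Hq). rewrite cont_eps in Hcw.
  destruct (Hcw 1 Rlt_0_1) as (r & Hr & Hcw').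
  set (L := Rabs (x - p) + Rabs (y - q)).
  assert (HL : 0 < L).
  { unfold L. pose proof (Rabs_pos (y - q)). pose proof (Rabs_pos_lt (x - p)). lra. }
  set (M := Cmod (f (p, q)) + 1).
  assert (HM : 0 < M). { unfold M. pose proof (Cmod_ge_0 (f (p, q))). lra. }
  assert (G2 : forall th, 0 < th <= 1 -> th * L < r -> Cmod (rectJ f p x q y) <= 2 * M * (th * L)).
  { intros th Hth Hr'. rewrite (G th Hth).
    replace (th * L) with (Rabs (p + th * (x - p) - p) + Rabs (q + th * (y - q) - q)).
    2:{ unfold L. replace (p + th * (x - p) - p) with (th * (x - p)) by ring.
        replace (q + th * (y - q) - q) with (th * (y - q)) by ring.
        rewrite !Rabs_mult, !(Rabs_pos_eq th) by lra. ring. }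
    apply (rectJ_bound f A B C D); auto.
    - clear - Hth Hp Hx. nra.
    - clear - Hth Hq Hy. nra.
    - intros s t Hs Ht.
      assert (Hst : Cmod ((s, t) - (p, q))%C < r).
      { replace ((s, t) - (p, q))%C with ((s - p, t - q) : Complex.C) by reflexivity.
        eapply Rle_lt_trans. apply Cmod_le_Rabs. eapply Rle_lt_trans; [|exact Hr'].
        unfold L. rewrite Rmult_plus_distr_l.
        rewrite <- (Rabs_pos_eq th) at 1 2 by lra. rewrite <- !Rabs_mult.
        apply Rplus_le_compat.
        - revert Hs. unfold Rmin, Rmax. destruct (Rle_dec p _); unfold Rabs;
          repeat destruct Rcase_abs; lra.
        - revert Ht. unfold Rmin, Rmax. destruct (Rle_dec q _); unfold Rabs;
          repeat destruct Rcase_abs; lra. }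
      specialize (Hcw' _ Hst). pose proof (Cmod_triangle_inv (f (s, t)) (f (p, q))).
      unfold M. lra. }
  apply Cmod_eq_0. apply Rle_antisym; [|apply Cmod_ge_0].
  apply Rnot_lt_le. intros H0. set (v := Cmod (rectJ f p x q y)) in *.
  (* Small enough for the shrunken rectangle to lie where [|f| <= M], and for the bound [2 M th L]
     on [v] to be at most [v / 2]. *)
  set (th := Rmin 1 (Rmin (r / (2 * L)) (v / (4 * M * L)))).
  assert (T1 : th <= 1) by apply Rmin_l.
  assert (T2 : th <= r / (2 * L)).
  { eapply Rle_trans. apply Rmin_r. apply Rmin_l. }
  assert (T3 : th <= v / (4 * M * L)).
  { eapply Rle_trans. apply Rmin_r. apply Rmin_r. }
  assert (T0 : 0 < th).
  { repeat apply Rmin_pos. lra. apply Rdiv_lt_0_compat; lra.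
    apply Rdiv_lt_0_compat; [lra|]. apply Rmult_lt_0_compat; lra. }
  assert (HML : 0 < M * L) by (apply Rmult_lt_0_compat; auto).
  apply (Rmult_le_compat_r L) in T2; [|lra].
  replace (r / (2 * L) * L) with (r / 2) in T2 by (field; lra).
  apply (Rmult_le_compat_r (4 * M * L)) in T3; [|lra].
  replace (v / (4 * M * L) * (4 * M * L)) with v in T3 by (field; lra).
  specialize (G2 th ltac:(lra) ltac:(lra)). lra.
Qed.

(** Cutting at [(p, q)] makes it a corner of all four signed pieces, even if it lies outside the
    inner rectangle. The exceptional point will be that of the difference quotient in Cauchy's
    formula. *)
Lemma goursat_rect_except (a b c d : R) :
  A <= a <= B -> A <= b <= B -> C <= c <= D -> C <= d <= D -> rectJ f a b c d = RtoC 0.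
Proof.
  intros Ha Hb Hc Hd'.
  destruct (classic (A <= p <= B /\ C <= q <= D)) as [[Hp Hq]|N].
  - rewrite (rectJ_split f A B C D Hf a p b c q d); auto.
    rewrite (goursat_rect_corner b d) by auto.
    rewrite (rectJ_swap_x p a c q), (rectJ_swap_y p a q c), (goursat_rect_corner a c) by auto.
    rewrite (rectJ_swap_y p b q c), (goursat_rect_corner b c) by auto.
    rewrite (rectJ_swap_x p a q d), (goursat_rect_corner a d) by auto.
    ring.
  - apply goursat_rect_signed; auto. intros x y Hx Hy.
    assert (A <= x <= B).
    { revert Hx; unfold Rmin, Rmax; destruct (Rle_dec a b); lra. }
    assert (C <= y <= D).
    { revert Hy; unfold Rmin, Rmax; destruct (Rle_dec c d); lra. }
    apply Hd; auto. intros E. injection E. intros -> ->. tauto.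
Qed.

End Signed.

(** Puts the axis-parallel rectangle between 0 and a point of the disk inside the disk. *)
Lemma inD_sub (x y s t : R) : inD (x, y) -> Rabs s <= Rabs x -> Rabs t <= Rabs y -> inD (s, t).
Proof.
  unfold inD, Cmod; simpl. intros H H1 H2. eapply Rle_lt_trans; [|exact H].
  apply sqrt_le_1_alt. apply Rsqr_le_abs_1 in H1. apply Rsqr_le_abs_1 in H2.
  unfold Rsqr in *. lra.
Qed.

Definition contD (f : C -> C) : Prop := forall z, inD z -> cont f z.

Lemma holo_contD (f : C -> C) : holo f -> contD f.
Proof. intros H z Hz. apply ex_derive_C_cont; auto. Qed.

Lemma contD_rect (f : C -> C) (x y : R) : contD f -> inD (x, y) ->
  cont_rect f (- Rabs x) (Rabs x) (- Rabs y) (Rabs y).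
Proof.
  intros Hf H s t Hs Ht. apply Hf. apply (inD_sub x y); auto; apply Rabs_le; auto.
Qed.

Lemma ex_CI_horizD (f : C -> C) (a b c : R) : contD f -> inD (a, c) -> inD (b, c) ->
  ex_CI (fun t => f (t, c)) a b.
Proof.
  intros Hf Ha Hb. apply ex_CI_cont. intros t Ht.
  apply (contR_comp f (fun s => (s, c)) t). apply contR_horiz. apply Hf.
  destruct (Rle_dec (Rabs t) (Rabs a)).
  - apply (inD_sub a c); auto. lra.
  - apply (inD_sub b c); auto; try lra. revert n Ht. unfold Rmin, Rmax, Rabs.
    destruct (Rle_dec a b); repeat destruct Rcase_abs; lra.
Qed.

Lemma ex_CI_vertD (f : C -> C) (a b c : R) : contD f -> inD (c, a) -> inD (c, b) ->
  ex_CI (fun t => f (c, t)) a b.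
Proof.
  intros Hf Ha Hb. apply ex_CI_cont. intros t Ht.
  apply (contR_comp f (fun s => (c, s)) t). apply contR_vert. apply Hf.
  destruct (Rle_dec (Rabs t) (Rabs a)).
  - apply (inD_sub c a); auto. lra.
  - apply (inD_sub c b); auto; try lra. revert n Ht. unfold Rmin, Rmax, Rabs.
    destruct (Rle_dec a b); repeat destruct Rcase_abs; lra.
Qed.

Lemma CI_const (c : C) (a b : R) : CI (fun _ => c) a b = (RtoC (b - a) * c)%C.
Proof. rewrite <- scal_R_Cmult. exact (@RInt_const C_R_CompleteNormedModule a b c). Qed.

Lemma ex_CI_const (c : C) (a b : R) : ex_CI (fun _ => c) a b.
Proof. exact (@ex_RInt_const C_R_NormedModule a b c). Qed.

(** [P] integrates first horizontally, then vertically; the vanishing of [rectJ] says that the other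
    order gives the same value. Each form reduces one kind of increment to a single integral near
    the point: the first form the vertical increments, the second the horizontal ones. *)
Lemma primitive_of_rectJ (f : C -> C) : contD f ->
  (forall x y, inD (x, y) -> rectJ f 0 x 0 y = RtoC 0) ->
  exists P, is_deriv_on_D P f.
Proof.
  intros Hf HJ.
  set (P := fun z : C => (CI (fun t => f (t, 0%R)) 0 (fst z) + Ci * CI (fun s => f (fst z, s)) 0 (snd z))%C).
  assert (P2 : forall x y, inD (x, y) ->
    P (x, y) = (Ci * CI (fun s => f (0%R, s)) 0 y + CI (fun t => f (t, y)) 0 x)%C).
  { intros x y H. specialize (HJ x y H). unfold rectJ in HJ. unfold P; simpl.
    apply Ceq_minus. rewrite <- HJ. ring. }
  assert (H00 : forall x y, inD (x, y) -> inD (x, 0) /\ inD (0, y)).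
  { intros x y H. pose proof (Rabs_pos x). pose proof (Rabs_pos y).
    split; apply (inD_sub x y); auto; rewrite ?Rabs_R0; lra. }
  exists P. intros [x y] Hz. apply is_derive_C_eps. intros e He.
  destruct (inD_open _ Hz) as (r1 & Hr1 & HD).
  destruct (proj1 (cont_eps _ _) (Hf _ Hz) (e / 2) ltac:(lra)) as (r2 & Hr2 & Hc).
  (* Half, because the coordinate differences add up to at most twice the modulus. *)
  exists (Rmin r1 r2 / 2). split. { assert (0 < Rmin r1 r2) by (apply Rmin_pos; auto). lra. }
  intros [x' y'] Hw.
  assert (Hxy : Rabs (x' - x) + Rabs (y' - y) <= 2 * Cmod ((x', y') - (x, y))%C).
  { generalize (Rabs_fst_le_Cmod ((x', y') - (x, y))%C) (Rabs_snd_le_Cmod ((x', y') - (x, y))%C).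
    simpl. unfold Rminus. lra. }
  assert (Hnear : forall s t, Rabs (s - x) <= Rabs (x' - x) -> Rabs (t - y) <= Rabs (y' - y) ->
     inD (s, t) /\ Cmod (f (s, t) - f (x, y))%C <= e / 2).
  { intros s t Hs Ht.
    assert (Cmod ((s, t) - (x, y))%C < Rmin r1 r2).
    { replace ((s, t) - (x, y))%C with ((s - x, t - y) : C) by reflexivity.
      eapply Rle_lt_trans. apply Cmod_le_Rabs. lra. }
    pose proof (Rmin_l r1 r2). pose proof (Rmin_r r1 r2). split.
    - apply HD. lra.
    - apply Rlt_le. apply Hc. lra. }
  assert (I1 : inD (x', y')) by (apply Hnear; lra).
  assert (Z : forall u, Rabs (u - u) = 0) by (intros u; rewrite Rminus_diag_eq, Rabs_R0; auto).
  assert (I2 : inD (x, y')). { apply Hnear; rewrite ?Z; try lra. apply Rabs_pos. }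
  destruct (H00 x y Hz) as [J1 J2]. destruct (H00 x' y' I1) as [J3 J4].
  assert (E1 : (P (x', y') - P (x, y') = CI (fun t => f (t, y')) x x')%C).
  { rewrite !P2 by auto. rewrite (CI_Chasles (fun t => f (t, y')) 0 x x'). ring.
    apply ex_CI_horizD; auto. apply ex_CI_horizD; auto. }
  assert (E2 : (P (x, y') - P (x, y) = Ci * CI (fun t => f (x, t)) y y')%C).
  { unfold P; simpl. rewrite (CI_Chasles (fun t => f (x, t)) 0 y y'). ring.
    apply ex_CI_vertD; auto. apply ex_CI_vertD; auto. }
  assert (X1 : ex_CI (fun t => f (t, y')) x x') by (apply ex_CI_horizD; auto).
  assert (X2 : ex_CI (fun t => f (x, t)) y y') by (apply ex_CI_vertD; auto).
  set (c := f (x, y)) in *.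
  replace (P (x', y') - P (x, y) - ((x', y') - (x, y)) * c)%C with
    (CI (fun t => f (t, y') - c)%C x x' + Ci * CI (fun t => f (x, t) - c)%C y y')%C.
  2:{ rewrite !CI_minus by (auto; apply ex_CI_const). rewrite !CI_const.
      replace (P (x', y') - P (x, y))%C with ((P (x', y') - P (x, y')) + (P (x, y') - P (x, y)))%C by ring.
      rewrite E1, E2.
      replace ((x', y') - (x, y))%C with (RtoC (x' - x) + Ci * RtoC (y' - y))%C. ring.
      unfold Cminus, Cplus, Copp, Cmult, RtoC, Ci; simpl. f_equal; ring. }
  eapply Rle_trans. apply Cmod_triangle. rewrite Cmod_mult, Cmod_Ci, Rmult_1_l.
  apply Rle_trans with (e / 2 * Rabs (x' - x) + e / 2 * Rabs (y' - y)).
  - apply Rplus_le_compat; apply CI_bound.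
    + apply ex_CI_cont. intros t Ht. apply contR_minus; [|apply contR_const].
      apply (contR_comp f (fun s => (s, y')) t). apply contR_horiz. apply Hf.
      apply Hnear. revert Ht; unfold Rmin, Rmax, Rabs.
      destruct (Rle_dec x x'); repeat destruct Rcase_abs; lra. lra.
    + intros t Ht. apply Hnear; [|lra]. revert Ht; unfold Rmin, Rmax, Rabs.
      destruct (Rle_dec x x'); repeat destruct Rcase_abs; lra.
    + apply ex_CI_cont. intros t Ht. apply contR_minus; [|apply contR_const].
      apply (contR_comp f (fun s => (x, s)) t). apply contR_vert. apply Hf.
      apply Hnear. rewrite Z. apply Rabs_pos. revert Ht; unfold Rmin, Rmax, Rabs.
      destruct (Rle_dec y y'); repeat destruct Rcase_abs; lra.
    + intros t Ht. apply Hnear. rewrite Z. apply Rabs_pos. revert Ht; unfold Rmin, Rmax, Rabs.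
      destruct (Rle_dec y y'); repeat destruct Rcase_abs; lra.
  - nra.
Qed.

Theorem primitive_except (f : C -> C) (w : C) : contD f ->
  (forall z, inD z -> z <> w -> ex_derive f z) ->
  exists P, is_deriv_on_D P f.
Proof.
  intros Hf Hd. apply primitive_of_rectJ; auto. intros x y H.
  destruct w as [p q].
  assert (Hx : - Rabs x <= x <= Rabs x) by (unfold Rabs; destruct Rcase_abs; lra).
  assert (Hy : - Rabs y <= y <= Rabs y) by (unfold Rabs; destruct Rcase_abs; lra).
  pose proof (Rabs_pos x). pose proof (Rabs_pos y).
  apply (goursat_rect_except f (- Rabs x) (Rabs x) (- Rabs y) (Rabs y)) with (p := p) (q := q); try lra.
  - apply contD_rect; auto.
  - intros s t Hs Ht Hne. apply Hd; auto. apply (inD_sub x y); auto; apply Rabs_le; auto.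
Qed.

Corollary primitive_holo (f : C -> C) : holo f -> exists P, is_deriv_on_D P f.
Proof.
  intros H. apply (primitive_except f (RtoC 0)). apply holo_contD; auto. intros; auto.
Qed.

(** * Cauchy's formula on circles *)

Lemma inD_segment (z w : C) (t : R) : inD z -> inD w -> 0 <= t <= 1 ->
  inD (z + RtoC t * (w - z))%C.
Proof.
  unfold inD. intros Hz Hw Ht.
  replace (z + RtoC t * (w - z))%C with (RtoC (1 - t) * z + RtoC t * w)%C
    by (rewrite RtoC_minus; ring).
  eapply Rle_lt_trans. apply Cmod_triangle. rewrite !Cmod_mult, !Cmod_R, !Rabs_pos_eq by lra.
  pose proof (Cmod_ge_0 z). pose proof (Cmod_ge_0 w).
  destruct (Req_dec t 0). subst; lra. nra.
Qed.

Lemma is_derive_segment (z v : C) (t : R) :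
  @is_derive R_AbsRing C_R_NormedModule (fun s => z + RtoC s * v)%C t v.
Proof.
  apply is_derive_R_eps. intros e He. exists 1. split. lra. intros s _.
  rewrite RtoC_minus.
  match goal with |- Cmod ?z <= _ => replace z with (RtoC 0) by ring end.
  rewrite Cmod_0. apply Rmult_le_pos. lra. apply Rabs_pos.
Qed.

Lemma contR_segment (f : C -> C) (z w : C) (t : R) : contD f -> inD z -> inD w -> 0 <= t <= 1 ->
  contR (fun s => f (z + RtoC s * (w - z)))%C t.
Proof.
  intros Hf Hz Hw Ht. apply (contR_comp f (fun s => z + RtoC s * (w - z))%C t).
  - eapply contR_derive. apply is_derive_segment.
  - apply Hf. apply inD_segment; auto.
Qed.

Lemma is_CI_segment (P f : C -> C) (z w : C) : contD f -> is_deriv_on_D P f -> inD z -> inD w ->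
  is_CI (fun t => f (z + RtoC t * (w - z)) * (w - z))%C 0 1 (P w - P z)%C.
Proof.
  intros Hf HP Hz Hw.
  replace (P w - P z)%C with (P (z + RtoC 1 * (w - z)) - P (z + RtoC 0 * (w - z)))%C.
  2:{ f_equal; [|f_equal]; f_equal; ring. }
  apply (CI_derive (fun t => P (z + RtoC t * (w - z)))%C (fun t => f (z + RtoC t * (w - z)) * (w - z))%C);
    rewrite Rmin_left, Rmax_right by lra; intros t Ht.
  - apply (is_derive_C_comp_R P (fun t => z + RtoC t * (w - z))%C t).
    apply HP. apply inD_segment; auto. apply is_derive_segment.
  - apply contR_mult; [|apply contR_const]. apply contR_segment; auto.
Qed.

(* The mean value inequality, in the form that survives locally uniform limits of [f]. *)
Lemma primitive_segment_bound (P f : C -> C) (z w c : C) (e : R) :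
  contD f -> is_deriv_on_D P f -> inD z -> inD w ->
  (forall t, 0 <= t <= 1 -> Cmod (f (z + RtoC t * (w - z)) - c)%C <= e) ->
  Cmod (P w - P z - (w - z) * c)%C <= e * Cmod (w - z)%C.
Proof.
  intros Hf HP Hz Hw He.
  assert (I := is_CI_segment P f z w Hf HP Hz Hw).
  assert (I2 : is_CI (fun _ : R => c * (w - z))%C 0 1 ((w - z) * c)%C).
  { replace ((w - z) * c)%C with (CI (fun _ => c * (w - z))%C 0 1).
    { apply CI_correct. apply ex_CI_const. }
    rewrite CI_const, Rminus_0_r. change (RtoC 1 * (c * (w - z)) = (w - z) * c)%C. ring. }
  assert (I3 := is_CI_minus _ _ _ _ _ _ I I2).
  rewrite <- (is_CI_unique _ _ _ _ I3).
  replace (e * Cmod (w - z)%C) with (e * Cmod (w - z)%C * Rabs (1 - 0))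
    by (rewrite Rminus_0_r, Rabs_R1; ring).
  apply CI_bound. eexists; exact I3.
  rewrite Rmin_left, Rmax_right by lra. intros t Ht.
  replace (f (z + RtoC t * (w - z)) * (w - z) - c * (w - z))%C
    with ((f (z + RtoC t * (w - z)) - c) * (w - z))%C by ring.
  rewrite Cmod_mult. apply Rmult_le_compat_r. apply Cmod_ge_0. auto.
Qed.

Lemma inD_0 : inD (RtoC 0).
Proof. unfold inD. rewrite Cmod_0. lra. Qed.

Lemma is_derive_real_eps (f : R -> R) (t l : R) :
  is_derive f t l <->
  forall e, 0 < e -> exists d, 0 < d /\
     forall s, Rabs (s - t) < d ->
       Rabs (f s - f t - (s - t) * l) <= e * Rabs (s - t).
Proof.
  split.
  - intros [_ H] e He.
    specialize (H t (fun P HP => HP) (mkposreal e He)).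
    destruct H as [d H]. exists d; split; [apply cond_pos|].
    intros w Hw. exact (H w Hw).
  - intros H. split.
    + apply is_linear_scal_l.
    + intros x Hx. apply (@is_filter_lim_locally_unique R_AbsRing (AbsRing_NormedModule R_AbsRing)) in Hx. subst x.
      intros e. destruct (H e (cond_pos e)) as (d & Hd & H').
      exists (mkposreal d Hd). intros w Hw. exact (H' w Hw).
Qed.

Lemma is_derive_pair (x y : R -> R) (t dx dy : R) :
  is_derive x t dx -> is_derive y t dy ->
  @is_derive R_AbsRing C_R_NormedModule (fun s => (x s, y s)) t (dx, dy).
Proof.
  rewrite !is_derive_real_eps, is_derive_R_eps. intros Hx Hy e He.
  destruct (Hx (e / 2) ltac:(lra)) as (d1 & H1 & Hx').
  destruct (Hy (e / 2) ltac:(lra)) as (d2 & H2 & Hy').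
  exists (Rmin d1 d2). split. apply Rmin_pos; auto. intros s Hs.
  pose proof (Rmin_l d1 d2). pose proof (Rmin_r d1 d2).
  specialize (Hx' s ltac:(lra)). specialize (Hy' s ltac:(lra)).
  replace ((x s, y s) - (x t, y t) - RtoC (s - t) * (dx, dy))%C with
    ((x s - x t - (s - t) * dx, y s - y t - (s - t) * dy) : C).
  2:{ unfold Cminus, Cplus, Copp, Cmult, RtoC; simpl; f_equal; ring. }
  eapply Rle_trans. apply Cmod_le_Rabs. lra.
Qed.

Definition circ (r t : R) : C := (r * cos t, r * sin t).

Lemma Cmod_circ (r t : R) : 0 <= r -> Cmod (circ r t) = r.
Proof.
  intros Hr. unfold Cmod, circ; simpl.
  replace (r * cos t * (r * cos t * 1) + r * sin t * (r * sin t * 1))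
    with (r * r * (Rsqr (sin t) + Rsqr (cos t))) by (unfold Rsqr; ring).
  rewrite sin2_cos2, Rmult_1_r. apply sqrt_square; auto.
Qed.

Lemma is_derive_circ (r t : R) :
  @is_derive R_AbsRing C_R_NormedModule (circ r) t (Ci * circ r t)%C.
Proof.
  replace (Ci * circ r t)%C with ((- r * sin t, r * cos t) : C)
    by (unfold circ, Ci, Cmult; simpl; f_equal; ring).
  apply (is_derive_pair (fun t => r * cos t) (fun t => r * sin t)); auto_derive; auto; ring.
Qed.

Lemma contR_circ (f : C -> C) (r t : R) : 0 <= r < 1 -> contD f ->
  contR (fun t => f (circ r t)) t.
Proof.
  intros Hr Hf. apply (contR_comp f (circ r) t).
  - eapply contR_derive. apply is_derive_circ.
  - apply Hf. unfold inD. rewrite Cmod_circ; lra.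
Qed.

Lemma inD_circ (r t : R) : 0 <= r < 1 -> inD (circ r t).
Proof. intros Hr. unfold inD. rewrite Cmod_circ; lra. Qed.

Lemma contR_circ_id (r t : R) : contR (circ r) t.
Proof. eapply contR_derive. apply is_derive_circ. Qed.

(** Along the circle a primitive returns to its initial value. In [dz = i z dt] the factor [i] is
    dropped, so that integrals over [t] read as means over the circle. *)
Lemma circle_integral_0 (P f : C -> C) (r : R) : 0 <= r < 1 -> contD f -> is_deriv_on_D P f ->
  is_CI (fun t => f (circ r t) * circ r t)%C 0 (2 * PI) (RtoC 0).
Proof.
  intros Hr Hf HP.
  assert (I : is_CI (fun t => f (circ r t) * (Ci * circ r t))%C 0 (2 * PI)
     (P (circ r (2 * PI)) - P (circ r 0))%C).
  { apply (CI_derive (fun t => P (circ r t)) (fun t => f (circ r t) * (Ci * circ r t))%C); intros t _.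
    - apply (is_derive_C_comp_R P (circ r) t). apply HP, inD_circ; auto. apply is_derive_circ.
    - apply contR_mult. apply contR_circ; auto. apply contR_mult. apply contR_const. apply contR_circ_id. }
  replace (circ r (2 * PI)) with (circ r 0) in I.
  2:{ unfold circ. rewrite cos_2PI, sin_2PI, cos_0, sin_0. reflexivity. }
  apply (is_CI_scal (- Ci)%C) in I.
  replace (- Ci * (P (circ r 0) - P (circ r 0)))%C with (RtoC 0) in I by ring.
  revert I. apply is_CI_ext. intros t _.
  transitivity (f (circ r t) * circ r t * (- (Ci * Ci)))%C. ring.
  replace (- (Ci * Ci))%C with (RtoC 1). ring.
  unfold Ci, Cmult, Copp, RtoC; simpl. f_equal; ring.
Qed.

Lemma is_CI_conj (p : R -> C) (a b : R) (l : C) :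
  is_CI p a b l -> is_CI (fun t => Cconj (p t)) a b (Cconj l).
Proof.
  rewrite !is_CI_pair. intros [H1 H2]. split; simpl.
  - exact H1.
  - exact (is_RInt_opp _ _ _ _ H2).
Qed.

Lemma neq_of_Cmod_lt (z w : C) : Cmod w < Cmod z -> (z - w)%C <> RtoC 0.
Proof.
  intros H E. apply Ceq_minus in E. subst. lra.
Qed.

(* [z/(z-w)] is on the circle the conjugate of the function [1/(1-cz)], [c = conj w/r^2],
   whose mean is its value at the centre. *)
Lemma cauchy_kernel_integral (w : C) (r : R) : 0 < r < 1 -> Cmod w < r * r ->
  is_CI (fun t => circ r t / (circ r t - w))%C 0 (2 * PI) (RtoC (2 * PI)).
Proof.
  intros Hr Hw.
  set (c := (Cconj w / RtoC (r * r))%C).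
  assert (Hrr : RtoC (r * r) <> RtoC 0). { intros E. apply RtoC_inj in E. nra. }
  (* This is where [|w| < r^2], stronger than [|w| < r], enters: the pole of [1/(1 - c z)] then lies
     outside the unit disk, and a primitive exists on the whole disk. *)
  assert (Hc : Cmod c < 1).
  { unfold c. rewrite Cmod_div, Cmod_conj, Cmod_R, Rabs_pos_eq by (auto; nra).
    apply (Rmult_lt_reg_r (r * r)). nra. unfold Rdiv. rewrite Rmult_assoc, Rinv_l by nra. lra. }
  assert (Hne : forall z, inD z -> (1 - c * z)%C <> RtoC 0).
  { intros z Hz. apply neq_of_Cmod_lt. rewrite Cmod_mult, Cmod_1.
    unfold inD in Hz. pose proof (Cmod_ge_0 c). pose proof (Cmod_ge_0 z). nra. }
  assert (Hh : holo (fun z => c / (1 - c * z))%C).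
  { intros z Hz. apply ex_derive_C_div; auto. apply ex_derive_C_const.
    apply ex_derive_C_minus. apply ex_derive_C_const.
    apply ex_derive_C_mult. apply ex_derive_C_const. apply ex_derive_C_id. }
  destruct (primitive_holo _ Hh) as [P HP].
  assert (I := circle_integral_0 P _ r ltac:(lra) (holo_contD _ Hh) HP).
  assert (I2 := CI_correct _ _ _ (ex_CI_const (RtoC 1) 0 (2 * PI))).
  rewrite CI_const in I2.
  assert (I3 := is_CI_conj _ _ _ _ (is_CI_plus _ _ _ _ _ _ I2 I)).
  replace (Cconj (RtoC (2 * PI - 0) * 1 + 0)) with (RtoC (2 * PI)) in I3.
  2:{ unfold Cconj, Cplus, Cmult, RtoC; simpl. f_equal; ring. }
  revert I3. apply is_CI_ext. intros t _.
  assert (Hz : inD (circ r t)) by (apply inD_circ; lra).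
  assert (Hm : Cmod (circ r t) = r) by (apply Cmod_circ; lra).
  set (z := circ r t) in *.
  assert (Hz0 : z <> RtoC 0). { apply Cmod_gt_0. lra. }
  assert (Hzw : (z - w)%C <> RtoC 0). { apply neq_of_Cmod_lt. nra. }
  (* On the circle [conj z = r^2 / z]. *)
  assert (Hcz : (Cconj c * Cconj z = w / z)%C).
  { unfold c. rewrite Cdiv_conj, Cconj_conj by auto.
    replace (Cconj (RtoC (r * r))) with (z * Cconj z)%C.
    2:{ rewrite <- Cmod2_conj, Hm. unfold Cconj, RtoC; simpl. f_equal; ring. }
    field. split; auto. intros E. apply Hz0. rewrite <- (Cconj_conj z), E.
    unfold Cconj, RtoC; simpl; f_equal; ring. }
  assert (H1 := Hne z Hz).
  replace (1 + c / (1 - c * z) * z)%C with (/ (1 - c * z))%C by (field; auto).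
  rewrite Cinv_conj by auto. rewrite Cminus_conj, Cmult_conj, Hcz.
  replace (Cconj (RtoC 1)) with (RtoC 1) by (unfold Cconj, RtoC; simpl; f_equal; ring).
  field. split; auto.
Qed.

(** The difference quotient [q] of [f] at [w] is continuous, and differentiable off [w], so it has a
    primitive and [q z * z] has mean zero on the circle. It remains to write [f z * z/(z - w)] as
    [q z * z + f w * z/(z - w)]. *)
Theorem cauchy_formula (f : C -> C) (w : C) (r : R) : holo f -> 0 < r < 1 -> Cmod w < r * r ->
  is_CI (fun t => f (circ r t) * (circ r t / (circ r t - w)))%C 0 (2 * PI) (RtoC (2 * PI) * f w)%C.
Proof.
  intros Hf Hr Hw.
  assert (Hw1 : inD w) by (unfold inD; nra).
  destruct (Hf w Hw1) as [l Hl].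
  set (q := fun z => if excluded_middle_informative (z = w) then l else ((f z - f w) / (z - w))%C).
  assert (Hq : forall z, z <> w -> q z = ((f z - f w) / (z - w))%C).
  { intros z Hz. unfold q. destruct excluded_middle_informative; tauto. }
  assert (Hqw : q w = l).
  { unfold q. destruct excluded_middle_informative; tauto. }
  assert (Hqd : forall z, inD z -> z <> w -> ex_derive q z).
  { intros z Hz Hzw.
    apply (ex_derive_C_ext_loc (fun z => (f z - f w) / (z - w))%C).
    - exists (Cmod (z - w)%C). assert (0 < Cmod (z - w)%C).
      { apply Cmod_gt_0. apply Cminus_eq_contra; auto. }
      split; auto. intros y Hy. symmetry. apply Hq. intros ->.
      rewrite Cmod_minus_sym in Hy. lra.
    - apply ex_derive_C_div.
      + apply Cminus_eq_contra; auto.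
      + apply ex_derive_C_minus; auto. apply ex_derive_C_const.
      + apply ex_derive_C_minus. apply ex_derive_C_id. apply ex_derive_C_const. }
  assert (Hqc : contD q).
  { intros z Hz. destruct (classic (z = w)) as [->|Hzw].
    - apply cont_eps. intros e He. rewrite is_derive_C_eps in Hl.
      destruct (Hl (e / 2) ltac:(lra)) as (d & Hd & H). exists d; split; [exact Hd|].
      intros y Hy. rewrite Hqw. destruct (classic (y = w)) as [->|Hyw].
      + rewrite Hqw. replace (l - l)%C with (RtoC 0) by ring. rewrite Cmod_0. lra.
      + rewrite Hq by auto. specialize (H y Hy).
        assert (Hyw' : (y - w)%C <> RtoC 0) by (apply Cminus_eq_contra; auto).
        replace ((f y - f w) / (y - w) - l)%C with ((f y - f w - (y - w) * l) / (y - w))%C by (field; auto).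
        rewrite Cmod_div by auto. apply Cmod_gt_0 in Hyw'.
        apply Rle_lt_trans with (e / 2); [|lra].
        apply (Rmult_le_reg_r (Cmod (y - w)%C)); auto.
        unfold Rdiv at 1. rewrite Rmult_assoc, Rinv_l, Rmult_1_r by lra. auto.
    - apply ex_derive_C_cont. auto. }
  destruct (primitive_except q w Hqc Hqd) as [P HP].
  assert (I := circle_integral_0 P q r ltac:(lra) Hqc HP).
  assert (I2 := is_CI_scal (f w) _ _ _ _ (cauchy_kernel_integral w r Hr Hw)).
  assert (I3 := is_CI_plus _ _ _ _ _ _ I I2).
  replace (RtoC 0 + f w * RtoC (2 * PI))%C with (RtoC (2 * PI) * f w)%C in I3 by ring.
  revert I3. apply is_CI_ext. intros t _.
  assert (Hzw : (circ r t - w)%C <> RtoC 0).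
  { apply neq_of_Cmod_lt. rewrite Cmod_circ by lra. nra. }
  rewrite Hq. field; auto. intros E. apply Hzw. rewrite E. ring.
Qed.

(** For analytic [f] and [0 < r < 1] this is [2 PI] times the [k]-th Taylor coefficient at 0. *)
Definition coef (f : C -> C) (r : R) (k : nat) : C :=
  CI (fun t => f (circ r t) * / Cpow (circ r t) k)%C 0 (2 * PI).

Section Coef.

Variables (f : C -> C) (r : R).
Hypotheses (Hf : holo f) (Hr : 0 < r < 1).

Lemma circ_neq_0 (t : R) : circ r t <> RtoC 0.
Proof. apply Cmod_gt_0. rewrite Cmod_circ; lra. Qed.

Lemma contR_inv (p : R -> C) (t : R) : contR p t -> p t <> RtoC 0 -> contR (fun s => / p s)%C t.
Proof.
  intros Hp Hz. apply (contR_comp (fun z => / z)%C p t Hp).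
  eapply is_derive_C_cont. apply is_derive_C_inv; auto.
Qed.

Lemma contR_pow (p : R -> C) (n : nat) (t : R) : contR p t -> contR (fun s => Cpow (p s) n) t.
Proof.
  intros Hp. induction n; simpl. apply contR_const. apply contR_mult; auto.
Qed.

Lemma ex_CI_coef (k : nat) : ex_CI (fun t => f (circ r t) * / Cpow (circ r t) k)%C 0 (2 * PI).
Proof.
  apply ex_CI_cont. intros t _. apply contR_mult.
  - apply contR_circ. lra. apply holo_contD; auto.
  - apply contR_inv. apply contR_pow. apply contR_circ_id.
    apply Cpow_nz. apply circ_neq_0.
Qed.

Lemma coef_bound (M : R) (k : nat) : (forall z, Cmod z = r -> Cmod (f z) <= M) ->
  Cmod (coef f r k) <= M / r ^ k * (2 * PI).
Proof.
  intros HM. pose proof PI_RGT_0.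
  replace (2 * PI) with (Rabs (2 * PI - 0)) by (rewrite Rminus_0_r, Rabs_pos_eq; lra).
  apply CI_bound. apply ex_CI_coef. intros t _.
  rewrite Cmod_mult, Cmod_inv, Cmod_pow, Cmod_circ by (try apply Cpow_nz, circ_neq_0; lra).
  apply Rmult_le_compat_r.
  - apply Rlt_le, Rinv_0_lt_compat, pow_lt; lra.
  - apply HM. apply Cmod_circ; lra.
Qed.

(** A finite Taylor expansion with remainder takes the place of the power series. It is used to pass
    from convergence of coefficients to uniform convergence on smaller disks. *)
Lemma taylor_bound (M eta : R) (K : nat) (w : C) :
  (forall z, Cmod z = r -> Cmod (f z) <= M) ->
  (forall k, (k < K)%nat -> Cmod (coef f r k) <= eta) -> Cmod w < r * r ->
  2 * PI * Cmod (f w) <= INR K * eta + M * ((Cmod w / r) ^ K * (r / (r - Cmod w))) * (2 * PI).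
Proof.
  intros HM Heta Hw. pose proof PI_RGT_0.
  pose proof (Cmod_ge_0 w).
  assert (Hwr : Cmod w < r) by nra.
  assert (Hzw : forall t, (circ r t - w)%C <> RtoC 0).
  { intros t. apply neq_of_Cmod_lt. rewrite Cmod_circ by lra. nra. }
  (* [g k] is the Cauchy integrand after [k] terms have been split off by means of
     [z/(z - w) = 1 + (w/z) * z/(z - w)]. *)
  set (g := fun k t => (f (circ r t) * (Cpow (w / circ r t) k * (circ r t / (circ r t - w))))%C).
  assert (Hg : forall k, ex_CI (g k) 0 (2 * PI)).
  { intros k. apply ex_CI_cont. intros t _. apply contR_mult.
    - apply contR_circ. lra. apply holo_contD; auto.
    - apply contR_mult. apply contR_pow. apply contR_mult. apply contR_const.
      apply contR_inv. apply contR_circ_id. apply circ_neq_0.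
      apply contR_mult. apply contR_circ_id. apply contR_inv; auto.
      apply contR_minus. apply contR_circ_id. apply contR_const. }
  assert (S : forall k, CI (g k) 0 (2 * PI) = (Cpow w k * coef f r k + CI (g (S k)) 0 (2 * PI))%C).
  { intros k. apply is_CI_unique.
    assert (I := is_CI_plus _ _ _ _ _ _ (is_CI_scal (Cpow w k) _ _ _ _ (CI_correct _ _ _ (ex_CI_coef k)))
      (CI_correct _ _ _ (Hg (S k)))).
    revert I. apply is_CI_ext. intros t _. unfold g. simpl Cpow.
    pose proof (circ_neq_0 t). assert (Cpow (circ r t) k <> RtoC 0) by (apply Cpow_nz; auto).
    replace (Cpow (w / circ r t) k) with (Cpow w k / Cpow (circ r t) k)%C.
    field. repeat split; auto.
    unfold Cdiv. rewrite Cpow_mult_l, Cpow_inv; auto. }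
  assert (B : forall k, (k <= K)%nat -> Cmod (CI (g 0%nat) 0 (2 * PI)) <= INR k * eta + Cmod (CI (g k) 0 (2 * PI))).
  { induction k; intros Hk. simpl. lra.
    eapply Rle_trans. apply IHk; lia. rewrite S_INR, (S k).
    assert (Cmod (Cpow w k * coef f r k + CI (g (Datatypes.S k)) 0 (2 * PI))%C <=
      eta + Cmod (CI (g (Datatypes.S k)) 0 (2 * PI))).
    { eapply Rle_trans. apply Cmod_triangle. apply Rplus_le_compat_r.
      rewrite Cmod_mult, Cmod_pow. specialize (Heta k ltac:(lia)).
      assert (Cmod w ^ k <= 1). { rewrite <- (pow1 k). apply pow_incr. lra. }
      assert (0 <= Cmod w ^ k) by (apply pow_le; lra).
      pose proof (Cmod_ge_0 (coef f r k)). nra. }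
    lra. }
  assert (E : CI (g 0%nat) 0 (2 * PI) = (RtoC (2 * PI) * f w)%C).
  { apply is_CI_unique. generalize (cauchy_formula f w r Hf Hr Hw).
    apply is_CI_ext. intros t _. unfold g. simpl. ring. }
  specialize (B K (le_n K)). rewrite E, Cmod_mult, Cmod_R, Rabs_pos_eq in B by lra.
  eapply Rle_trans. apply B. apply Rplus_le_compat_l.
  replace (2 * PI) with (Rabs (2 * PI - 0)) at 2 by (rewrite Rminus_0_r, Rabs_pos_eq; lra).
  apply CI_bound; auto. intros t _. unfold g.
  assert (Hm : Cmod (circ r t) = r) by (apply Cmod_circ; lra).
  rewrite Cmod_mult. apply Rmult_le_compat; try apply Cmod_ge_0. auto.
  rewrite Cmod_mult, Cmod_pow, !Cmod_div, Hm by (auto using circ_neq_0).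
  apply Rmult_le_compat_l. apply pow_le. apply Rdiv_le_0_compat; lra.
  apply Rmult_le_compat_l. lra. apply Rinv_le_contravar. lra.
  rewrite <- Hm at 1. apply Cmod_triangle_inv.
Qed.

End Coef.

(** * Montel's theorem *)

Definition incr (phi : nat -> nat) : Prop := forall k, (phi k < phi (S k))%nat.

Lemma incr_lt (phi : nat -> nat) : incr phi -> forall m n, (m < n)%nat -> (phi m < phi n)%nat.
Proof.
  intros H m n Hmn. induction Hmn. apply H. specialize (H m0). lia.
Qed.

Lemma incr_ge (phi : nat -> nat) : incr phi -> forall n, (n <= phi n)%nat.
Proof. intros H n. induction n. lia. specialize (H n). lia. Qed.

Lemma incr_comp (phi psi : nat -> nat) : incr phi -> incr psi -> incr (fun n => phi (psi n)).
Proof. intros H1 H2 k. apply incr_lt; auto. Qed.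

(** [Q k phi] abstracts the convergence of the [k]-th sequence along [phi]. It has to survive
    passing to a subsequence up to finitely many terms, because the diagonal is a subsequence of the
    [k]-th extraction only from some rank on. *)
Lemma diagonal_subsequence (Q : nat -> (nat -> nat) -> Prop) :
  (forall k phi, incr phi -> exists psi, incr psi /\ Q k (fun n => phi (psi n))) ->
  (forall k phi phi' N, Q k phi ->
     (forall n, (N <= n)%nat -> exists j, (n <= j)%nat /\ phi' n = phi j) -> Q k phi') ->
  exists phi, incr phi /\ forall k, Q k phi.
Proof.
  intros Hex Hsub.
  set (T := {phi : nat -> nat | incr phi}).
  assert (next : forall k (p : T), exists psi, incr psi /\ Q k (fun n => proj1_sig p (psi n))).
  { intros k [p Hp]. apply Hex; auto. }
  set (psi := fun k p => proj1_sig (constructive_indefinite_description _ (next k p))).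
  assert (Hpsi : forall k p, incr (psi k p) /\ Q k (fun n => proj1_sig p (psi k p n))).
  { intros k p. unfold psi. destruct constructive_indefinite_description; auto. }
  set (nx := fun k (p : T) =>
    exist incr (fun n => proj1_sig p (psi k p n)) (incr_comp _ _ (proj2_sig p) (proj1 (Hpsi k p))) : T).
  assert (Hid : incr (fun n => n)) by (intros k; lia).
  (* Stage [k] composes [k] successive extractions; the subset type keeps monotonicity at hand for
     the next one. *)
  set (F := fix F k := match k with O => exist _ (fun n => n) Hid : T | S k => nx k (F k) end).
  set (p := fun k => proj1_sig (F k)).
  assert (Hp : forall k, incr (p k)) by (intros k; apply proj2_sig).
  assert (HpS : forall k n, p (S k) n = p k (psi k (F k) n)) by reflexivity.
  assert (HQ : forall k, Q k (p (S k))) by (intros k; apply Hpsi).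
  assert (Hch : forall k i n, exists j, (n <= j)%nat /\ p (k + i)%nat n = p k j).
  { intros k i. induction i; intros n.
    - exists n. rewrite Nat.add_0_r. auto.
    - rewrite Nat.add_succ_r, HpS.
      destruct (IHi (psi (k + i)%nat (F (k + i)%nat) n)) as (j & Hj & E).
      exists j. split; auto.
      pose proof (incr_ge _ (proj1 (Hpsi (k + i)%nat (F (k + i)%nat))) n). lia. }
  exists (fun n => p n n). split.
  - intros k. rewrite HpS. apply incr_lt; auto.
    pose proof (incr_ge _ (proj1 (Hpsi k (F k))) (S k)). lia.
  (* Property [k] is secured by the extraction that leads from [p k] to [p (S k)], hence the rank
     [S k]. *)
  - intros k. apply (Hsub k (p (S k)) _ (S k)); auto.
    intros n Hn. destruct (Hch (S k) (n - S k)%nat n) as (j & Hj & E).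
    exists j. split; auto. rewrite <- E. f_equal. lia.
Qed.

Definition CauchyC (u : nat -> C) : Prop :=
  forall e, 0 < e -> exists N, forall n m, (N <= n)%nat -> (N <= m)%nat -> Cmod (u n - u m)%C <= e.

Lemma bolzano_weierstrass_subseq (u : nat -> R) (M : R) : (forall n, Rabs (u n) <= M) ->
  exists psi, incr psi /\
    forall e, 0 < e -> exists N, forall n m, (N <= n)%nat -> (N <= m)%nat ->
      Rabs (u (psi n) - u (psi m)) <= e.
Proof.
  intros HM.
  destruct (Bolzano_Weierstrass u (fun x => - M <= x <= M)) as [l Hl].
  - apply compact_P3.
  - intros n. specialize (HM n). revert HM. unfold Rabs. destruct Rcase_abs; lra.
  - assert (Hn : forall N k, exists p, (N <= p)%nat /\ Rabs (u p - l) < / INR (S k)).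
    { intros N k. assert (Hk : 0 < / INR (S k)) by (apply Rinv_0_lt_compat, lt_0_INR; lia).
      destruct (Hl (fun x => Rabs (x - l) < / INR (S k)) N) as (p & Hp & H).
      - exists (mkposreal _ Hk). intros x Hx. exact Hx.
      - exists p; auto. }
    set (nx := fun N k => proj1_sig (constructive_indefinite_description _ (Hn N k))).
    assert (Hnx : forall N k, (N <= nx N k)%nat /\ Rabs (u (nx N k) - l) < / INR (S k)).
    { intros N k. unfold nx. destruct constructive_indefinite_description; auto. }
    set (psi := fix psi k := match k with O => nx O O | S k => nx (S (psi k)) (S k) end).
    exists psi. split.
    + intros k. simpl. destruct (Hnx (S (psi k)) (S k)). lia.
    + assert (Hp : forall k, Rabs (u (psi k) - l) < / INR (S k)).
      { intros [|k]; simpl psi; apply Hnx. }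
      intros e He. destruct (INR_archimed 1 (2 / e) ltac:(lra)) as [N HN].
      exists N. intros n m Hn' Hm'.
      assert (G : forall n, (N <= n)%nat -> Rabs (u (psi n) - l) <= e / 2).
      { intros k Hk. apply Rlt_le. eapply Rlt_le_trans. apply Hp.
        assert (INR N <= INR (S k)) by (apply le_INR; lia).
        assert (0 < 2 / e) by (apply Rdiv_lt_0_compat; lra).
        replace (e / 2) with (/ (2 / e)) by (field; lra).
        apply Rinv_le_contravar; lra. }
      pose proof (G n Hn') as G1. pose proof (G m Hm') as G2.
      replace (u (psi n) - u (psi m)) with ((u (psi n) - l) - (u (psi m) - l)) by ring.
      eapply Rle_trans. apply Rabs_triang. rewrite Rabs_Ropp. lra.
Qed.

Lemma CauchyC_subseq (u : nat -> C) (M : R) (phi : nat -> nat) : incr phi ->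
  (forall n, Cmod (u n) <= M) -> exists psi, incr psi /\ CauchyC (fun n => u (phi (psi n))).
Proof.
  intros Hphi HM.
  destruct (bolzano_weierstrass_subseq (fun n => fst (u (phi n))) M) as (p1 & Hp1 & H1).
  { intros n. eapply Rle_trans. apply Rabs_fst_le_Cmod. apply HM. }
  destruct (bolzano_weierstrass_subseq (fun n => snd (u (phi (p1 n)))) M) as (p2 & Hp2 & H2).
  { intros n. eapply Rle_trans. apply Rabs_snd_le_Cmod. apply HM. }
  exists (fun n => p1 (p2 n)). split. apply incr_comp; auto.
  intros e He. destruct (H1 (e / 2) ltac:(lra)) as [N1 HN1].
  destruct (H2 (e / 2) ltac:(lra)) as [N2 HN2].
  exists (max N1 N2). intros n m Hn Hm.
  pose proof (incr_ge _ Hp2 n). pose proof (incr_ge _ Hp2 m).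
  specialize (HN1 (p2 n) (p2 m) ltac:(lia) ltac:(lia)).
  specialize (HN2 n m ltac:(lia) ltac:(lia)).
  destruct (u (phi (p1 (p2 n)))) as [a b]. destruct (u (phi (p1 (p2 m)))) as [c d].
  simpl in HN1, HN2.
  replace ((a, b) - (c, d))%C with ((a - c, b - d) : C) by reflexivity.
  eapply Rle_trans. apply Cmod_le_Rabs. lra.
Qed.

(** The limit inherits every Cauchy estimate with the same [e] and [N]. Limits chosen point by point
    therefore turn a uniform Cauchy estimate into uniform convergence. *)
Lemma CauchyC_limit (u : nat -> C) : CauchyC u ->
  exists l, forall e N, (forall n m, (N <= n)%nat -> (N <= m)%nat -> Cmod (u n - u m)%C <= e) ->
    forall n, (N <= n)%nat -> Cmod (u n - l)%C <= e.
Proof.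
  intros H.
  assert (G : forall g : C -> R, (forall z w, Rabs (g z - g w) <= Cmod (z - w)%C) ->
     exists l : R, is_lim_seq (fun n => g (u n)) l).
  { intros g Hg. apply ex_lim_seq_cauchy_corr. intros e.
    destruct (H (e / 2) ltac:(generalize (cond_pos e); lra)) as [N HN].
    exists N. intros n m Hn Hm. eapply Rle_lt_trans. apply Hg.
    eapply Rle_lt_trans. apply HN; auto. generalize (cond_pos e); lra. }
  destruct (G fst) as [a Ha]. { intros z w. apply (Rabs_fst_le_Cmod (z - w)%C). }
  destruct (G snd) as [b Hb]. { intros z w. apply (Rabs_snd_le_Cmod (z - w)%C). }
  exists ((a, b) : C). intros e N HN n Hn.
  apply le_epsilon. intros d Hd.
  apply is_lim_seq_spec in Ha. apply is_lim_seq_spec in Hb.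
  assert (Hd2 : 0 < d / 2) by lra.
  destruct (Ha (mkposreal _ Hd2)) as [N1 H1]. destruct (Hb (mkposreal _ Hd2)) as [N2 H2].
  set (m := max N (max N1 N2)).
  specialize (H1 m ltac:(lia)). specialize (H2 m ltac:(lia)). specialize (HN n m Hn ltac:(lia)).
  simpl in H1, H2.
  replace (u n - (a, b))%C with ((u n - u m) + (u m - (a, b)))%C by ring.
  eapply Rle_trans. apply Cmod_triangle. apply Rplus_le_compat; auto.
  destruct (u m) as [x y]. simpl in H1, H2.
  replace ((x, y) - (a, b))%C with ((x - a, y - b) : C) by reflexivity.
  eapply Rle_trans. apply Cmod_le_Rabs. lra.
Qed.

Lemma coef_minus (f g : C -> C) (r : R) (k : nat) : holo f -> holo g -> 0 < r < 1 ->
  coef (fun z => f z - g z)%C r k = (coef f r k - coef g r k)%C.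
Proof.
  intros Hf Hg Hr. apply is_CI_unique.
  generalize (is_CI_minus _ _ _ _ _ _ (CI_correct _ _ _ (ex_CI_coef f r Hf Hr k))
    (CI_correct _ _ _ (ex_CI_coef g r Hg Hr k))).
  apply is_CI_ext. intros t _. ring.
Qed.

(** A countable family of radii tending to 1, as diagonal extraction requires; the shift by 2 makes
    the first one [1/2] rather than 0. *)
Definition rad (m : nat) : R := 1 - / INR (m + 2).

Lemma rad_bounds (m : nat) : 0 < rad m < 1.
Proof.
  unfold rad. assert (2 <= INR (m + 2)).
  { rewrite plus_INR. pose proof (pos_INR m). simpl. lra. }
  assert (0 < / INR (m + 2)) by (apply Rinv_0_lt_compat; lra).
  assert (/ INR (m + 2) <= / 2) by (apply Rinv_le_contravar; lra). lra.
Qed.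

(** The square matches the hypothesis [Cmod w < r * r] of [taylor_bound]. *)
Lemma rad_large (r : R) : r < 1 -> exists m, r < rad m * rad m.
Proof.
  intros Hr. destruct (INR_archimed 1 (2 / (1 - r)) ltac:(lra)) as [m Hm].
  exists m. assert (H0 : 0 < 2 / (1 - r)) by (apply Rdiv_lt_0_compat; lra).
  assert (/ INR (m + 2) < (1 - r) / 2).
  { replace ((1 - r) / 2) with (/ (2 / (1 - r))) by (field; lra).
    apply Rinv_lt_contravar. apply Rmult_lt_0_compat; auto.
    all: rewrite plus_INR; simpl; lra. }
  pose proof (rad_bounds m). unfold rad in *. nra.
Qed.

(** The coefficients on each circle of radius [rad m] are bounded, so a diagonal subsequence makes
    all of them Cauchy, and [taylor_bound] for differences gives locally uniform Cauchy estimates.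
    Analyticity is recovered later, for the image of the limit under [Tg]. *)
Theorem montel (fs : nat -> C -> C) (Mb : R -> R) :
  (forall n, holo (fs n)) ->
  (forall n r z, r < 1 -> Cmod z <= r -> Cmod (fs n z) <= Mb r) ->
  exists phi f, incr phi /\
    forall r e, r < 1 -> 0 < e -> exists N, forall n, (N <= n)%nat ->
      forall z, Cmod z <= r -> Cmod (fs (phi n) z - f z)%C <= e.
Proof.
  intros Hh HM.
  (* The Cantor pairing enumerates all pairs of a radius and a degree. *)
  set (u := fun j n => coef (fs n) (rad (fst (of_nat j))) (snd (of_nat j))).
  destruct (diagonal_subsequence (fun j phi => CauchyC (fun n => u j (phi n)))) as (phi & Hphi & HC).
  { intros j phi Hphi.
    set (r := rad (fst (of_nat j))). assert (Hr : 0 < r < 1) by apply rad_bounds.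
    apply (CauchyC_subseq (u j) (Mb r / r ^ (snd (of_nat j)) * (2 * PI))); auto.
    intros n. apply (coef_bound (fs n) r (Hh n) Hr (Mb r) (snd (of_nat j))).
    intros z Hz. apply HM; lra. }
  { intros j phi phi' N HC Hs e He. destruct (HC e He) as [N1 HN1].
    exists (max N N1). intros n m Hn Hm.
    destruct (Hs n ltac:(lia)) as (a & Ha & ->). destruct (Hs m ltac:(lia)) as (b & Hb & ->).
    apply HN1; lia. }
  assert (U : forall r e, 0 <= r < 1 -> 0 < e -> exists N, forall n m, (N <= n)%nat -> (N <= m)%nat ->
     forall z, Cmod z <= r -> Cmod (fs (phi n) z - fs (phi m) z)%C <= e).
  { intros r e Hr He. destruct (rad_large r ltac:(lra)) as [m0 Hm0].
    set (rho := rad m0) in *. assert (Hrho : 0 < rho < 1) by apply rad_bounds.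
    pose proof PI_RGT_0 as Hpi.
    assert (Hrr : r < rho) by nra.
    set (A := 2 * Mb rho * (rho / (rho - r))).
    assert (HA : 0 <= A).
    { unfold A. apply Rmult_le_pos. 2: apply Rdiv_le_0_compat; lra.
      generalize (HM O rho (RtoC 0) ltac:(lra) ltac:(rewrite Cmod_0; lra)) (Cmod_ge_0 (fs O (RtoC 0))). lra. }
    assert (HMb : 0 <= Mb rho).
    { generalize (HM O rho (RtoC 0) ltac:(lra) ltac:(rewrite Cmod_0; lra)) (Cmod_ge_0 (fs O (RtoC 0))). lra. }
    assert (Hq : 0 <= r / rho < 1).
    { split. apply Rdiv_le_0_compat; lra. apply (Rmult_lt_reg_r rho). lra.
      unfold Rdiv. rewrite Rmult_assoc, Rinv_l; lra. }
    (* [K] makes the Taylor remainder of a difference, which is bounded by [2 * Mb rho], at most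
       [e/2]. Then [eta] makes the first [K] coefficients contribute at most [e * PI], the other
       half of [2 PI e]. *)
    destruct (pow_lt_1_zero (r / rho) ltac:(rewrite Rabs_pos_eq; lra) (e / (2 * (1 + A)))) as [K HK].
    { apply Rdiv_lt_0_compat; lra. }
    specialize (HK K (le_n K)). rewrite Rabs_pos_eq in HK by (apply pow_le; lra).
    set (eta := e * PI / (INR K + 1)).
    pose proof (pos_INR K) as HK0.
    assert (Heta : 0 < eta).
    { unfold eta. apply Rdiv_lt_0_compat. apply Rmult_lt_0_compat; lra. lra. }
    assert (HN : exists N, forall k, (k < K)%nat -> forall n m, (N <= n)%nat -> (N <= m)%nat ->
      Cmod (coef (fs (phi n)) rho k - coef (fs (phi m)) rho k)%C <= eta).
    { clear HK HK0. clearbody eta. induction K.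
      - exists O. intros; lia.
      - destruct IHK as [N1 HN1]. destruct (HC (to_nat (m0, K)) eta Heta) as [N2 HN2].
        exists (max N1 N2). intros k Hk n m Hn Hm.
        destruct (Nat.eq_dec k K) as [->|Hne].
        + specialize (HN2 n m ltac:(lia) ltac:(lia)). unfold u in HN2.
          rewrite cancel_of_to in HN2. exact HN2.
        + apply HN1; lia. }
    destruct HN as [N HN]. exists N. intros n m Hn Hm z Hz.
    assert (Hd : holo (fun z => fs (phi n) z - fs (phi m) z)%C).
    { intros w Hw. apply ex_derive_C_minus; apply Hh; auto. }
    pose proof (Cmod_ge_0 z) as Hz0.
    assert (T := taylor_bound _ rho Hd Hrho (2 * Mb rho) eta K z).
    assert (T' : 2 * PI * Cmod (fs (phi n) z - fs (phi m) z)%C <=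
      INR K * eta + 2 * Mb rho * ((Cmod z / rho) ^ K * (rho / (rho - Cmod z))) * (2 * PI)).
    { apply T.
      - intros w Hw. eapply Rle_trans. apply Cmod_triangle_minus.
        generalize (HM (phi n) rho w ltac:(lra) ltac:(lra)) (HM (phi m) rho w ltac:(lra) ltac:(lra)). lra.
      - intros k Hk. rewrite coef_minus; auto.
      - lra. }
    clear T.
    assert (B1 : INR K * eta <= e * PI).
    { unfold eta. apply (Rmult_le_reg_r (INR K + 1)). lra.
      replace (INR K * (e * PI / (INR K + 1)) * (INR K + 1)) with (INR K * (e * PI)) by (field; lra).
      assert (0 < e * PI) by (apply Rmult_lt_0_compat; lra). nra. }
    assert (B2 : (Cmod z / rho) ^ K * (rho / (rho - Cmod z)) <= (r / rho) ^ K * (rho / (rho - r))).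
    { apply Rmult_le_compat.
      - apply pow_le. apply Rdiv_le_0_compat; lra.
      - apply Rdiv_le_0_compat; lra.
      - apply pow_incr. split. apply Rdiv_le_0_compat; lra.
        apply Rmult_le_compat_r. apply Rlt_le, Rinv_0_lt_compat; lra. lra.
      - apply Rmult_le_compat_l. lra. apply Rinv_le_contravar; lra. }
    assert (B3 : (r / rho) ^ K * A <= e / 2).
    { apply Rle_trans with (e / (2 * (1 + A)) * A).
      apply Rmult_le_compat_r; lra.
      apply (Rmult_le_reg_r (2 * (1 + A))). lra.
      replace (e / (2 * (1 + A)) * A * (2 * (1 + A))) with (e * A) by (field; lra). nra. }
    assert (B4 : 2 * Mb rho * ((Cmod z / rho) ^ K * (rho / (rho - Cmod z))) <= e / 2).
    { eapply Rle_trans; [|exact B3]. unfold A.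
      replace ((r / rho) ^ K * (2 * Mb rho * (rho / (rho - r)))) with
       (2 * Mb rho * ((r / rho) ^ K * (rho / (rho - r)))) by ring.
      apply Rmult_le_compat_l; lra. }
    apply (Rmult_le_reg_l (2 * PI)). lra.
    eapply Rle_trans. apply T'.
    apply Rle_trans with (e * PI + e / 2 * (2 * PI)).
    - apply Rplus_le_compat; auto. apply Rmult_le_compat_r; lra.
    - lra. }
  (* Stated for every [z], with 0 as default outside the disk, so that choice yields a total
     function. *)
  assert (L : forall z, exists l, inD z -> forall e N,
     (forall n m, (N <= n)%nat -> (N <= m)%nat -> Cmod (fs (phi n) z - fs (phi m) z)%C <= e) ->
     forall n, (N <= n)%nat -> Cmod (fs (phi n) z - l)%C <= e).
  { intros z. destruct (classic (inD z)) as [Hz|Hz].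
    - destruct (CauchyC_limit (fun n => fs (phi n) z)) as [l Hl].
      + intros e He. destruct (U (Cmod z) e) as [N HN]; auto.
        * split. apply Cmod_ge_0. exact Hz.
        * exists N. intros n m Hn Hm. apply HN; auto. lra.
      + exists l. intros _. exact Hl.
    - exists (RtoC 0). tauto. }
  exists phi, (fun z => proj1_sig (constructive_indefinite_description _ (L z))). split; auto.
  intros r e Hr He. destruct (U (Rmax 0 r) e) as [N HN]; auto.
  { split. apply Rmax_l. apply Rmax_lub_lt; lra. }
  exists N. intros n Hn z Hz. destruct (constructive_indefinite_description _ (L z)) as [l Hl]; simpl.
  assert (Cmod z <= Rmax 0 r) by (eapply Rle_trans; [exact Hz | apply Rmax_r]).
  apply (Hl ltac:(unfold inD; lra) e N); auto.
Qed.

(** * The Volterra operator and the Bloch condition *)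

Lemma cexp_plus (z w : C) : cexp (z + w)%C = (cexp z * cexp w)%C.
Proof.
  destruct z as [a b], w as [c d]. unfold cexp, Cplus, Cmult, Re, Im; simpl.
  rewrite exp_plus, cos_plus, sin_plus. f_equal; ring.
Qed.

Lemma Cmod_cexp (z : C) : Cmod (cexp z) = exp (Re z).
Proof.
  apply (Cmod_circ (exp (Re z)) (Im z)). apply Rlt_le, exp_pos.
Qed.

Lemma is_derive_cexp_0 : is_derive cexp (RtoC 0) (RtoC 1).
Proof.
  apply is_derive_C_eps. intros e He.
  (* The error splits below into four products, bounded by 1, 2, 3 and 2 times [e1 * m], 8 in
     all. *)
  set (e1 := Rmin 1 (e / 8)).
  assert (He1 : 0 < e1) by (apply Rmin_pos; lra).
  assert (He1' : e1 <= 1 /\ e1 <= e / 8) by (split; [apply Rmin_l | apply Rmin_r]).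
  clearbody e1.
  assert (D1 : is_derive exp 0 1) by (auto_derive; auto; rewrite exp_0; ring).
  assert (D2 : is_derive cos 0 0) by (auto_derive; auto; rewrite sin_0; ring).
  assert (D3 : is_derive sin 0 1) by (auto_derive; auto; rewrite cos_0; ring).
  destruct (proj1 (is_derive_real_eps _ _ _) D1 e1 He1) as (d1 & Hd1 & H1).
  destruct (proj1 (is_derive_real_eps _ _ _) D2 e1 He1) as (d2 & Hd2 & H2).
  destruct (proj1 (is_derive_real_eps _ _ _) D3 e1 He1) as (d3 & Hd3 & H3).
  exists (Rmin e1 (Rmin d1 (Rmin d2 d3))). split. repeat apply Rmin_pos; auto.
  intros [x y] Hw.
  pose proof (Rmin_l e1 (Rmin d1 (Rmin d2 d3))). pose proof (Rmin_r e1 (Rmin d1 (Rmin d2 d3))).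
  pose proof (Rmin_l d1 (Rmin d2 d3)). pose proof (Rmin_r d1 (Rmin d2 d3)).
  pose proof (Rmin_l d2 d3). pose proof (Rmin_r d2 d3).
  replace ((x, y) - RtoC 0)%C with ((x, y) : C) in *
    by (unfold Cminus, Cplus, Copp, RtoC; simpl; f_equal; ring).
  set (m := Cmod (x, y)) in *.
  assert (Hx : Rabs x <= m) by apply (Rabs_fst_le_Cmod (x, y)).
  assert (Hy : Rabs y <= m) by apply (Rabs_snd_le_Cmod (x, y)).
  specialize (H1 x). specialize (H2 y). specialize (H3 y).
  rewrite Rminus_0_r in H1, H2, H3. rewrite exp_0 in H1. rewrite cos_0 in H2. rewrite sin_0 in H3.
  specialize (H1 ltac:(lra)). specialize (H2 ltac:(lra)). specialize (H3 ltac:(lra)).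
  assert (Hm0 : 0 <= m) by apply Cmod_ge_0.
  assert (A1 : Rabs (exp x - 1) <= 2 * m).
  { replace (exp x - 1) with ((exp x - 1 - x * 1) + x) by ring.
    eapply Rle_trans. apply Rabs_triang. pose proof (Rabs_pos x). nra. }
  assert (A2 : Rabs (exp x) <= 3).
  { replace (exp x) with ((exp x - 1) + 1) by ring. eapply Rle_trans. apply Rabs_triang.
    rewrite Rabs_R1. lra. }
  assert (A3 : Rabs (cos y) <= 1) by (apply Rabs_le; apply COS_bound).
  replace (cexp (x, y) - cexp (RtoC 0) - (x, y) * RtoC 1)%C with
    (((exp x - 1 - x * 1) * cos y + (1 + x) * (cos y - 1 - y * 0),
      exp x * (sin y - 0 - y * 1) + (exp x - 1) * y) : C).
  2:{ unfold cexp, Cminus, Cplus, Copp, Cmult, RtoC, Re, Im; simpl.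
      rewrite exp_0, cos_0, sin_0. f_equal; ring. }
  eapply Rle_trans. apply Cmod_le_Rabs.
  apply Rle_trans with ((e1 * m * 1 + 2 * (e1 * m)) + (3 * (e1 * m) + 2 * e1 * m)); [|nra].
  apply Rplus_le_compat; (eapply Rle_trans; [apply Rabs_triang|]); rewrite !Rabs_mult;
  apply Rplus_le_compat; apply Rmult_le_compat; try apply Rabs_pos; auto.
  - eapply Rle_trans. apply H1. nra.
  - eapply Rle_trans. apply Rabs_triang. rewrite Rabs_R1. lra.
  - eapply Rle_trans. apply H2. nra.
  - eapply Rle_trans. apply H3. nra.
  - lra.
Qed.

Lemma ex_derive_cexp (z : C) : ex_derive cexp z.
Proof.
  apply (ex_derive_ext (fun w => cexp z * cexp (w - z))%C).
  { intros w. rewrite <- cexp_plus. f_equal. ring. }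
  apply ex_derive_C_mult. apply ex_derive_C_const.
  apply (ex_derive_C_comp cexp (fun w => w - z)%C).
  - replace (z - z)%C with (RtoC 0) by ring. eexists. apply is_derive_cexp_0.
  - apply ex_derive_C_minus. apply ex_derive_C_id. apply ex_derive_C_const.
Qed.

Lemma is_derive_fst (p : R -> C) (t : R) (l : C) :
  @is_derive R_AbsRing C_R_NormedModule p t l -> is_derive (fun s => fst (p s)) t (fst l).
Proof.
  rewrite is_derive_R_eps, is_derive_real_eps. intros H e He.
  destruct (H e He) as (d & Hd & H'). exists d; split; [exact Hd|]. intros s Hs.
  eapply Rle_trans; [|apply (H' s Hs)].
  eapply Rle_trans; [|apply Rabs_fst_le_Cmod]. right. f_equal. simpl. ring.
Qed.

Lemma is_derive_snd (p : R -> C) (t : R) (l : C) :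
  @is_derive R_AbsRing C_R_NormedModule p t l -> is_derive (fun s => snd (p s)) t (snd l).
Proof.
  rewrite is_derive_R_eps, is_derive_real_eps. intros H e He.
  destruct (H e He) as (d & Hd & H'). exists d; split; [exact Hd|]. intros s Hs.
  eapply Rle_trans; [|apply (H' s Hs)].
  eapply Rle_trans; [|apply Rabs_snd_le_Cmod]. right. f_equal. simpl. ring.
Qed.

(** [1/(1 - t)] is the derivative of [- ln (1 - t)], so [p] and [- p] both become nonincreasing
    after adding [M * ln (1 - t)]. *)
Lemma log_lipschitz (p dp : R -> R) (M r s : R) :
  (forall t, 0 <= t < 1 -> is_derive p t (dp t)) ->
  (forall t, 0 <= t < 1 -> Rabs (dp t) <= M / (1 - t)) ->
  0 <= r < 1 -> 0 <= s < 1 ->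
  Rabs (p r - p s) <= M * Rabs (ln (1 - r) - ln (1 - s)).
Proof.
  intros Hp Hb.
  assert (G : forall r s, 0 <= r -> r <= s -> s < 1 ->
    Rabs (p r - p s) <= M * Rabs (ln (1 - r) - ln (1 - s))).
  { clear r s. intros r s Hr Hrs Hs.
    rewrite (Rabs_pos_eq (ln (1 - r) - ln (1 - s))).
    2:{ assert (ln (1 - s) <= ln (1 - r)) by (apply ln_le; lra). lra. }
    assert (K : forall sg, sg = 1 \/ sg = -1 ->
      sg * (p s - p r) + M * (ln (1 - s) - ln (1 - r)) <= 0).
    { intros sg Hsg.
      destruct (MVT_gen (fun t => sg * p t + M * ln (1 - t)) r s (fun t => sg * dp t - M / (1 - t)))
        as (c & Hc & E).
      - rewrite Rmin_left, Rmax_right by lra. intros t Ht.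
        apply (is_derive_plus (fun t => sg * p t) (fun t => M * ln (1 - t)) t (sg * dp t) (- (M / (1 - t)))).
        + apply is_derive_scal. apply Hp; lra.
        + auto_derive. lra. field. lra.
      - rewrite Rmin_left, Rmax_right by lra. intros t Ht.
        apply continuity_pt_filterlim.
        apply (@ex_derive_continuous R_AbsRing R_NormedModule (fun t => sg * p t + M * ln (1 - t)) t).
        apply (ex_derive_plus (fun t => sg * p t) (fun t => M * ln (1 - t))).
        + apply ex_derive_scal. eexists. apply Hp; lra.
        + auto_derive. lra.
      - rewrite Rmin_left, Rmax_right in Hc by lra.
        assert (sg * dp c - M / (1 - c) <= 0).
        { specialize (Hb c ltac:(lra)). revert Hb. unfold Rabs.
          destruct Rcase_abs; destruct Hsg as [-> | ->]; lra. }
        simpl in E. nra. }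
    generalize (K 1 (or_introl eq_refl)) (K (-1) (or_intror eq_refl)).
    unfold Rabs. destruct Rcase_abs; lra. }
  intros Hr Hs. destruct (Rle_dec r s).
  - apply G; lra.
  - rewrite Rabs_minus_sym, (Rabs_minus_sym (ln _)). apply G; lra.
Qed.

(** * Bloch functions along rays *)

Section Bloch.

Variables (h hp : C -> C) (M : R).
Hypothesis Hh : is_deriv_on_D h hp.
Hypothesis HM : forall z, inD z -> Cmod (h 0) + (1 - Cmod z ^ 2) * Cmod (hp z) <= M.

Lemma bloch_const_nonneg : 0 <= M.
Proof.
  generalize (HM _ inD_0) (Cmod_ge_0 (h 0)) (Cmod_ge_0 (hp 0)).
  rewrite Cmod_0. intros. lra.
Qed.

Lemma is_derive_ray (r th : R) :
  @is_derive R_AbsRing C_R_NormedModule (fun r => circ r th) r (circ 1 th).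
Proof.
  apply (is_derive_pair (fun r => r * cos th) (fun r => r * sin th)); auto_derive; auto; ring.
Qed.

Lemma bloch_ray_derivative (r th : R) : 0 <= r < 1 ->
  @is_derive R_AbsRing C_R_NormedModule (fun r => h (circ r th)) r (hp (circ r th) * circ 1 th)%C /\
  Cmod (hp (circ r th) * circ 1 th)%C <= M / (1 - r).
Proof.
  intros Hr. assert (Hz : inD (circ r th)) by (apply inD_circ; auto). split.
  - apply (is_derive_C_comp_R h (fun r => circ r th)). apply Hh; auto. apply is_derive_ray.
  - rewrite Cmod_mult, (Cmod_circ 1) by lra.
    specialize (HM _ Hz). rewrite Cmod_circ in HM by lra.
    pose proof (Cmod_ge_0 (h 0)). pose proof (Cmod_ge_0 (hp (circ r th))).
    apply (Rmult_le_reg_r (1 - r)). lra. replace (M / (1 - r) * (1 - r)) with M by (field; lra).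
    (* The Bloch factor [1 - r^2] is [(1 - r) + r (1 - r)], hence dominates [1 - r]. *)
    assert (0 <= r * (1 - r) * Cmod (hp (circ r th))) by (apply Rmult_le_pos; nra). nra.
Qed.

Lemma bloch_re_lipschitz (r s th : R) : 0 <= r < 1 -> 0 <= s < 1 ->
  Rabs (Re (h (circ r th)) - Re (h (circ s th))) <= M * Rabs (ln (1 - r) - ln (1 - s)).
Proof.
  apply (log_lipschitz (fun r => Re (h (circ r th))) (fun r => Re (hp (circ r th) * circ 1 th)%C)).
  - intros t Ht. apply (is_derive_fst (fun r => h (circ r th))). apply bloch_ray_derivative; auto.
  - intros t Ht. eapply Rle_trans. apply Rabs_fst_le_Cmod. apply bloch_ray_derivative; auto.
Qed.

Lemma bloch_im_lipschitz (r s th : R) : 0 <= r < 1 -> 0 <= s < 1 ->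
  Rabs (Im (h (circ r th)) - Im (h (circ s th))) <= M * Rabs (ln (1 - r) - ln (1 - s)).
Proof.
  apply (log_lipschitz (fun r => Im (h (circ r th))) (fun r => Im (hp (circ r th) * circ 1 th)%C)).
  - intros t Ht. apply (is_derive_snd (fun r => h (circ r th))). apply bloch_ray_derivative; auto.
  - intros t Ht. eapply Rle_trans. apply Rabs_snd_le_Cmod. apply bloch_ray_derivative; auto.
Qed.

End Bloch.

Lemma circ_0 (th : R) : circ 0 th = RtoC 0.
Proof. unfold circ, RtoC. f_equal; ring. Qed.

Lemma polar_form (z : C) : exists th, 0 <= th < 2 * PI /\ z = circ (Cmod z) th.
Proof.
  pose proof PI_RGT_0 as Hpi.
  destruct (Ceq_dec z (RtoC 0)) as [->|Hz].
  { exists 0. split. lra. now rewrite Cmod_0, circ_0. }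
  destruct z as [x y]. apply Cmod_gt_0 in Hz.
  set (m := Cmod (x, y)) in *.
  assert (Hm : m * m = x * x + y * y).
  { generalize (Cmod2_alt (x, y)). fold m. simpl. nra. }
  assert (Hx : -1 <= x / m <= 1).
  { split; apply (Rmult_le_reg_r m); auto; unfold Rdiv; rewrite Rmult_assoc, Rinv_l by lra; nra. }
  assert (E : x = m * (x / m)) by (field; lra).
  assert (Es : m * sqrt (1 - Rsqr (x / m)) = Rabs y).
  { rewrite <- (sqrt_Rsqr m) at 1 by lra. rewrite <- sqrt_mult_alt by apply Rle_0_sqr.
    rewrite <- (sqrt_Rsqr_abs y). f_equal. unfold Rsqr. field_simplify; [|lra].
    nra. }
  destruct (acos_bound (x / m)) as [B1 B2].
  destruct (Rle_dec 0 y) as [Hy|Hy].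
  - exists (acos (x / m)). split. lra. unfold circ.
    rewrite cos_acos, sin_acos, Es, <- E, Rabs_pos_eq by auto. reflexivity.
  - exists (2 * PI - acos (x / m)). split.
    (* A zero arccosine would force [y = 0]; excluding it keeps the angle strictly below
       [2 * PI]. *)
    + split. lra. cut (0 < acos (x / m)). lra.
      destruct (Rle_lt_or_eq_dec _ _ B1) as [|E0]; auto. exfalso.
      generalize (sin_acos (x / m) Hx). rewrite <- E0, sin_0. intros E1. rewrite <- E1 in Es.
      rewrite Rmult_0_r in Es. symmetry in Es. apply Rabs_eq_0 in Es. lra.
    + unfold circ. rewrite cos_minus, sin_minus, cos_2PI, sin_2PI, cos_acos, sin_acos by auto.
      f_equal. lra. replace (m * (0 * (x / m) - 1 * sqrt (1 - Rsqr (x / m))))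
        with (- (m * sqrt (1 - Rsqr (x / m)))) by ring.
      rewrite Es, Rabs_left by lra. ring.
Qed.

(** * The Volterra operator: primitives, bounds and limits *)

Section Volterra.

Variables (gp : C -> C) (Gb : R -> R).
Hypothesis Hgp : holo gp.
Hypothesis HGb : forall r z, r < 1 -> Cmod z <= r -> Cmod (gp z) <= Gb r.

Lemma contD_mult (f : C -> C) : contD f -> contD (fun z => f z * gp z)%C.
Proof.
  intros Hf z Hz. apply cont_eps. intros e He.
  assert (Hg := holo_contD _ Hgp z Hz).
  pose proof (Cmod_ge_0 (f z)) as P1. pose proof (Cmod_ge_0 (gp z)) as P2.
  set (e1 := Rmin 1 (e / (2 * (2 + Cmod (f z) + Cmod (gp z))))).
  assert (He1 : 0 < e1) by (apply Rmin_pos; [lra | apply Rdiv_lt_0_compat; lra]).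
  assert (He1' : e1 <= 1) by apply Rmin_l.
  assert (He2 : e1 * (2 + Cmod (f z) + Cmod (gp z)) <= e / 2).
  { apply Rle_trans with (e / (2 * (2 + Cmod (f z) + Cmod (gp z))) * (2 + Cmod (f z) + Cmod (gp z))).
    apply Rmult_le_compat_r. lra. apply Rmin_r. right. field. lra. }
  destruct (proj1 (cont_eps _ _) (Hf z Hz) e1 He1) as (d1 & Hd1 & H1).
  destruct (proj1 (cont_eps _ _) Hg e1 He1) as (d2 & Hd2 & H2).
  exists (Rmin d1 d2). split. apply Rmin_pos; auto. intros w Hw.
  specialize (H1 w ltac:(eapply Rlt_le_trans; [apply Hw | apply Rmin_l])).
  specialize (H2 w ltac:(eapply Rlt_le_trans; [apply Hw | apply Rmin_r])).
  replace (f w * gp w - f z * gp z)%C with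
    ((f w - f z) * (gp w - gp z) + (f z * (gp w - gp z) + gp z * (f w - f z)))%C by ring.
  eapply Rle_lt_trans. apply Cmod_triangle.
  eapply Rle_lt_trans. apply Rplus_le_compat_l. apply Cmod_triangle.
  rewrite !Cmod_mult.
  pose proof (Cmod_ge_0 (f w - f z)%C). pose proof (Cmod_ge_0 (gp w - gp z)%C). nra.
Qed.

Lemma is_CI_Tg (f : C -> C) (z : C) : contD f -> inD z ->
  is_CI (fun t => f (RtoC t * z) * gp (RtoC t * z) * z)%C 0 1 (Tg gp f z).
Proof.
  intros Hf Hz. apply CI_correct. apply ex_CI_cont.
  rewrite Rmin_left, Rmax_right by lra. intros t Ht.
  apply contR_mult; [|apply contR_const].
  assert (K := contR_segment _ _ _ t (contD_mult f Hf) inD_0 Hz Ht).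
  revert K. apply continuous_ext. intros s.
  replace (RtoC 0 + RtoC s * (z - RtoC 0))%C with (RtoC s * z)%C by ring. reflexivity.
Qed.

Lemma Tg_primitive (P f : C -> C) (z : C) : contD f ->
  is_deriv_on_D P (fun z => f z * gp z)%C -> inD z -> Tg gp f z = (P z - P (RtoC 0))%C.
Proof.
  intros Hf HP Hz. apply is_CI_unique.
  generalize (is_CI_segment P _ _ _ (contD_mult f Hf) HP inD_0 Hz).
  apply is_CI_ext. intros t _.
  replace (RtoC 0 + RtoC t * (z - RtoC 0))%C with (RtoC t * z)%C by ring.
  replace (z - RtoC 0)%C with z by ring. reflexivity.
Qed.

(** [f * g'] has a primitive on the disk, and [Tg], an integral along segments, differs from it by a
    constant. *)
Lemma is_derive_Tg (f : C -> C) : holo f ->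
  is_deriv_on_D (Tg gp f) (fun z => f z * gp z)%C.
Proof.
  intros Hf. destruct (primitive_holo (fun z => f z * gp z)%C) as [P HP].
  { intros z Hz. apply ex_derive_C_mult; auto. }
  intros z Hz. apply (is_derive_ext_loc (fun z => P z - P (RtoC 0))%C).
  - apply locally_C, locally_C_eps. destruct (inD_open z Hz) as (d & Hd & H).
    exists d. split; auto. intros w Hw. symmetry. apply Tg_primitive; auto.
    apply holo_contD; auto.
  - replace (f z * gp z)%C with (f z * gp z - RtoC 0)%C by ring.
    apply is_derive_C_minus. apply HP; auto. apply is_derive_C_const.
Qed.

Lemma Tg_bound (f : C -> C) (z : C) (r eta : R) : contD f -> r < 1 -> Cmod z <= r ->
  (forall w, Cmod w <= r -> Cmod (f w) <= eta) ->
  Cmod (Tg gp f z) <= eta * Gb r.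
Proof.
  intros Hf Hr Hz He. replace (eta * Gb r) with (eta * Gb r * Rabs (1 - 0))
    by (rewrite Rminus_0_r, Rabs_R1; ring).
  apply CI_bound. eexists; apply is_CI_Tg; auto. unfold inD; lra.
  rewrite Rmin_left, Rmax_right by lra. intros t Ht.
  pose proof (Cmod_ge_0 z) as P0.
  assert (Hw : Cmod (RtoC t * z)%C <= r).
  { rewrite Cmod_mult, Cmod_R, Rabs_pos_eq by lra. nra. }
  rewrite !Cmod_mult. specialize (He _ Hw). specialize (HGb r _ Hr Hw).
  pose proof (Cmod_ge_0 (f (RtoC t * z)%C)). pose proof (Cmod_ge_0 (gp (RtoC t * z)%C)).
  apply Rle_trans with (Cmod (f (RtoC t * z)%C) * Cmod (gp (RtoC t * z)%C) * 1).
  - apply Rmult_le_compat_l. apply Rmult_le_pos; auto. lra.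
  - rewrite Rmult_1_r. apply Rmult_le_compat; auto.
Qed.

Lemma Tg_minus (f1 f2 : C -> C) (z : C) : contD f1 -> contD f2 -> inD z ->
  Tg gp (fun z => f1 z - f2 z)%C z = (Tg gp f1 z - Tg gp f2 z)%C.
Proof.
  intros H1 H2 Hz. apply is_CI_unique.
  generalize (is_CI_minus _ _ _ _ _ _ (is_CI_Tg f1 z H1 Hz) (is_CI_Tg f2 z H2 Hz)).
  apply is_CI_ext. intros t _. ring.
Qed.

Lemma contD_minus (f1 f2 : C -> C) : contD f1 -> contD f2 -> contD (fun z => f1 z - f2 z)%C.
Proof.
  intros H1 H2 z Hz. exact (@continuous_minus C_UniformSpace C_AbsRing C_NormedModule f1 f2 z (H1 z Hz) (H2 z Hz)).
Qed.

Section Limit.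

Variables (fs : nat -> C -> C) (f : C -> C).
Hypothesis Hfs : forall n, holo (fs n).
Hypothesis Hlim : forall r e, r < 1 -> 0 < e -> exists N, forall n, (N <= n)%nat ->
      forall z, Cmod z <= r -> Cmod (fs n z - f z)%C <= e.

Lemma limit_contD : contD f.
Proof.
  intros z Hz. apply cont_eps. intros e He. unfold inD in Hz.
  destruct (Hlim ((1 + Cmod z) / 2) (e / 4) ltac:(lra) ltac:(lra)) as [N HN].
  specialize (HN N (le_n N)).
  assert (Hc := holo_contD _ (Hfs N) z Hz).
  destruct (proj1 (cont_eps _ _) Hc (e / 4) ltac:(lra)) as (d & Hd & H).
  exists (Rmin d ((1 - Cmod z) / 2)). split. apply Rmin_pos; lra. intros w Hw.
  specialize (H w ltac:(eapply Rlt_le_trans; [apply Hw | apply Rmin_l])).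
  assert (Hw2 : Cmod (w - z)%C < (1 - Cmod z) / 2) by (eapply Rlt_le_trans; [apply Hw | apply Rmin_r]).
  pose proof (Cmod_triangle_inv w z).
  assert (A := HN w ltac:(lra)). assert (B := HN z ltac:(lra)).
  replace (f w - f z)%C with ((fs N w - fs N z) - (fs N w - f w) + (fs N z - f z))%C by ring.
  eapply Rle_lt_trans. apply Cmod_triangle.
  eapply Rle_lt_trans. apply Rplus_le_compat_r. apply Cmod_triangle_minus. lra.
Qed.

(** Here [f] is known only as a locally uniform limit, hence as continuous, and [is_derive_Tg] does
    not apply. Up to an arbitrarily small error, the mean value inequality for [Tg (fs N)] has
    constants taken from [f] alone, so it passes to the limit. *)
Lemma is_derive_Tg_limit : is_deriv_on_D (Tg gp f) (fun z => f z * gp z)%C.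
Proof.
  assert (Hf := limit_contD).
  intros z Hz. apply is_derive_C_eps. intros e He.
  destruct (proj1 (cont_eps _ _) (contD_mult f Hf z Hz) e He) as (d1 & Hd1 & H1).
  destruct (inD_open z Hz) as (d2 & Hd2 & H2).
  exists (Rmin d1 d2). split. apply Rmin_pos; auto. intros w Hw.
  assert (Hw1 : Cmod (w - z)%C < d1) by (eapply Rlt_le_trans; [apply Hw | apply Rmin_l]).
  assert (Hw2 : inD w) by (apply H2; eapply Rlt_le_trans; [apply Hw | apply Rmin_r]).
  (* The slack [d] allows [N] to depend on [w]. It pays for [eta * Gb r] three times: at both
     endpoints, and in the mean value inequality with the factor [|w - z|]. *)
  apply le_epsilon. intros d Hd.
  set (r := Rmax (Cmod z) (Cmod w)).
  assert (Hr : r < 1) by (apply Rmax_lub_lt; auto).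
  assert (Hzr : Cmod z <= r) by apply Rmax_l.
  assert (Hwr : Cmod w <= r) by apply Rmax_r.
  assert (HG : 0 <= Gb r).
  { eapply Rle_trans; [apply Cmod_ge_0 | apply (HGb r z); auto]. }
  pose proof (Cmod_ge_0 (w - z)%C) as Hwz0.
  set (eta := d / ((Gb r + 1) * (2 + Cmod (w - z)%C))).
  assert (Heta : 0 < eta).
  { unfold eta. apply Rdiv_lt_0_compat; auto. apply Rmult_lt_0_compat; lra. }
  assert (Heta2 : eta * Gb r * (2 + Cmod (w - z)%C) <= d).
  { apply Rle_trans with (eta * (Gb r + 1) * (2 + Cmod (w - z)%C)).
    - apply Rmult_le_compat_r. lra. apply Rmult_le_compat_l; lra.
    - right. unfold eta. field. split; lra. }
  destruct (Hlim r eta Hr Heta) as [N HN]. specialize (HN N (le_n N)).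
  assert (Hdc : contD (fun z => fs N z - f z)%C) by (apply contD_minus; auto; apply holo_contD; auto).
  assert (T1 : Cmod (Tg gp (fs N) z - Tg gp f z)%C <= eta * Gb r).
  { rewrite <- Tg_minus by (auto; apply holo_contD; auto). apply Tg_bound; auto. }
  assert (T2 : Cmod (Tg gp (fs N) w - Tg gp f w)%C <= eta * Gb r).
  { rewrite <- Tg_minus by (auto; apply holo_contD; auto). apply Tg_bound; auto. }
  assert (T3 := primitive_segment_bound (Tg gp (fs N)) (fun z => fs N z * gp z)%C z w (f z * gp z)%C
    (e + eta * Gb r) (contD_mult _ (holo_contD _ (Hfs N))) (is_derive_Tg _ (Hfs N)) Hz Hw2).
  lapply T3; clear T3.
  2:{ intros t Ht. set (y := (z + RtoC t * (w - z))%C).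
      assert (Hyz : Cmod (y - z)%C < d1).
      { unfold y. replace (z + RtoC t * (w - z) - z)%C with (RtoC t * (w - z))%C by ring.
        rewrite Cmod_mult, Cmod_R, Rabs_pos_eq by lra. nra. }
      assert (Hyr : Cmod y <= r).
      { unfold y. replace (z + RtoC t * (w - z))%C with (RtoC (1 - t) * z + RtoC t * w)%C
          by (rewrite RtoC_minus; ring).
        eapply Rle_trans. apply Cmod_triangle. rewrite !Cmod_mult, !Cmod_R, !Rabs_pos_eq by lra. nra. }
      specialize (H1 y Hyz). specialize (HN y Hyr).
      replace (fs N y * gp y - f z * gp z)%C with
        ((f y * gp y - f z * gp z) + (fs N y - f y) * gp y)%C by ring.
      eapply Rle_trans. apply Cmod_triangle. rewrite Cmod_mult.
      apply Rplus_le_compat. lra. apply Rmult_le_compat; try apply Cmod_ge_0; auto. }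
  intros T3.
  replace (Tg gp f w - Tg gp f z - (w - z) * (f z * gp z))%C with
    ((Tg gp (fs N) w - Tg gp (fs N) z - (w - z) * (f z * gp z))
      - (Tg gp (fs N) w - Tg gp f w) + (Tg gp (fs N) z - Tg gp f z))%C by ring.
  eapply Rle_trans. apply Cmod_triangle.
  eapply Rle_trans. apply Rplus_le_compat_r. apply Cmod_triangle_minus. lra.
Qed.

End Limit.

(** Parametrised by the radius, the integral can be cut at an intermediate [t2], as in the limit
    condition. *)
Lemma is_CI_Tg_ray (f : C -> C) (t th : R) : contD f -> 0 <= t < 1 ->
  is_CI (fun r => f (circ r th) * gp (circ r th) * circ 1 th)%C 0 t (Tg gp f (circ t th)).
Proof.
  intros Hf Ht.
  assert (I : ex_CI (fun r => f (circ r th) * gp (circ r th) * circ 1 th)%C 0 t).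
  { apply ex_CI_cont. rewrite Rmin_left, Rmax_right by lra. intros r Hr.
    apply contR_mult; [|apply contR_const].
    apply (contR_comp (fun z => f z * gp z)%C (fun r => circ r th)).
    - eapply contR_derive. apply is_derive_ray.
    - apply contD_mult; auto. apply inD_circ; lra. }
  apply CI_correct in I.
  replace (Tg gp f (circ t th)) with
    (CI (fun r => f (circ r th) * gp (circ r th) * circ 1 th)%C 0 t); auto.
  symmetry. apply is_CI_unique.
  (* [is_RInt_comp_lin] expects endpoints of the form [t * s + 0]. *)
  replace 0 with (t * 0 + 0) in I at 1 by ring. replace t with (t * 1 + 0) in I at 2 by ring.
  apply (@is_RInt_comp_lin C_R_NormedModule) in I.
  revert I. apply is_CI_ext. intros s _. rewrite scal_R_Cmult.
  replace (circ (t * s + 0) th) with (RtoC s * circ t th)%C.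
  replace (circ t th) with (RtoC t * circ 1 th)%C. ring.
  all: unfold circ, RtoC, Cmult; simpl; f_equal; ring.
Qed.

End Volterra.

(** * Sufficiency *)

Lemma log_deriv_holo (gp : C -> C) : log_deriv_in_Bloch gp -> holo gp.
Proof.
  intros (h & hp & Hh & He & _) z Hz.
  apply (ex_derive_C_ext_loc (fun z => cexp (h z))).
  - destruct (inD_open z Hz) as (d & Hd & H). exists d. split; auto.
  - apply ex_derive_C_comp. apply ex_derive_cexp. eexists; apply Hh; auto.
Qed.

(** Integrating the Bloch bound along a ray gives [|g'| <= exp (Re (h 0)) * (1 - r)^(-M)] on the
    disk of radius [r]. *)
Lemma log_deriv_bound (gp : C -> C) : log_deriv_in_Bloch gp ->
  exists Gb : R -> R, forall r z, r < 1 -> Cmod z <= r -> Cmod (gp z) <= Gb r.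
Proof.
  intros (h & hp & Hh & He & M & HM).
  pose proof (bloch_const_nonneg h hp M HM) as HM0.
  exists (fun r => exp (Re (h 0) + M * (- ln (1 - r)))). intros r z Hr Hz.
  pose proof (Cmod_ge_0 z) as Hz0.
  rewrite <- (He z) by (unfold inD; lra). rewrite Cmod_cexp.
  destruct (polar_form z) as (th & _ & E).
  assert (L := bloch_re_lipschitz h hp M Hh HM (Cmod z) 0 th ltac:(lra) ltac:(lra)).
  rewrite <- E, circ_0, Rminus_0_r, ln_1, Rminus_0_r in L.
  assert (L2 : ln (1 - r) <= ln (1 - Cmod z)) by (apply ln_le; lra).
  assert (L3 : ln (1 - Cmod z) <= 0) by (rewrite <- ln_1; apply ln_le; lra).
  rewrite (Rabs_left1 (ln _)) in L by auto.
  assert (L4 : Re (h z) <= Re (h 0) + M * - ln (1 - r)).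
  { apply Rle_trans with (Re (h 0) + M * - ln (1 - Cmod z)).
    - revert L. unfold Rabs. destruct Rcase_abs; lra.
    - apply Rplus_le_compat_l, Rmult_le_compat_l; lra. }
  destruct L4 as [L4 | ->]. left; apply exp_increasing; auto. right; reflexivity.
Qed.

Lemma analytic_weight_pos (nu : C -> R) (z : C) : analytic_weight nu -> inD z -> 0 < nu z.
Proof.
  intros [[H0 _] (F & _ & HF)] Hz. destruct (HF z Hz) as (_ & E & _).
  destruct (Rle_lt_or_eq_dec _ _ (H0 z Hz)) as [|E0]; auto.
  rewrite <- E0, Rmult_0_l in E. lra.
Qed.

Lemma Cmod_RtoC (r : R) : 0 <= r -> Cmod (RtoC r) = r.
Proof. intros. rewrite Cmod_R. apply Rabs_pos_eq; auto. Qed.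

Lemma continuous_Cmod (p : R -> C) (t : R) : contR p t -> continuous (fun s => Cmod (p s)) t.
Proof.
  intros H. apply (continuous_ext (fun s => @norm R_AbsRing C_R_NormedModule (p s))).
  { intros s. symmetry. apply Cmod_norm. }
  apply (continuous_comp p (@norm R_AbsRing C_R_NormedModule) t H).
  apply (@filterlim_norm R_AbsRing C_R_NormedModule).
Qed.

Lemma continuous_weight_ray (nu : C -> R) (r : R) : weight nu -> 0 <= r < 1 ->
  continuous (fun r => nu (RtoC r)) r.
Proof.
  intros (_ & Hc & _) Hr.
  apply (@continuous_comp R_UniformSpace C_UniformSpace R_UniformSpace RtoC nu r).
  - apply (contR_horiz 0 r).
  - apply Hc. unfold inD. rewrite Cmod_RtoC; lra.
Qed.

Lemma continuous_ratio (gp : C -> C) (nu : C -> R) (r th : R) :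
  contD gp -> analytic_weight nu -> 0 <= r < 1 ->
  continuous (fun r => Cmod (gp (circ r th)) / nu (RtoC r)) r.
Proof.
  intros Hg Hnu Hr.
  apply (continuous_mult (K:=R_AbsRing) (fun r => Cmod (gp (circ r th))) (fun r => / nu (RtoC r))).
  - apply continuous_Cmod. apply (contR_comp gp (fun r => circ r th)).
    eapply contR_derive. apply is_derive_ray. apply Hg. apply inD_circ; auto.
  - apply continuous_Rinv_comp. apply continuous_weight_ray; auto. apply Hnu.
    apply Rgt_not_eq. apply analytic_weight_pos; auto. unfold inD; rewrite Cmod_RtoC; lra.
Qed.

Section Sufficiency.

Variables (gp : C -> C) (nu mu : C -> R) (Gb : R -> R).
Hypothesis Hgp : holo gp.
Hypothesis HGb : forall r z, r < 1 -> Cmod z <= r -> Cmod (gp z) <= Gb r.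
Hypothesis Hnu : analytic_weight nu.
Hypothesis Hmu : weight mu.

Lemma wnorm_le_bound (f : C -> C) (B : R) (z : C) : inD z -> wnorm_le nu f B ->
  Cmod (f z) <= B / nu z.
Proof.
  intros Hz H. pose proof (analytic_weight_pos nu z Hnu Hz).
  apply (Rmult_le_reg_l (nu z)); auto.
  replace (nu z * (B / nu z)) with B by (field; lra). apply H; auto.
Qed.

Lemma wnorm_le_bound_disk (f : C -> C) (B r : R) (z : C) : r < 1 -> Cmod z <= r ->
  wnorm_le nu f B -> Cmod (f z) <= B / nu (RtoC r).
Proof.
  intros Hr Hz H. pose proof (Cmod_ge_0 z) as Hz0.
  assert (Hz1 : inD z) by (unfold inD; lra).
  assert (Hr1 : inD (RtoC r)) by (unfold inD; rewrite Cmod_RtoC; lra).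
  pose proof (analytic_weight_pos nu _ Hnu Hz1).
  pose proof (analytic_weight_pos nu _ Hnu Hr1).
  eapply Rle_trans. apply wnorm_le_bound; eauto.
  apply Rmult_le_compat_l.
  - eapply Rle_trans; [|apply (H z Hz1)]. apply Rmult_le_pos. lra. apply Cmod_ge_0.
  - apply Rinv_le_contravar; auto. apply Hnu; auto. rewrite Cmod_RtoC; lra.
Qed.

(** The ray is cut at [t2]. Before it [f] is at most [eta], and [mu] is replaced by its maximum at
    0; after it [|f| <= B / nu] produces [Iquant]. *)
Lemma Tg_tail_bound (f : C -> C) (B eta t2 t th : R) :
  contD f -> wnorm_le nu f B -> 0 <= t2 <= t -> t < 1 ->
  (forall w, Cmod w <= t2 -> Cmod (f w) <= eta) ->
  mu (circ t th) * Cmod (Tg gp f (circ t th)) <=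
    mu (RtoC 0) * (eta * Gb t2) + B * Iquant gp nu mu t t2 th.
Proof.
  intros Hf HB Ht2 Ht He.
  assert (I := is_CI_Tg_ray gp Hgp f t th Hf ltac:(lra)).
  assert (I1 := is_CI_Tg_ray gp Hgp f t2 th Hf ltac:(lra)).
  set (p := fun r => (f (circ r th) * gp (circ r th) * circ 1 th)%C) in *.
  assert (X2 : ex_CI p t2 t).
  { apply (ex_RInt_Chasles_2 (V := C_R_CompleteNormedModule) p 0 t2 t). lra. eexists; apply I. }
  assert (E : (Tg gp f (circ t th) = Tg gp f (circ t2 th) + CI p t2 t)%C).
  { rewrite <- (is_CI_unique _ _ _ _ I). rewrite <- (is_CI_unique _ _ _ _ I1).
    apply CI_Chasles; auto. eexists; apply I1. }
  assert (Hgc := holo_contD _ Hgp).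
  assert (XR : ex_RInt (fun r => Cmod (gp (circ r th)) / nu (RtoC r)) t2 t).
  { apply (ex_RInt_continuous (V := R_CompleteNormedModule)).
    rewrite Rmin_left, Rmax_right by lra. intros r Hr. apply continuous_ratio; auto. lra. }
  assert (T1 : Cmod (Tg gp f (circ t2 th)) <= eta * Gb t2).
  { apply Tg_bound; auto. lra. right. apply Cmod_circ; lra. }
  assert (T2 : Cmod (CI p t2 t) <= B * RInt (fun r => Cmod (gp (circ r th)) / nu (RtoC r)) t2 t).
  { rewrite Cmod_norm.
    apply (norm_RInt_le p (fun r => B * (Cmod (gp (circ r th)) / nu (RtoC r))) t2 t); try lra.
    - intros r Hr. rewrite <- Cmod_norm. unfold p.
      rewrite !Cmod_mult, (Cmod_circ 1), Rmult_1_r by lra.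
      assert (Hz : inD (circ r th)) by (apply inD_circ; lra).
      assert (Hb := wnorm_le_bound f B _ Hz HB).
      destruct Hnu as [(_ & _ & Hrad & _) _].
      rewrite (Hrad _ Hz), Cmod_circ in Hb by lra.
      replace (B * (Cmod (gp (circ r th)) / nu (RtoC r))) with (B / nu (RtoC r) * Cmod (gp (circ r th)))
        by (unfold Rdiv; ring).
      apply Rmult_le_compat_r; auto. apply Cmod_ge_0.
    - apply CI_correct; auto.
    - apply (is_RInt_scal (V := R_NormedModule)). apply (RInt_correct (V := R_CompleteNormedModule)). auto. }
  destruct Hmu as (Hmu0 & _ & Hmur & Hmud).
  assert (Hz : inD (circ t th)) by (apply inD_circ; lra).
  assert (Em : mu (circ t th) = mu (RtoC t)) by (rewrite (Hmur _ Hz), Cmod_circ; auto; lra).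
  assert (Hm1 : mu (circ t th) <= mu (RtoC 0)).
  { apply Hmud; auto. apply inD_0. rewrite Cmod_0. apply Cmod_ge_0. }
  specialize (Hmu0 _ Hz).
  unfold Iquant. fold (circ t th).
  replace (RInt (fun r => Cmod (gp (r * cos th, r * sin th)) / nu (RtoC r)) t2 t)
    with (RInt (fun r => Cmod (gp (circ r th)) / nu (RtoC r)) t2 t) by reflexivity.
  rewrite E, <- Em. rewrite Em in *.
  set (J := RInt (fun r => Cmod (gp (circ r th)) / nu (RtoC r)) t2 t) in *.
  apply Rle_trans with (mu (RtoC t) * (eta * Gb t2) + mu (RtoC t) * (B * J)).
  - rewrite <- Rmult_plus_distr_l. apply Rmult_le_compat_l; auto.
    eapply Rle_trans. apply Cmod_triangle. lra.
  - apply Rplus_le_compat.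
    + apply Rmult_le_compat_r; auto. eapply Rle_trans; [apply Cmod_ge_0 | exact T1].
    + right. ring.
Qed.

Hypothesis Hlim : limit_condition gp nu mu.

(** One estimate for two purposes: boundedness takes for [eta] the bound of [f] on the disk of
    radius [t0], compactness takes a small [eta]. This works because [t0] is chosen before [f], [B]
    and [eta]. *)
Lemma Tg_uniform_smallness (e : R) : 0 < e ->
  exists t0, 0 <= t0 < 1 /\ forall f B eta, contD f -> 0 <= B -> wnorm_le nu f B ->
    (forall w, Cmod w <= t0 -> Cmod (f w) <= eta) ->
    wnorm_le mu (Tg gp f) (mu (RtoC 0) * (eta * Gb t0) + B * e).
Proof.
  intros He. destruct (Hlim e He) as (d & Hd & H).
  set (t2 := (1 + Rmax 0 d) / 2).
  assert (Hmx : 0 <= Rmax 0 d < 1) by (split; [apply Rmax_l | apply Rmax_lub_lt; lra]).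
  pose proof (Rmax_r 0 d).
  assert (Ht2 : 0 < t2 < 1 /\ d < t2) by (unfold t2; lra).
  destruct (H t2 ltac:(lra)) as (e0 & He0 & H').
  (* Beyond [e0] the limit condition bounds [Iquant] from [t2]. Cutting at the larger [t0] only
     shortens the range of integration, and the disk of radius [t0] is left to [Tg_bound]. *)
  set (t0 := Rmax t2 e0).
  assert (Ht0 : t2 <= t0 /\ e0 <= t0 /\ t0 < 1).
  { split. apply Rmax_l. split. apply Rmax_r. apply Rmax_lub_lt; lra. }
  exists t0. split. lra. intros f B eta Hf HB0 HB Heta z Hz.
  destruct (polar_form z) as (th & Hth & E).
  assert (Hmu00 : 0 <= mu (RtoC 0)) by (apply Hmu; apply inD_0).
  assert (Hmuz : 0 <= mu z <= mu (RtoC 0)).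
  { split. apply Hmu; auto. apply Hmu; auto. apply inD_0. rewrite Cmod_0. apply Cmod_ge_0. }
  assert (Heta0 : 0 <= eta).
  { eapply Rle_trans; [apply Cmod_ge_0 | apply (Heta (RtoC 0)); rewrite Cmod_0; lra]. }
  assert (HG : Gb t2 >= 0 /\ Gb t0 >= 0).
  { split; apply Rle_ge; (eapply Rle_trans; [apply Cmod_ge_0 | apply (HGb _ (RtoC 0)); rewrite ?Cmod_0; lra]). }
  destruct (Rle_dec (Cmod z) t0) as [Hz0|Hz0].
  - assert (T := Tg_bound gp Gb Hgp HGb f z t0 eta Hf ltac:(lra) Hz0 Heta).
    apply Rle_trans with (mu (RtoC 0) * (eta * Gb t0)).
    + apply Rmult_le_compat; try lra. apply Cmod_ge_0.
    + assert (0 <= B * e) by (apply Rmult_le_pos; lra). lra.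
  - unfold inD in Hz. rewrite E.
    eapply Rle_trans. apply (Tg_tail_bound f B eta t0 (Cmod z) th); auto; try lra.
    apply Rplus_le_compat_l. apply Rmult_le_compat_l; auto.
    eapply Rle_trans; [|apply (H' (Cmod z) ltac:(lra) th Hth)].
    unfold Iquant. apply Rmult_le_compat_l.
    { apply Hmu. unfold inD. rewrite Cmod_RtoC; lra. }
    assert (X : forall a b, 0 <= a -> a <= b -> b < 1 ->
      ex_RInt (fun r => Cmod (gp (circ r th)) / nu (RtoC r)) a b).
    { intros a b Ha Hab Hb. apply (ex_RInt_continuous (V := R_CompleteNormedModule)).
      rewrite Rmin_left, Rmax_right by lra. intros r Hr.
      apply continuous_ratio; auto. apply holo_contD; auto. lra. }
    change (RInt (fun r => Cmod (gp (circ r th)) / nu (RtoC r)) t0 (Cmod z) <=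
            RInt (fun r => Cmod (gp (circ r th)) / nu (RtoC r)) t2 (Cmod z)).
    rewrite <- (RInt_Chasles (V := R_CompleteNormedModule) _ t2 t0 (Cmod z)) by (apply X; lra).
    assert (0 <= RInt (fun r => Cmod (gp (circ r th)) / nu (RtoC r)) t2 t0).
    { apply RInt_ge_0. lra. apply X; lra. intros r Hr. apply Rdiv_le_0_compat. apply Cmod_ge_0.
      apply analytic_weight_pos; auto. unfold inD; rewrite Cmod_RtoC; lra. }
    unfold plus; simpl. lra.
Qed.

Lemma wnorm_le_nonneg (w : C -> R) (f : C -> C) (B : R) : weight w -> wnorm_le w f B -> 0 <= B.
Proof.
  intros Hw H. eapply Rle_trans; [|apply (H _ inD_0)].
  apply Rmult_le_pos. apply Hw, inD_0. apply Cmod_ge_0.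
Qed.

Lemma Tg_bounded (f : C -> C) (B : R) : contD f -> wnorm_le nu f B ->
  exists M, wnorm_le mu (Tg gp f) M.
Proof.
  intros Hf HB. destruct (Tg_uniform_smallness 1 Rlt_0_1) as (t0 & Ht0 & H).
  eexists. apply (H f B (B / nu (RtoC t0))); auto.
  - apply (wnorm_le_nonneg nu f); auto. apply Hnu.
  - intros w Hw. apply wnorm_le_bound_disk; auto. lra.
Qed.

Theorem limit_condition_compact : Tg_compact gp nu mu.
Proof.
  split.
  - intros f [Hf [B HB]]. split.
    + intros z Hz. eexists. apply (is_derive_Tg gp Hgp f Hf z Hz).
    + apply (Tg_bounded f B); auto. apply holo_contD; auto.
  - intros fs B Hfs.
    assert (HB : 0 <= B).
    { apply (wnorm_le_nonneg nu (fs O)). apply Hnu. apply Hfs. }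
    destruct (montel fs (fun r => B / nu (RtoC r))) as (phi & f & Hphi & Hcv).
    + intros n; apply Hfs.
    + intros n r z Hr Hz. apply wnorm_le_bound_disk; auto. apply Hfs.
    + set (fk := fun k => fs (phi k)).
      assert (Hfk : forall k, holo (fk k)) by (intros k; apply Hfs).
      assert (Hfc : contD f) by (apply (limit_contD fk f Hfk Hcv)).
      assert (HfB : wnorm_le nu f B).
      { intros z Hz. apply le_epsilon. intros e He.
        pose proof (analytic_weight_pos nu z Hnu Hz) as Hp.
        destruct (Hcv (Cmod z) (e / nu z)) as [N HN]; auto.
        { apply Rdiv_lt_0_compat; auto. }
        specialize (HN N (le_n N) z (Rle_refl _)).
        destruct (Hfs (phi N)) as [_ Hb]. specialize (Hb z Hz).
        pose proof (Cmod_triangle_inv (f z) (fs (phi N) z)) as T.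
        rewrite Cmod_minus_sym in T.
        assert (nu z * (e / nu z) = e) by (field; lra). nra. }
      exists phi, (Tg gp f). split; [exact Hphi|]. split.
      * split. intros z Hz. eexists. apply (is_derive_Tg_limit gp Gb Hgp HGb fk f Hfk Hcv z Hz).
        apply (Tg_bounded f B); auto.
      * intros eps He.
        (* [fk k - f] has norm at most [2 * B], which times this constant is at most [eps / 2]; the
           [+ 1] covers [B = 0]. The other half comes from [eta]. *)
        assert (He1 : 0 < eps / (4 * (B + 1))) by (apply Rdiv_lt_0_compat; lra).
        destruct (Tg_uniform_smallness _ He1) as (t0 & Ht0 & H).
        assert (Hmu0 : 0 <= mu (RtoC 0)) by (apply Hmu; apply inD_0).
        assert (HG : 0 <= Gb t0).
        { eapply Rle_trans; [apply Cmod_ge_0 | apply (HGb _ (RtoC 0)); rewrite ?Cmod_0; lra]. }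
        assert (HmG : 0 <= mu (RtoC 0) * Gb t0) by (apply Rmult_le_pos; auto).
        set (eta := eps / (2 * (1 + mu (RtoC 0) * Gb t0))).
        assert (Heta : 0 < eta) by (apply Rdiv_lt_0_compat; lra).
        destruct (Hcv t0 eta ltac:(lra) Heta) as [N HN].
        exists N. intros k Hk z Hz.
        assert (Hd : contD (fun z => fk k z - f z)%C).
        { apply contD_minus; auto. apply holo_contD; auto. }
        assert (HdB : wnorm_le nu (fun z => fk k z - f z)%C (2 * B)).
        { intros w Hw. apply Rle_trans with (nu w * (Cmod (fk k w) + Cmod (f w))).
          - apply Rmult_le_compat_l. apply Hnu; auto. apply Cmod_triangle_minus.
          - generalize (proj2 (Hfs (phi k)) w Hw) (HfB w Hw). unfold fk. lra. }
        specialize (H _ (2 * B) eta Hd ltac:(lra) HdB (HN k Hk) z Hz).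
        rewrite Tg_minus in H; auto. 2: apply holo_contD; auto.
        eapply Rle_trans. exact H.
        apply Rle_trans with (eps / 2 + eps / 2); [|lra].
        apply Rplus_le_compat.
        -- unfold eta. apply (Rmult_le_reg_r (2 * (1 + mu (RtoC 0) * Gb t0))). lra.
           replace (mu (RtoC 0) * (eps / (2 * (1 + mu (RtoC 0) * Gb t0)) * Gb t0) * (2 * (1 + mu (RtoC 0) * Gb t0)))
             with (eps * (mu (RtoC 0) * Gb t0)) by (field; lra).
           nra.
        -- apply (Rmult_le_reg_r (4 * (B + 1))). lra.
           replace (2 * B * (eps / (4 * (B + 1))) * (4 * (B + 1))) with (2 * B * eps) by (field; lra).
           nra.
Qed.

End Sufficiency.

(** * Test functions *)

(** For [y = e^s] with [s] real this is [1/cosh^2 (s/2)], a bump at [s = 0] of height 1. It is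
    rational, with its only pole at [-1]. *)
Definition ker (y : C) : C := (4 * y / ((1 + y) * (1 + y)))%C.

Definition kerR (y : R) : R := 4 * y / ((1 + y) * (1 + y)).

Lemma ker_RtoC (y : R) : 0 < y -> ker (RtoC y) = RtoC (kerR y).
Proof.
  intros Hy. unfold ker, kerR. rewrite RtoC_div by nra.
  rewrite !RtoC_mult, RtoC_plus. reflexivity.
Qed.

Lemma Cmod_1_plus (y : C) : 0 < Re y -> 1 + Cmod y ^ 2 <= Cmod (1 + y)%C ^ 2.
Proof.
  intros Hy. rewrite !Cmod2_alt. destruct y as [a b]. unfold Re, Im in *; simpl in *. nra.
Qed.

(** Both bounds come from [|1 + y|^2 >= 1 + |y|^2] on the right half-plane. The constant one
    controls powers of the kernel, the decaying one makes sums over geometric scales bounded. *)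
Lemma Cmod_ker (y : C) : 0 < Re y -> Cmod (ker y) <= 2 /\ Cmod (ker y) <= 4 * Rmin (Cmod y) (/ Cmod y).
Proof.
  intros Hy. pose proof (Cmod_1_plus y Hy) as H1.
  assert (Hm : 0 < Cmod y).
  { apply Cmod_gt_0. intros ->. simpl in Hy. lra. }
  assert (H0 : 0 < Cmod (1 + y)%C).
  { pose proof (Cmod_ge_0 (1 + y)%C). destruct (Req_dec (Cmod (1 + y)%C) 0) as [E|]; [|lra].
    rewrite E in H1. simpl in H1. nra. }
  assert (Hn : (1 + y)%C <> RtoC 0) by (apply Cmod_gt_0; auto).
  assert (E : Cmod (ker y) = 4 * Cmod y / (Cmod (1 + y)%C ^ 2)).
  { unfold ker. rewrite Cmod_div by (apply Cmult_neq_0; auto).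
    rewrite !Cmod_mult, Cmod_RtoC by lra. simpl. now rewrite Rmult_1_r. }
  rewrite E. set (m := Cmod y) in *. set (P := Cmod (1 + y)%C ^ 2) in *.
  replace (m ^ 2) with (m * m) in H1 by ring. clearbody P.
  assert (HP : 0 < P) by nra.
  assert (G : forall B, 4 * m <= B * P -> 4 * m / P <= B).
  { intros B HB. apply (Rmult_le_reg_r P); auto.
    replace (4 * m / P * P) with (4 * m) by (field; lra). auto. }
  split.
  - apply G. generalize (Rle_0_sqr (m - 1)). unfold Rsqr. lra.
  - rewrite Rmult_min_distr_l by lra. apply Rmin_glb; apply G.
    + nra.
    + apply Rle_trans with (4 * / m * (m * m)). right; field; lra.
      apply Rmult_le_compat_l; [|nra].
      apply Rmult_le_pos. lra. apply Rlt_le, Rinv_0_lt_compat; auto.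
Qed.

Lemma kerR_pos (y : R) : 0 < y -> 0 < kerR y.
Proof. intros Hy. unfold kerR. apply Rdiv_lt_0_compat. lra. nra. Qed.

Lemma kerR_le_min (y : R) : 0 < y -> kerR y <= 4 * Rmin y (/ y).
Proof.
  intros Hy. generalize (proj2 (Cmod_ker (RtoC y) Hy)).
  rewrite ker_RtoC, !Cmod_RtoC by (auto; try (apply Rlt_le, kerR_pos); lra). auto.
Qed.

Lemma kerR_inv (y : R) : 0 < y -> kerR (/ y) = kerR y.
Proof. intros Hy. unfold kerR. field. lra. Qed.

Lemma kerR_decr (y y' : R) : 1 <= y < y' -> kerR y' < kerR y.
Proof.
  intros H. unfold kerR.
  assert (Hp : 0 < (1 + y) * (1 + y) * ((1 + y') * (1 + y'))) by (repeat apply Rmult_lt_0_compat; lra).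
  apply (Rmult_lt_reg_r ((1 + y) * (1 + y) * ((1 + y') * (1 + y')))); auto.
  replace (4 * y' / ((1 + y') * (1 + y')) * ((1 + y) * (1 + y) * ((1 + y') * (1 + y'))))
    with (4 * y' * ((1 + y) * (1 + y))) by (field; lra).
  replace (4 * y / ((1 + y) * (1 + y)) * ((1 + y) * (1 + y) * ((1 + y') * (1 + y'))))
    with (4 * y * ((1 + y') * (1 + y'))) by (field; lra).
  assert (0 < (y' - y) * (y * y' - 1)) by (apply Rmult_lt_0_compat; nra). nra.
Qed.

Lemma kerR_exp_decr (a b : R) : 0 <= a <= b -> kerR (exp b) <= kerR (exp a).
Proof.
  intros [Ha [Hab | ->]]; [|lra].
  apply Rlt_le, kerR_decr. split.
  - rewrite <- exp_0. destruct Ha as [Ha | <-]; [left; apply exp_increasing; auto | right; auto].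
  - apply exp_increasing; auto.
Qed.

(** By the symmetry [y -> 1/y] the kernel depends on the logarithmic distance to 1 alone, so
    [kerR_exp_decr] compares values on both sides of 1. *)
Lemma kerR_abs_ln (y : R) : 0 < y -> kerR y = kerR (exp (Rabs (ln y))).
Proof.
  intros Hy. unfold Rabs. destruct Rcase_abs.
  - rewrite exp_Ropp, exp_ln, kerR_inv; auto.
  - rewrite exp_ln; auto.
Qed.

(** The terms decay geometrically on each side of the scale [q^k] closest to [X], hence a bound free
    of [X] and [N]. *)
Lemma sum_min_bound (q X : R) (N : nat) : 0 < q < 1 -> 0 < X ->
  sum_f_R0 (fun k => Rmin (X / q ^ k) (/ (X / q ^ k))) N <= 2 / (1 - q).
Proof.
  intros Hq HX.
  (* Peeling off a term replaces [X] by [X / q], so the claim is sharpened to bounds that reproduce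
     themselves: [X + (2 - q (X/q))/(1 - q)] is again [(2 - q X)/(1 - q)], and [1/X + (q/X)/(1 - q)]
     is [(1/X)/(1 - q)]. *)
  assert (G : forall N X, 0 < X ->
    (1 <= X -> sum_f_R0 (fun k => Rmin (X / q ^ k) (/ (X / q ^ k))) N <= / X / (1 - q)) /\
    (X <= 1 -> sum_f_R0 (fun k => Rmin (X / q ^ k) (/ (X / q ^ k))) N <= (2 - q * X) / (1 - q))).
  { clear N X HX. intros N; induction N; intros X HX; split; intros HX1.
    - simpl. rewrite !Rdiv_1_r. eapply Rle_trans. apply Rmin_r.
      apply (Rmult_le_reg_r (1 - q)). lra.
      replace (/ X / (1 - q) * (1 - q)) with (/ X) by (field; lra).
      assert (0 < / X) by (apply Rinv_0_lt_compat; lra). nra.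
    - simpl. rewrite !Rdiv_1_r. eapply Rle_trans. apply Rmin_l.
      apply (Rmult_le_reg_r (1 - q)). lra.
      replace ((2 - q * X) / (1 - q) * (1 - q)) with (2 - q * X) by (field; lra). nra.
    - rewrite decomp_sum by lia. simpl pred.
      rewrite (sum_eq _ (fun k => Rmin (X / q / q ^ k) (/ (X / q / q ^ k)))).
      2:{ intros i _. assert (q ^ i <> 0) by (apply pow_nonzero; lra).
          replace (X / q ^ S i) with (X / q / q ^ i) by (simpl; field; lra). reflexivity. }
      assert (HXq : 1 <= X / q).
      { apply (Rmult_le_reg_r q). lra. unfold Rdiv. rewrite Rmult_assoc, Rinv_l; lra. }
      destruct (IHN (X / q) ltac:(lra)) as [I _]. specialize (I HXq).
      apply Rle_trans with (/ X + / (X / q) / (1 - q)).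
      + apply Rplus_le_compat; auto. simpl. rewrite Rdiv_1_r. apply Rmin_r.
      + right. field. lra.
    - rewrite decomp_sum by lia. simpl pred.
      rewrite (sum_eq _ (fun k => Rmin (X / q / q ^ k) (/ (X / q / q ^ k)))).
      2:{ intros i _. assert (q ^ i <> 0) by (apply pow_nonzero; lra).
          replace (X / q ^ S i) with (X / q / q ^ i) by (simpl; field; lra). reflexivity. }
      assert (HXq0 : 0 < X / q) by (apply Rdiv_lt_0_compat; lra).
      assert (EX : X / q * q = X) by (field; lra).
      destruct (IHN (X / q) HXq0) as [I1 I2].
      assert (I0 : Rmin (X / q ^ 0) (/ (X / q ^ 0)) <= X).
      { simpl. rewrite Rdiv_1_r. apply Rmin_l. }
      destruct (Rle_dec 1 (X / q)) as [L|L].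
      + apply Rle_trans with (X + / (X / q) / (1 - q)). apply Rplus_le_compat; auto.
        apply (Rmult_le_reg_r (X * (1 - q))). nra.
        replace ((X + / (X / q) / (1 - q)) * (X * (1 - q))) with (X * X * (1 - q) + q) by (field; lra).
        replace ((2 - q * X) / (1 - q) * (X * (1 - q))) with ((2 - q * X) * X) by (field; lra).
        assert (q <= X) by nra.
        assert ((X - q) * (X - 1) <= 0) by nra. nra.
      + apply Rle_trans with (X + (2 - q * (X / q)) / (1 - q)).
        apply Rplus_le_compat; auto. apply I2; lra.
        right. field. lra. }
  destruct (G N X HX) as [G1 G2].
  assert (0 < / (1 - q)) by (apply Rinv_0_lt_compat; lra).
  destruct (Rle_dec 1 X) as [L|L].
  - eapply Rle_trans. apply G1; auto. apply Rmult_le_compat_r. lra.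
    assert (/ X <= / 1) by (apply Rinv_le_contravar; lra). lra.
  - eapply Rle_trans. apply G2; lra. apply Rmult_le_compat_r; nra.
Qed.

Fixpoint csum (F : nat -> C) (N : nat) : C :=
  match N with O => F O | S n => (csum F n + F (S n))%C end.

Lemma Cmod_csum (F : nat -> C) (b : nat -> R) (N : nat) :
  (forall k, Cmod (F k) <= b k) -> Cmod (csum F N) <= sum_f_R0 b N.
Proof.
  intros H. induction N; simpl; auto.
  eapply Rle_trans. apply Cmod_triangle. apply Rplus_le_compat; auto.
Qed.

Lemma Re_csum_mult (F : nat -> C) (w : C) (N : nat) :
  Re (csum F N * w)%C = sum_f_R0 (fun k => Re (F k * w)%C) N.
Proof.
  induction N; [reflexivity|].
  rewrite tech5, <- IHN, <- re_plus. f_equal. simpl csum. ring.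
Qed.

Lemma ex_derive_csum (F : nat -> C -> C) (N : nat) (z : C) :
  (forall k, ex_derive (F k) z) -> ex_derive (fun z => csum (fun k => F k z) N) z.
Proof.
  intros H. induction N; simpl; auto. apply ex_derive_C_plus; auto.
Qed.

Lemma sum_ge_with_peak (a b : nat -> R) (c : R) (k0 N : nat) : (k0 <= N)%nat ->
  (forall k, b k <= a k) -> b k0 + c <= a k0 -> sum_f_R0 b N + c <= sum_f_R0 a N.
Proof.
  intros Hk H H0. induction N.
  - replace k0 with O in H0 by lia. simpl. auto.
  - simpl. destruct (Nat.eq_dec k0 (S N)) as [->|].
    + assert (sum_f_R0 b N <= sum_f_R0 a N) by (apply sum_Rle; auto). lra.
    + specialize (IHN ltac:(lia)). specialize (H (S N)). lra.
Qed.

Lemma geometric_bracket (q x : R) (N : nat) : 0 < q < 1 -> q ^ N <= x <= 1 ->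
  exists k, (k <= N)%nat /\ q <= x / q ^ k <= 1.
Proof.
  intros Hq. induction N; intros Hx.
  - exists O. simpl in *. rewrite Rdiv_1_r. split; auto. lra.
  - destruct (Rle_dec (q ^ N) x) as [L|L].
    + destruct IHN as (k & Hk & H); [lra|]. exists k. split; auto.
    + exists N. split; auto. assert (0 < q ^ N) by (apply pow_lt; lra).
      simpl in Hx. split; apply (Rmult_le_reg_r (q ^ N)); auto;
      replace (x / q ^ N * q ^ N) with x by (field; lra); lra.
Qed.

Lemma cos_ge_half (v : R) : Rabs v <= 1 / 2 -> 1 / 2 <= cos v.
Proof.
  intros H. pose proof PI_4 as P4. pose proof PI2_3_2 as P3.
  assert (E : cos v = cos (Rabs v)).
  { unfold Rabs. destruct Rcase_abs; auto. now rewrite cos_neg. }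
  rewrite E, <- cos_PI3. pose proof (Rabs_pos v). apply cos_decr_1; lra.
Qed.

Lemma cos_ge_0_of_abs (v : R) : Rabs v <= 1 -> 0 <= cos v.
Proof.
  intros H. pose proof PI2_3_2 as P3. apply Rabs_le_between in H. apply cos_ge_0; lra.
Qed.

(* A discrete mollification of [exp(-iu)] in the variable [ln(1-r)]: a sum of translates of a power
   of the kernel [4y/(1+y)^2], whose poles stay outside the right half-plane. *)
Lemma phase_aligned_function (M : R) : 0 <= M ->
  exists c K, 0 < c /\ forall t1 u, t1 < 1 ->
    (forall r s, 0 <= r < 1 -> 0 <= s < 1 -> Rabs (u r - u s) <= M * Rabs (ln (1 - r) - ln (1 - s))) ->
    exists S, holo S /\ (forall z, inD z -> Cmod (S z) <= K) /\
      forall r, 0 <= r <= t1 -> c <= Re (S (RtoC r) * circ 1 (u r))%C.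
Proof.
  intros HM.
  (* Over a logarithmic distance [del] the phase turns by at most [1/2], and a turn of more than 1
     takes at least [2 * del]. The [+ 1] covers [M = 0]. *)
  set (del := 1 / (2 * (M + 1))).
  assert (Hdel : 0 < del) by (apply Rdiv_lt_0_compat; lra).
  (* The samples [1 - q^k] are spaced by [del] in the variable [ln (1 - r)]. *)
  set (q := exp (- del)).
  assert (Hq : 0 < q < 1).
  { unfold q. split. apply exp_pos. rewrite <- exp_0. apply exp_increasing. lra. }
  (* [A'] is the least value of the kernel within logarithmic distance [del], [A] the greatest
     beyond [2 * del]. As [A < A'], a suitable power [m] makes [A^m] negligible against [A'^m]; the
     constant 32 is the one that gives [HE]. *)
  set (A := kerR (exp (2 * del))). set (A' := kerR (exp del)).
  assert (HA : 0 < A) by (apply kerR_pos, exp_pos).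
  assert (HA' : 0 < A') by (apply kerR_pos, exp_pos).
  assert (HAA : A < A').
  { apply kerR_decr. split. rewrite <- exp_0. left; apply exp_increasing; lra.
    apply exp_increasing; lra. }
  assert (Hratio : 0 <= A / A' < 1).
  { split. apply Rdiv_le_0_compat; lra. apply (Rmult_lt_reg_r A'); auto.
    replace (A / A' * A') with A by (field; lra). lra. }
  destruct (pow_lt_1_zero (A / A') ltac:(rewrite Rabs_pos_eq; lra) (A' * (1 - q) / 32)) as [m Hm].
  { apply Rdiv_lt_0_compat; [apply Rmult_lt_0_compat|]; lra. }
  specialize (Hm m (le_n m)). rewrite Rabs_pos_eq in Hm by (apply pow_le; lra).
  assert (HA'm : 0 < A' ^ m) by (apply pow_lt; auto).
  assert (HAm : A ^ m <= A' ^ m * (A' * (1 - q) / 32)).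
  { replace (A ^ m) with (A' ^ m * (A / A') ^ m).
    - apply Rmult_le_compat_l; lra.
    - rewrite <- Rpow_mult_distr. f_equal. field. lra. }
  (* Of the [m + 1] kernel factors, [m] provide the smallness [A^m], and the last one the summable
     decay [4 * min (y, 1/y)]. *)
  set (E := A ^ m * 4).
  assert (HE0 : 0 <= E) by (unfold E; apply Rmult_le_pos; [apply pow_le; lra | lra]).
  assert (HE : E * (2 / (1 - q)) <= A' ^ S m / 4).
  { unfold E. apply (Rmult_le_reg_r (1 - q)). lra.
    replace (A ^ m * 4 * (2 / (1 - q)) * (1 - q)) with (8 * A ^ m) by (field; lra).
    simpl. lra. }
  (* The nearest sample contributes at least [A'^(m+1) / 2], the wrongly phased ones at worst
     [- A'^(m+1) / 4] together. Both witnesses depend on [M] only. *)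
  exists (A' ^ S m / 4), (2 ^ m * 4 * (2 / (1 - q))).
  split. { apply Rdiv_lt_0_compat. apply pow_lt; auto. lra. }
  intros t1 u Ht1 Hu.
  (* Enough samples to pass [t1], so that each [r <= t1] lies within [del] of one of them. *)
  destruct (pow_lt_1_zero q ltac:(rewrite Rabs_pos_eq; lra) (1 - t1) ltac:(lra)) as [N HN].
  specialize (HN N (le_n N)). rewrite Rabs_pos_eq in HN by (apply pow_le; lra).
  assert (Hqk : forall k, 0 < q ^ k <= 1).
  { intros k. split. apply pow_lt; lra. rewrite <- (pow1 k). apply pow_incr; lra. }
  (* The conjugate phase at the sample [1 - q^k], times a bump in [(1 - z)/q^k], which stays in the
     right half-plane for [z] in the disk. *)
  set (F := fun k (z : C) => (circ 1 (- u (1 - q ^ k)%R) * Cpow (ker ((1 - z) / RtoC (q ^ k))) (S m))%C).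
  assert (HRe : forall k z, inD z -> 0 < Re ((1 - z) / RtoC (q ^ k))%C).
  { intros k z Hz. specialize (Hqk k).
    unfold Cdiv. rewrite <- RtoC_inv by lra. rewrite re_scal_r.
    apply Rmult_lt_0_compat; [|apply Rinv_0_lt_compat; lra].
    generalize (re_le_Cmod z) (Rle_abs (Re z)). unfold inD in Hz. simpl. unfold Re. lra. }
  exists (fun z => csum (fun k => F k z) N). split; [|split].
  - intros z Hz. apply ex_derive_csum. intros k. unfold F.
    apply ex_derive_C_mult. apply ex_derive_C_const.
    apply (ex_derive_C_pow (fun z => ker ((1 - z) / RtoC (q ^ k)))%C).
    assert (D : ex_derive (fun z : C => (1 - z) / RtoC (q ^ k))%C z).
    { apply ex_derive_C_mult; [|apply ex_derive_C_const].
      apply ex_derive_C_minus. apply ex_derive_C_const. apply ex_derive_C_id. }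
    unfold ker. apply ex_derive_C_div.
    + assert (N1 : (1 + (1 - z) / RtoC (q ^ k))%C <> RtoC 0).
      { intros E0. specialize (HRe k z Hz).
        assert (Re (1 + (1 - z) / RtoC (q ^ k))%C = 0) by (rewrite E0; reflexivity).
        rewrite re_plus in H. simpl Re at 1 in H. unfold Re in *. simpl in *. lra. }
      apply Cmult_neq_0; auto.
    + apply ex_derive_C_mult; auto. apply ex_derive_C_const.
    + apply ex_derive_C_mult; apply ex_derive_C_plus; auto; apply ex_derive_C_const.
  - intros z Hz.
    set (X := Cmod (1 - z)%C).
    assert (HX : 0 < X).
    { apply Cmod_gt_0. apply neq_of_Cmod_lt. rewrite Cmod_1. exact Hz. }
    apply Rle_trans with (sum_f_R0 (fun k => 2 ^ m * 4 * Rmin (X / q ^ k) (/ (X / q ^ k))) N).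
    + apply Cmod_csum. intros k. unfold F.
      rewrite Cmod_mult, Cmod_circ, Rmult_1_l, Cmod_pow by lra.
      destruct (Cmod_ker _ (HRe k z Hz)) as [B1 B2].
      rewrite Cmod_div, Cmod_RtoC in B2 by
       (try (intros E0; apply RtoC_inj in E0); generalize (Hqk k); lra).
      fold X in B2. set (v := Cmod (ker _)) in *.
      assert (0 <= v) by apply Cmod_ge_0.
      simpl. rewrite Rmult_comm, Rmult_assoc. apply Rmult_le_compat; auto.
      apply pow_le; auto. apply pow_incr; auto.
    + rewrite (sum_eq _ (fun k => Rmin (X / q ^ k) (/ (X / q ^ k)) * (2 ^ m * 4)))
        by (intros; ring).
      rewrite <- scal_sum.
      apply Rmult_le_compat_l. apply Rmult_le_pos; [apply pow_le|]; lra.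
      apply sum_min_bound; auto.
  - intros r Hr. set (x := 1 - r).
    assert (Hx : 0 < x <= 1) by (unfold x; lra).
    rewrite Re_csum_mult.
    assert (T : forall k, Re (F k (RtoC r) * circ 1 (u r))%C =
       kerR (x / q ^ k) ^ S m * cos (u r - u (1 - q ^ k))).
    { intros k. unfold F. specialize (Hqk k).
      replace ((1 - RtoC r) / RtoC (q ^ k))%C with (RtoC (x / q ^ k)).
      2:{ unfold x. rewrite RtoC_div, RtoC_minus by lra. reflexivity. }
      rewrite ker_RtoC, <- RtoC_pow by (apply Rdiv_lt_0_compat; lra).
      replace (circ 1 (- u (1 - q ^ k)%R) * RtoC (kerR (x / q ^ k) ^ S m) * circ 1 (u r))%C
        with (RtoC (kerR (x / q ^ k) ^ S m) * (circ 1 (- u (1 - q ^ k)%R) * circ 1 (u r)))%C by ring.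
      rewrite re_scal_l. f_equal. unfold circ, Re; simpl.
      rewrite cos_minus, cos_neg, sin_neg. ring. }
    assert (V : forall k, Rabs (u r - u (1 - q ^ k)) <= (M + 1) * Rabs (ln (x / q ^ k))).
    { intros k. specialize (Hqk k). eapply Rle_trans. apply Hu; lra.
      replace (1 - (1 - q ^ k)) with (q ^ k) by ring. fold x. rewrite <- ln_div by lra.
      apply Rmult_le_compat_r. apply Rabs_pos. lra. }
    assert (Hdel2 : (M + 1) * del = 1 / 2) by (unfold del; field; lra).
    destruct (geometric_bracket q x N Hq ltac:(unfold x in *; lra)) as (k0 & Hk0 & Hb).
    (* Every sample is bounded below by its worst case [- E * min], and the nearest one exceeds it
       by [A'^(m+1) / 2]. *)
    apply Rle_trans with (sum_f_R0 (fun k => - E * Rmin (x / q ^ k) (/ (x / q ^ k))) N + A' ^ S m / 2).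
    + assert (sum_f_R0 (fun k => - E * Rmin (x / q ^ k) (/ (x / q ^ k))) N >= - (A' ^ S m / 4)).
      { rewrite (sum_eq _ (fun k => Rmin (x / q ^ k) (/ (x / q ^ k)) * - E)) by (intros; ring).
        rewrite <- scal_sum.
        pose proof (sum_min_bound q x N Hq ltac:(lra)). nra. }
      lra.
    + apply (sum_ge_with_peak _ _ _ k0); auto.
      * intros k. rewrite T. specialize (V k). specialize (Hqk k).
        assert (Hy : 0 < x / q ^ k) by (apply Rdiv_lt_0_compat; lra).
        set (y := x / q ^ k) in *. set (v := u r - u (1 - q ^ k)) in *.
        assert (Hk : 0 < kerR y) by (apply kerR_pos; auto).
        assert (Hmin : 0 <= Rmin y (/ y)).
        { apply Rmin_glb. lra. apply Rlt_le, Rinv_0_lt_compat; auto. }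
        assert (Hkp : 0 < kerR y ^ S m) by (apply pow_lt; auto).
        (* A phase error up to 1 does no harm, as its cosine is nonnegative; a larger one occurs
           only at logarithmic distance [2 * del] or more. *)
        destruct (Rle_dec (Rabs v) 1) as [L|L].
        -- pose proof (cos_ge_0_of_abs v L). nra.
        -- assert (L2 : 2 * del <= Rabs (ln y)) by nra.
           assert (Hk1 : kerR y <= A).
           { rewrite kerR_abs_ln by auto. apply kerR_exp_decr. lra. }
           assert (Hk2 : kerR y ^ S m <= E * Rmin y (/ y)).
           { unfold E. simpl. rewrite Rmult_comm, Rmult_assoc. apply Rmult_le_compat.
             apply pow_le; lra. lra. apply pow_incr; lra. apply kerR_le_min; auto. }
           destruct (COS_bound v). nra.
      * rewrite T. specialize (V k0). specialize (Hqk k0).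
        assert (Hy : 0 < x / q ^ k0) by (apply Rdiv_lt_0_compat; lra).
        set (y := x / q ^ k0) in *. set (v := u r - u (1 - q ^ k0)) in *.
        assert (Hly : Rabs (ln y) <= del).
        { assert (ln y <= 0) by (rewrite <- ln_1; apply ln_le; lra).
          assert (- del <= ln y).
          { replace (- del) with (ln q) by (unfold q; apply ln_exp). apply ln_le; lra. }
          apply Rabs_le; lra. }
        assert (Hk1 : A' <= kerR y).
        { rewrite (kerR_abs_ln y) by auto. apply kerR_exp_decr. split. apply Rabs_pos. auto. }
        assert (Hk2 : A' ^ S m <= kerR y ^ S m) by (apply pow_incr; lra).
        assert (Hk3 : 0 < A' ^ S m) by (apply pow_lt; auto).
        assert (Hv : Rabs v <= 1 / 2) by nra.
        pose proof (cos_ge_half v Hv).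
        assert (Hmin : 0 <= Rmin y (/ y)).
        { apply Rmin_glb. lra. apply Rlt_le, Rinv_0_lt_compat; auto. }
        nra.
Qed.

(** With [w = e^(-i th)] the function is [w (w z)^n F(w z) S(w z)]. The inner [w] turns the ray onto
    the real axis, where [F = 1/nu]; the outer one cancels the [e^(i th)] of [dz]. Since
    [|F z| <= F |z|], [nu * |F|] is at most 1 on the disk. That [c] and [K] precede [n], [t1] and
    [th] is the uniformity on which the necessity rests. *)
Lemma test_function (gp : C -> C) (nu : C -> R) :
  log_deriv_in_Bloch gp -> analytic_weight nu ->
  exists c K, 0 < c /\ forall n t1 th, t1 < 1 ->
    exists f, holo f /\ (forall z, inD z -> nu z * Cmod (f z) <= K * Cmod z ^ n) /\
      forall r, 0 <= r <= t1 ->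
        c * r ^ n * (Cmod (gp (circ r th)) / nu (RtoC r)) <=
        Re (f (circ r th) * gp (circ r th) * circ 1 th)%C.
Proof.
  intros (h & hp & Hh & He & M & HM) Hnu.
  destruct (phase_aligned_function M (bloch_const_nonneg h hp M HM)) as (c & K & Hc & HS).
  exists c, K. split; auto. intros n t1 th Ht1.
  destruct (HS t1 (fun r => Im (h (circ r th))) Ht1) as (S & HSh & HSK & HSr).
  { intros r s Hr Hs. apply (bloch_im_lipschitz h hp M Hh HM); auto. }
  assert (Hnu' := Hnu).
  destruct Hnu' as [(_ & _ & Hnur & _) (F & HFh & HF)].
  set (w := circ 1 (- th)).
  assert (Hw : Cmod w = 1) by (apply Cmod_circ; lra).
  assert (Hww : (w * circ 1 th)%C = RtoC 1).
  { unfold w, circ, Cmult, RtoC; simpl. rewrite cos_neg, sin_neg.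
    generalize (sin2_cos2 th). unfold Rsqr. intros. f_equal. lra. ring. }
  assert (Hmz : forall z, Cmod (w * z)%C = Cmod z).
  { intros z. rewrite Cmod_mult, Hw. ring. }
  exists (fun z => w * (Cpow (w * z) n * (F (w * z) * S (w * z))))%C. split; [|split].
  - intros z Hz.
    assert (D : ex_derive (fun z => w * z)%C z).
    { apply ex_derive_C_mult. apply ex_derive_C_const. apply ex_derive_C_id. }
    assert (Hz' : inD (w * z)%C) by (unfold inD; rewrite Hmz; exact Hz).
    apply ex_derive_C_mult. apply ex_derive_C_const.
    apply ex_derive_C_mult. apply (ex_derive_C_pow (fun z => w * z)%C); auto.
    apply ex_derive_C_mult.
    apply (ex_derive_C_comp F (fun z => w * z)%C); auto.
    apply (ex_derive_C_comp S (fun z => w * z)%C); auto.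
  - intros z Hz. assert (Hz' : inD (w * z)%C) by (unfold inD; rewrite Hmz; exact Hz).
    pose proof (analytic_weight_pos nu z Hnu Hz) as Hp.
    destruct (HF z Hz) as (_ & E1 & _).
    destruct (HF (w * z)%C Hz') as (_ & _ & E3). rewrite Hmz in E3.
    rewrite !Cmod_mult, Hw, Cmod_pow, Hmz, Rmult_1_l.
    specialize (HSK _ Hz').
    assert (E4 : nu z * Cmod (F (w * z)%C) <= 1).
    { rewrite <- E1. apply Rmult_le_compat_l; lra. }
    replace (nu z * (Cmod z ^ n * (Cmod (F (w * z)%C) * Cmod (S (w * z)%C)))) with
      ((nu z * Cmod (F (w * z)%C)) * Cmod (S (w * z)%C) * Cmod z ^ n) by ring.
    apply Rmult_le_compat_r. apply pow_le, Cmod_ge_0.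
    pose proof (Cmod_ge_0 (S (w * z)%C)).
    assert (0 <= nu z * Cmod (F (w * z)%C)) by (apply Rmult_le_pos; [lra | apply Cmod_ge_0]).
    nra.
  - intros r Hr.
    assert (Hz : inD (circ r th)) by (apply inD_circ; lra).
    assert (Hz2 : inD (RtoC r)) by (unfold inD; rewrite Cmod_RtoC; lra).
    pose proof (analytic_weight_pos nu _ Hnu Hz2) as Hp.
    assert (Ew : (w * circ r th)%C = RtoC r).
    { transitivity (RtoC r * (w * circ 1 th))%C.
      - replace (circ r th) with (RtoC r * circ 1 th)%C. ring.
        unfold circ, RtoC, Cmult; simpl; f_equal; ring.
      - rewrite Hww. ring. }
    rewrite Ew.
    assert (EF : F (RtoC r) = RtoC (/ nu (RtoC r))).
    { destruct (HF _ Hz2) as (E1 & E2 & _). rewrite Cmod_RtoC in E1, E2 by lra.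
      destruct (F (RtoC r)) as [a b]. unfold Re, Im in *; simpl in *. subst b.
      unfold RtoC. f_equal. apply (Rmult_eq_reg_l (nu (RtoC r))); [|lra].
      unfold RtoC in *. rewrite E2. field. lra. }
    (* The polar form of [g' = exp h]: its phase [Im h] is the [u] that was handed to
       [phase_aligned_function]. *)
    assert (Eg : gp (circ r th) = (RtoC (Cmod (gp (circ r th))) * circ 1 (Im (h (circ r th))))%C).
    { rewrite <- (He _ Hz), Cmod_cexp. unfold cexp, circ, RtoC, Cmult; simpl. f_equal; ring. }
    rewrite Eg at 2. rewrite EF.
    set (G := Cmod (gp (circ r th))).
    replace (w * (Cpow (RtoC r) n * (RtoC (/ nu (RtoC r)) * S (RtoC r))) *
       (RtoC G * circ 1 (Im (h (circ r th)))) * circ 1 th)%C with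
      ((w * circ 1 th) * ((Cpow (RtoC r) n * RtoC (/ nu (RtoC r)) * RtoC G)
         * (S (RtoC r) * circ 1 (Im (h (circ r th))))))%C by ring.
    rewrite Hww, Cmult_1_l, <- RtoC_pow, <- !RtoC_mult, re_scal_l.
    specialize (HSr r Hr). cbv beta in HSr.
    assert (0 <= r ^ n * / nu (RtoC r) * G).
    { apply Rmult_le_pos. apply Rmult_le_pos. apply pow_le; lra.
      apply Rlt_le, Rinv_0_lt_compat; auto. apply Cmod_ge_0. }
    replace (c * r ^ n * (G / nu (RtoC r))) with (r ^ n * / nu (RtoC r) * G * c)
      by (unfold Rdiv; ring).
    apply Rmult_le_compat_l; auto.
Qed.

(** * Necessity *)

Lemma bernoulli_pow (x : R) (n : nat) : 0 <= x <= 1 -> 1 - INR n * x <= (1 - x) ^ n.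
Proof.
  intros Hx. induction n. simpl; lra.
  rewrite S_INR, <- tech_pow_Rmult. assert (H : 0 <= (1 - x) ^ n <= 1).
  { split. apply pow_le; lra. rewrite <- (pow1 n) at 2. apply pow_incr; lra. }
  assert (x * (1 - x) ^ n <= x * 1) by (apply Rmult_le_compat_l; lra). lra.
Qed.

Section Necessity.

Variables (gp : C -> C) (nu mu : C -> R) (Gb : R -> R).
Hypothesis Hgp : holo gp.
Hypothesis HGb : forall r z, r < 1 -> Cmod z <= r -> Cmod (gp z) <= Gb r.
Hypothesis Hnu : analytic_weight nu.
Hypothesis Hmu : weight mu.

Lemma Tg_ray_lower_bound (f : C -> C) (c t1 t2 th : R) (n : nat) :
  contD f -> 0 < c -> 0 <= t2 <= t1 -> t1 < 1 -> 1 / 2 <= t2 ^ n ->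
  (forall r, 0 <= r <= t1 -> c * r ^ n * (Cmod (gp (circ r th)) / nu (RtoC r)) <=
        Re (f (circ r th) * gp (circ r th) * circ 1 th)%C) ->
  c / 2 * Iquant gp nu mu t1 t2 th <= mu (circ t1 th) * Cmod (Tg gp f (circ t1 th)).
Proof.
  intros Hf Hc Ht Ht1 Hn H.
  set (w := fun r => Cmod (gp (circ r th)) / nu (RtoC r)).
  assert (Hw : forall r, 0 <= r < 1 -> continuous w r).
  { intros r Hr. apply continuous_ratio; auto. apply holo_contD; auto. }
  assert (Hw0 : forall r, 0 <= r < 1 -> 0 <= w r).
  { intros r Hr. apply Rdiv_le_0_compat. apply Cmod_ge_0.
    apply analytic_weight_pos; auto. unfold inD; rewrite Cmod_RtoC; lra. }
  set (v := fun r => c * r ^ n * w r).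
  assert (Hv : forall a b, 0 <= a -> a <= b -> b <= t1 -> ex_RInt v a b).
  { intros a b Ha Hab Hb. apply (ex_RInt_continuous (V := R_CompleteNormedModule)).
    rewrite Rmin_left, Rmax_right by lra. intros r Hr.
    apply (continuous_mult (K:=R_AbsRing) (fun r => c * r ^ n) w).
    - apply (ex_derive_continuous (V := R_NormedModule)). auto_derive. auto.
    - apply Hw; lra. }
  assert (I := is_CI_Tg_ray gp Hgp f t1 th Hf ltac:(lra)).
  apply is_CI_pair in I. destruct I as [I _].
  assert (L1 : RInt v 0 t1 <= Re (Tg gp f (circ t1 th))).
  { apply (is_RInt_le v (fun r => Re (f (circ r th) * gp (circ r th) * circ 1 th)%C) 0 t1).
    - lra.
    - apply (RInt_correct (V := R_CompleteNormedModule)). apply Hv; lra.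
    - exact I.
    - intros r Hr. apply H. lra. }
  assert (L2 : RInt v t2 t1 <= RInt v 0 t1).
  { rewrite <- (RInt_Chasles (V := R_CompleteNormedModule) v 0 t2 t1) by (apply Hv; lra).
    assert (0 <= RInt v 0 t2).
    { apply RInt_ge_0. lra. apply Hv; lra. intros r Hr. apply Rmult_le_pos.
      apply Rmult_le_pos. lra. apply pow_le; lra. apply Hw0; lra. }
    unfold plus; simpl. lra. }
  assert (L3 : c / 2 * RInt w t2 t1 <= RInt v t2 t1).
  { apply (is_RInt_le (fun r => c / 2 * w r) v t2 t1).
    - lra.
    - apply (is_RInt_scal (V := R_NormedModule)). apply (RInt_correct (V := R_CompleteNormedModule)).
      apply (ex_RInt_continuous (V := R_CompleteNormedModule)).
      rewrite Rmin_left, Rmax_right by lra. intros r Hr. apply Hw; lra.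
    - apply (RInt_correct (V := R_CompleteNormedModule)). apply Hv; lra.
    - intros r Hr. unfold v. apply Rmult_le_compat_r. apply Hw0; lra.
      assert (t2 ^ n <= r ^ n) by (apply pow_incr; lra). nra. }
  destruct Hmu as (Hm0 & _ & Hmr & _).
  assert (Hz : inD (circ t1 th)) by (apply inD_circ; lra).
  rewrite (Hmr _ Hz), Cmod_circ by lra.
  assert (Hz1 : inD (RtoC t1)) by (unfold inD; rewrite Cmod_RtoC; lra).
  specialize (Hm0 _ Hz1).
  change (Iquant gp nu mu t1 t2 th) with (mu (RtoC t1) * RInt w t2 t1).
  replace (c / 2 * (mu (RtoC t1) * RInt w t2 t1)) with (mu (RtoC t1) * (c / 2 * RInt w t2 t1)) by ring.
  apply Rmult_le_compat_l; auto.
  generalize (re_le_Cmod (Tg gp f (circ t1 th))) (Rle_abs (Re (Tg gp f (circ t1 th)))). lra.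
Qed.

(** The factor [|z|^n] makes the images tend to 0 at each point, which identifies the limit provided
    by compactness. *)
Lemma compact_vanishing (fs : nat -> C -> C) (K : R) :
  Tg_compact gp nu mu -> (forall n, holo (fs n)) -> 0 <= K ->
  (forall n z, inD z -> nu z * Cmod (fs n z) <= K * Cmod z ^ n) ->
  forall e, 0 < e -> exists n, wnorm_le mu (Tg gp (fs n)) e.
Proof.
  intros [_ HT] Hh HK Hb e He.
  destruct (HT fs K) as (phi & h & Hphi & _ & Hcv).
  { intros n. split; auto. intros z Hz. eapply Rle_trans. apply Hb; auto.
    assert (Cmod z ^ n <= 1).
    { rewrite <- (pow1 n). apply pow_incr. split. apply Cmod_ge_0. apply Rlt_le, Hz. }
    nra. }
  (* As [mu] may vanish, the limit is identified only through [mu * |h| = 0]. *)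
  assert (H0 : forall z, inD z -> mu z * Cmod (h z) <= 0).
  { intros z Hz. apply le_epsilon. intros d Hd. rewrite Rplus_0_l.
    destruct (Hcv (d / 2) ltac:(lra)) as [N HN].
    set (r := Cmod z). assert (Hr : 0 <= r < 1) by (split; [apply Cmod_ge_0 | exact Hz]).
    assert (Hzr : inD (RtoC r)) by (unfold inD; rewrite Cmod_RtoC; lra).
    pose proof (analytic_weight_pos nu _ Hnu Hzr) as Hp.
    assert (Hm0 : 0 <= mu z) by (apply Hmu; auto).
    assert (HG : 0 <= Gb r).
    { eapply Rle_trans; [apply Cmod_ge_0 | apply (HGb r z); [lra|right; reflexivity]]. }
    set (Q := mu z * (K / nu (RtoC r) * Gb r)).
    assert (HQ : 0 <= Q).
    { apply Rmult_le_pos; auto. apply Rmult_le_pos; auto. apply Rdiv_le_0_compat; auto. }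
    destruct (pow_lt_1_zero r ltac:(rewrite Rabs_pos_eq; lra) (d / (2 * (1 + Q)))) as [N2 HN2].
    { apply Rdiv_lt_0_compat; lra. }
    set (k := max N N2).
    specialize (HN2 (phi k) ltac:(generalize (incr_ge phi Hphi k); lia)).
    rewrite Rabs_pos_eq in HN2 by (apply pow_le; lra).
    specialize (HN k ltac:(lia) z Hz). cbv beta in HN.
    assert (T : Cmod (Tg gp (fs (phi k)) z) <= K * r ^ phi k / nu (RtoC r) * Gb r).
    { apply (Tg_bound gp Gb Hgp HGb).
      - apply holo_contD; auto.
      - lra.
      - right; reflexivity.
      - intros w Hw. pose proof (Cmod_ge_0 w) as Hw0.
        assert (Hwd : inD w) by (unfold inD; lra).
        assert (Hnn : nu (RtoC r) <= nu w).
        { apply Hnu; auto. rewrite Cmod_RtoC; lra. }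
        apply (Rmult_le_reg_l (nu (RtoC r))); auto.
        replace (nu (RtoC r) * (K * r ^ phi k / nu (RtoC r))) with (K * r ^ phi k) by (field; lra).
        apply Rle_trans with (nu w * Cmod (fs (phi k) w)).
        + apply Rmult_le_compat_r; auto. apply Cmod_ge_0.
        + eapply Rle_trans. apply Hb; auto. apply Rmult_le_compat_l; auto. apply pow_incr; lra. }
    assert (T2 : mu z * Cmod (Tg gp (fs (phi k)) z) <= d / 2).
    { apply Rle_trans with (Q * r ^ phi k).
      - replace (Q * r ^ phi k) with (mu z * (K * r ^ phi k / nu (RtoC r) * Gb r))
          by (unfold Q, Rdiv; ring).
        apply Rmult_le_compat_l; auto.
      - apply Rle_trans with (Q * (d / (2 * (1 + Q)))).
        apply Rmult_le_compat_l; lra.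
        apply (Rmult_le_reg_r (2 * (1 + Q))). lra.
        replace (Q * (d / (2 * (1 + Q))) * (2 * (1 + Q))) with (Q * d) by (field; lra). nra. }
    pose proof (Cmod_triangle_inv (h z) (Tg gp (fs (phi k)) z)) as T3.
    rewrite Cmod_minus_sym in T3. nra. }
  destruct (Hcv e He) as [N HN]. exists (phi N). intros z Hz.
  specialize (HN N (le_n N) z Hz). cbv beta in HN. specialize (H0 z Hz).
  assert (Hm0 : 0 <= mu z) by (apply Hmu; auto).
  pose proof (Cmod_triangle_inv (Tg gp (fs (phi N)) z) (h z)). nra.
Qed.

(** If the condition fails for [eps], then for every [n] some test function with factor [z^n] has an
    image that exceeds [c/2 * eps] in the [mu]-norm, against [compact_vanishing]. *)
Theorem compact_limit_condition : log_deriv_in_Bloch gp ->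
  Tg_compact gp nu mu -> limit_condition gp nu mu.
Proof.
  intros Hlog HT. apply NNPP. intros Hneg.
  apply not_all_ex_not in Hneg. destruct Hneg as [eps Hneg].
  apply imply_to_and in Hneg. destruct Hneg as [He Hneg].
  destruct (test_function gp nu Hlog Hnu) as (c & K & Hc & Htest).
  (* The absolute value supplies the nonnegative bound that [compact_vanishing] asks for, as
     [test_function] gives no sign for [K]. *)
  assert (Hbad : forall n : nat, exists f z, holo f /\
    (forall w, inD w -> nu w * Cmod (f w) <= Rabs K * Cmod w ^ n) /\
    inD z /\ c / 2 * eps < mu z * Cmod (Tg gp f z)).
  { intros n. apply NNPP. intros Hn. apply Hneg.
    pose proof (pos_INR n) as Hn0.
    (* By Bernoulli's inequality [(1 - x)^n >= 1 - n x >= 1/2], so every [t2] beyond [1 - x]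
       satisfies [t2^n >= 1/2]. *)
    set (x := / (2 * (INR n + 1))).
    assert (Hx : 0 < x) by (apply Rinv_0_lt_compat; lra).
    assert (Hx2 : INR n * x <= 1 / 2 /\ x <= 1 / 2).
    { assert (x * (2 * (INR n + 1)) = 1) by (unfold x; field; lra). nra. }
    (* The ray estimate works for every [t1] beyond [t2], so without a bad function for this [n] the
       condition would hold for [eps] with [e = t2]. *)
    exists (1 - x). split. lra. intros t2 Ht2. exists t2. split. lra.
    intros t1 Ht1 th Hth. apply Rnot_lt_le. intros HI. apply Hn.
    destruct (Htest n t1 th ltac:(lra)) as (f & Hf & HfK & Hfr).
    exists f, (circ t1 th). split; auto. split; [|split].
    - intros w Hw. eapply Rle_trans. apply HfK; auto. apply Rmult_le_compat_r.
      apply pow_le, Cmod_ge_0. apply Rle_abs.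
    - apply inD_circ; lra.
    - apply Rlt_le_trans with (c / 2 * Iquant gp nu mu t1 t2 th).
      + apply Rmult_lt_compat_l; lra.
      + apply (Tg_ray_lower_bound f c t1 t2 th n); auto; try lra.
        * apply holo_contD; auto.
        * apply Rle_trans with ((1 - x) ^ n).
          -- generalize (bernoulli_pow x n ltac:(lra)). lra.
          -- apply pow_incr; lra. }
  set (fs := fun n => proj1_sig (constructive_indefinite_description _ (Hbad n))).
  assert (Hfs : forall n, exists z, holo (fs n) /\
    (forall w, inD w -> nu w * Cmod (fs n w) <= Rabs K * Cmod w ^ n) /\
    inD z /\ c / 2 * eps < mu z * Cmod (Tg gp (fs n) z)).
  { intros n. unfold fs. destruct constructive_indefinite_description; auto. }
  destruct (compact_vanishing fs (Rabs K) HT) with (e := c / 2 * eps) as [n Hn].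
  - intros n. destruct (Hfs n) as (z & H & _); auto.
  - apply Rabs_pos.
  - intros n. destruct (Hfs n) as (z & _ & H & _); auto.
  - apply Rmult_lt_0_compat; lra.
  - destruct (Hfs n) as (z & _ & _ & Hz & Hlt). specialize (Hn z Hz). lra.
Qed.

End Necessity.

Theorem theorem7 (g gp : C -> C) (nu mu : C -> R) :
  is_deriv_on_D g gp ->
  log_deriv_in_Bloch gp ->
  analytic_weight nu ->
  weight mu ->
  (Tg_compact gp nu mu <-> limit_condition gp nu mu).
Proof.
  intros _ Hlog Hnu Hmu.
  pose proof (log_deriv_holo gp Hlog) as Hgp.
  destruct (log_deriv_bound gp Hlog) as [Gb HGb].
  split.
  - apply (compact_limit_condition gp nu mu Gb); auto.
  - apply (limit_condition_compact gp nu mu Gb); auto.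
Qed.
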